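(* Let $\mu\in\mathcal{M}_{\mathrm{loc},\mathrm{unif}}(\mathbb{R})$ and put $$C_\mu:=-\liminf_{p\to\infty}\frac1p\ln\|\mu-\mu(\cdot+p)\|_{[-p,p]}.$$ Assume that $C_\mu>0$. Then $H_\mu$ does not have any eigenvalues $z\in\mathbb{C}$ with $$|z|<E_\mu:=C_\mu^2-\inf_{r>0}\|\mu\|_{\mathrm{unif},r}.$$
   Context: A local measure on $\mathbb{R}$ is a map $\mu$ from the bounded Borel subsets of $\mathbb{R}$ to $\mathbb{C}$ such that $\mathbf{1}_K\mu:=\mu(\cdot\cap K)$ is a complex Radon measure for every compact $K\subseteq\mathbb{R}$; $|\mu|$ denotes its total variation (a nonnegative Radon measure on $\mathbb{R}$). Put $\|\mu\|_{\mathrm{unif}}:=\sup_{a\in\mathbb{R}}|\mu|((a,a+1])$, and let $\mathcal{M}_{\mathrm{loc},\mathrm{unif}}(\mathbb{R})$ be the space of all local measures $\mu$ with $\|\mu\|_{\mathrm{unif}}<\infty$. For $r>0$ put $\|\mu\|_{\mathrm{unif},r}:=\frac1r\sup_{a\in\mathbb{R}}|\mu|((a,a+r])$. Let $W^1_\infty(\mathbb{R})$ denote the (complex-valued) Lipschitz continuous functions on $\mathbb{R}$. For $\mu\in\mathcal{M}_{\mathrm{loc},\mathrm{unif}}(\mathbb{R})$ and $I\subseteq\mathbb{R}$ define $$\|\mu\|_I:=\sup\Bigl\{\Bigl|\int u\,d\mu\Bigr| : u\in W^1_\infty(\mathbb{R}),\ \operatorname{spt}u\subseteq I,\ \operatorname{diam}\operatorname{spt}u\le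 2,\ \|u'\|_\infty\le 1\Bigr\}.$$ For $p\in\mathbb{R}$, $\mu(\cdot+p)$ denotes the translate $B\mapsto\mu(B+p)$. Conventions: $\ln 0=-\infty$, so that $C_\mu=\infty$ (and then $E_\mu=\infty$) is allowed. The operator $H_\mu$ in $L_2(\mathbb{R})$ is defined by $D(H_\mu):=\{u\in L_2(\mathbb{R})\cap C(\mathbb{R}) : -u''+u\mu\in L_2(\mathbb{R})\}$, $H_\mu u:=-u''+u\mu$, in the sense of distributions; i.e. for $u,f\in L_2(\mathbb{R})$, one has $u\in D(H_\mu)$ and $H_\mu u=f$ iff $u$ is continuous and $\int_{\mathbb{R}}f\varphi=-\int_{\mathbb{R}}u\varphi''+\int_{\mathbb{R}}u\varphi\,d\mu$ for all $\varphi\in C_c^\infty(\mathbb{R})$. *)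

(* Defs.v *)
From HB Require Import structures.
From mathcomp Require Import all_boot all_order all_algebra.
From mathcomp.real_closed Require Import complex.
From mathcomp Require Import all_classical all_reals all_analysis.
From mathcomp Require Import measurable_realfun.

Set Implicit Arguments.
Unset Strict Implicit.
Unset Printing Implicit Defensive.

Import Order.TTheory GRing.Theory Num.Theory.
Import numFieldNormedType.Exports.

Local Open Scope classical_set_scope.
Local Open Scope ring_scope.

(* The complex numbers are [R[i]]; [re], [im] and [cabs] take values in [R]
   (whereas the norm [`|z|] of the numeric field [R[i]] lives in [R[i]]).
   Continuity, derivatives, measurability, integrals and countable additivity
   of complex-valued objects are understood componentwise (C = R^2). *)
Notation re := complex.Re.
Notation im := complex.Im.
Notation cabs := ComplexField.Normc.normc.

Section local_measures.
Context {R : realType}.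

(* On the Borel sigma-algebra of R every complex measure is Radon, so that
   "complex Radon measure" amounts to countable additivity. *)
Definition complex_measure (nu : set R -> R[i]) : Prop :=
  [/\ nu set0 = 0,
      semi_sigma_additive
        (fun B : set (measurableTypeR R) => (re (nu B))%:E) &
      semi_sigma_additive
        (fun B : set (measurableTypeR R) => (im (nu B))%:E)].

(* Only the values on bounded Borel sets are meaningful. *)
Record local_measure := LocalMeasure {
  local_measure_fun :> set R -> R[i];
  local_measureP : forall K : set R, compact K ->
    complex_measure (fun B => local_measure_fun (B `&` K)) }.

Implicit Types (mu nu : local_measure) (B I : set R) (p r : R).

(* B + p *)
Definition shift_set B p : set R := [set b + p | b in B].

Lemma shift_setE B p : shift_set B p = (fun x => x - p) @^-1` B.
Proof.
apply/seteqP; split => [x [b Bb <-]|x Bx]; first by rewrite /= addrK.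
by exists (x - p) => //; rewrite subrK.
Qed.

Lemma shift_setI A B p :
  shift_set (A `&` B) p = shift_set A p `&` shift_set B p.
Proof. by rewrite !shift_setE. Qed.

Lemma compact_shift_set B p : compact B -> compact (shift_set B p).
Proof.
move=> cB; apply: continuous_compact => //; apply: continuous_subspaceT => x.
by apply: cvgD; [exact: cvg_id|exact: cvg_cst].
Qed.

Lemma measurable_shift_set B p :
  measurable (B : set (measurableTypeR R)) ->
  measurable (shift_set B p : set (measurableTypeR R)).
Proof.
move=> mB; rewrite shift_setE -[X in measurable X]setTI.
apply: continuous_measurable_fun => // x.
by apply: cvgB; [exact: cvg_id|exact: cvg_cst].
Qed.

Lemma semi_sigma_additive_shift (f : set R -> R) p :
  semi_sigma_additive (fun B : set (measurableTypeR R) => (f B)%:E) ->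
  semi_sigma_additive
    (fun B : set (measurableTypeR R) => (f (shift_set B p))%:E).
Proof.
move=> hf F mF tF mUF.
have -> : shift_set (\bigcup_n F n) p = \bigcup_n shift_set (F n) p.
  by rewrite shift_setE preimage_bigcup; apply: eq_bigcupr => i _;
     rewrite shift_setE.
have mG i : measurable (shift_set (F i) p : set (measurableTypeR R)).
  exact: measurable_shift_set.
apply: hf => //; last exact: bigcup_measurable.
apply/trivIsetP => i j _ _ ij; rewrite -shift_setI.
by move/trivIsetP : tF => -> //; rewrite shift_setE preimage_set0.
Qed.

Lemma semi_sigma_additiveB (f g : set R -> R) :
  semi_sigma_additive (fun B : set (measurableTypeR R) => (f B)%:E) ->
  semi_sigma_additive (fun B : set (measurableTypeR R) => (g B)%:E) ->
  semi_sigma_additive (fun B : set (measurableTypeR R) => (f B - g B)%:E).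
Proof.
move=> hf hg F mF tF mUF.
have -> : (fun n => \sum_(0 <= i < n) (f (F i) - g (F i))%:E)%E =
    (fun n => (\sum_(0 <= i < n) (f (F i))%:E)
              - \sum_(0 <= i < n) (g (F i))%:E)%E.
  by apply/funext => n; rewrite !sumEFin -EFinB sumrB.
by rewrite EFinB; apply: cvgeB => //; [exact: hf|exact: hg].
Qed.

Lemma translateP mu p (K : set R) : compact K ->
  complex_measure (fun B => mu (shift_set (B `&` K) p)).
Proof.
move=> cK; have [m0 mre mim] := local_measureP mu (@compact_shift_set K p cK).
split.
- by rewrite set0I shift_setE preimage_set0 -(set0I (shift_set K p)).
- under eq_fun do rewrite shift_setI.
  exact: (semi_sigma_additive_shift
    (f := fun B => re (mu (B `&` shift_set K p)))).
- under eq_fun do rewrite shift_setI.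
  exact: (semi_sigma_additive_shift
    (f := fun B => im (mu (B `&` shift_set K p)))).
Qed.

Definition translate mu p : local_measure :=
  LocalMeasure (local_measure_fun := fun B => mu (shift_set B p))
    (translateP mu p).

Lemma subP mu nu (K : set R) : compact K ->
  complex_measure (fun B => mu (B `&` K) - nu (B `&` K)).
Proof.
move=> cK; have [m0 mre mim] := local_measureP mu cK.
have [n0 nre nim] := local_measureP nu cK.
have reB (z w : R[i]) : re (z - w) = re z - re w by case: z; case: w.
have imB (z w : R[i]) : im (z - w) = im z - im w by case: z; case: w.
split; first by rewrite m0 n0 subrr.
- under eq_fun do rewrite reB.
  exact: (semi_sigma_additiveB (f := fun B => re (mu (B `&` K)))
                               (g := fun B => re (nu (B `&` K)))).
- under eq_fun do rewrite imB.
  exact: (semi_sigma_additiveB (f := fun B => im (mu (B `&` K)))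
                               (g := fun B => im (nu (B `&` K)))).
Qed.

Definition sub_measure mu nu : local_measure :=
  LocalMeasure (local_measure_fun := fun B => mu B - nu B) (subP mu nu).

(* |mu|(B), for bounded Borel sets B *)
Definition var_measure mu B : \bar R :=
  ereal_sup [set v | exists (n : nat) (F : 'I_n -> set R),
    [/\ forall i, measurable (F i : set (measurableTypeR R)),
        trivIset setT F, \bigcup_i F i = B &
        v = (\sum_(i < n) (cabs (mu (F i)))%:E)%E]].

Definition unif_norm mu : \bar R :=
  ereal_sup [set var_measure mu `]a, (a + 1)] | a in [set: R]].

Definition loc_unif mu : Prop := (unif_norm mu < +oo)%E.

Definition unif_norm_r mu r : \bar R :=
  (r^-1%:E *
   ereal_sup [set var_measure mu `]a, (a + r)%R] | a in [set: R]])%E.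

(* Real and imaginary part of the restriction of mu to [-n, n] *)
Definition restr_re mu (n : nat) (B : set (measurableTypeR R)) : \bar R :=
  (re (mu (B `&` `[- n%:R, n%:R])))%:E.

Definition restr_im mu (n : nat) (B : set (measurableTypeR R)) : \bar R :=
  (im (mu (B `&` `[- n%:R, n%:R])))%:E.

Section restr_charge.
Variables (mu : local_measure) (n : nat).

Let mun := local_measureP mu (@segment_compact R (- n%:R) n%:R).

Let restr_re0 : restr_re mu n set0 = 0%E.
Proof. by rewrite /restr_re; have [-> _ _] := mun. Qed.

Let restr_im0 : restr_im mu n set0 = 0%E.
Proof. by rewrite /restr_im; have [-> _ _] := mun. Qed.

Let restr_re_sigma : semi_sigma_additive (restr_re mu n).
Proof. by have [] := mun. Qed.

Let restr_im_sigma : semi_sigma_additive (restr_im mu n).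
Proof. by have [] := mun. Qed.

HB.instance Definition _ := isCharge.Build _ (measurableTypeR R) R
  (restr_re mu n) restr_re0 (fun _ _ => isT) restr_re_sigma.

HB.instance Definition _ := isCharge.Build _ (measurableTypeR R) R
  (restr_im mu n) restr_im0 (fun _ _ => isT) restr_im_sigma.

End restr_charge.

(* Integral with respect to a finite signed measure, through its Jordan
   decomposition (which does not depend on the chosen Hahn decomposition). *)
Definition charge_integral (nu : {charge set (measurableTypeR R) -> \bar R})
    (f : R -> R) : R :=
  let hahnP := projT2 (cid (Hahn_decomposition nu)) in
  let nuPN := projT2 (cid hahnP) in
  \int[jordan_pos nuPN]_x f x - \int[jordan_neg nuPN]_x f x.

(* For f with bounded support these sequences are eventually constant. *)
Definition integral_re mu (f : R -> R) : R :=
  lim (charge_integral (restr_re mu n) f @[n --> \oo]).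

Definition integral_im mu (f : R -> R) : R :=
  lim (charge_integral (restr_im mu n) f @[n --> \oo]).

(* \int g dmu, for continuous g with bounded support *)
Definition local_integral mu (g : R -> R[i]) : R[i] :=
  Complex
    (integral_re mu (fun x => re (g x)) - integral_im mu (fun x => im (g x)))
    (integral_re mu (fun x => im (g x)) + integral_im mu (fun x => re (g x))).

End local_measures.

Arguments local_measure : clear implicits.

Section functions.
Context {R : realType}.
Implicit Types (u f phi : R -> R[i]) (I : set R).

Definition spt u : set R := closure [set x | u x != 0].

(* The diameter of the empty set is -oo here. *)
Definition diam I : \bar R :=
  ereal_sup [set `|x - y|%:E | x in I & y in I].

Definition lipschitz_fun u : Prop :=
  exists L : R, forall x y, cabs (u x - u y) <= L * `|x - y|.

Definition ccontinuous u : Prop :=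
  continuous (fun x => re (u x)) /\ continuous (fun x => im (u x)).

Definition cderiven (n : nat) u (x : R) : R[i] :=
  Complex (derive1n n (fun y => re (u y)) x)
          (derive1n n (fun y => im (u y)) x).

Definition csmooth u : Prop := forall n x,
  derivable (derive1n n (fun y => re (u y))) x 1 /\
  derivable (derive1n n (fun y => im (u y))) x 1.

Definition lebesgue_cintegral f : R[i] :=
  Complex (\int[lebesgue_measure]_x re (f x))
          (\int[lebesgue_measure]_x im (f x)).

(* L_2(R); functions are not identified almost everywhere *)
Definition L2 f : Prop :=
  [/\ measurable_fun setT (fun x : measurableTypeR R => re (f x)),
      measurable_fun setT (fun x : measurableTypeR R => im (f x)) &
      (\int[lebesgue_measure]_x (cabs (f x) ^+ 2)%:E < +oo)%E].

Definition test_function phi : Prop := csmooth phi /\ compact (spt phi).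

(* A Lipschitz function is differentiable almost everywhere, and the essential
   supremum does not depend on the value given to u' elsewhere. *)
Definition sup_norm_derivative u : \bar R :=
  ('N[@lebesgue_measure R]_+oo[EFin \o (fun x => cabs (cderiven 1 u x))])%E.

End functions.

Section schroedinger.
Context {R : realType}.
Implicit Types (mu : local_measure R) (I : set R) (u f : R -> R[i]).

Definition seminorm_on mu I : \bar R :=
  ereal_sup [set (cabs (local_integral mu u))%:E | u in
    [set u : R -> R[i] | [/\ lipschitz_fun u, spt u `<=` I,
      (diam (spt u) <= 2%:E)%E & (sup_norm_derivative u <= 1)%E]]].

(* ||mu - mu(. + p)||_{[-p,p]} *)
Definition translation_defect mu (p : R) : \bar R :=
  seminorm_on (sub_measure mu (translate mu p)) `[- p, p].

(* C_mu = - liminf_{p -> oo} p^-1 ln ||mu - mu(. + p)||_{[-p,p]}; [lne] is the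
   extended logarithm, with lne 0 = -oo *)
Definition C_of mu : \bar R :=
  (- limf_einf (fun p : R => p^-1%:E * lne (translation_defect mu p))
               (pinfty_nbhs R))%E.

Definition E_of mu : \bar R :=
  (C_of mu ^+ 2 - ereal_inf [set unif_norm_r mu r | r in [set r : R | (0 < r)%R]])%E.

(* u \in D(H_mu) and H_mu u = f; the element u of L_2(R) is given by its
   continuous representative. *)
Definition H_graph mu u f : Prop :=
  [/\ L2 u, L2 f, ccontinuous u &
      forall phi : R -> R[i], test_function phi ->
        lebesgue_cintegral (fun x => f x * phi x) =
        - lebesgue_cintegral (fun x => u x * cderiven 2 phi x)
        + local_integral mu (fun x => u x * phi x)].

(* The eigenfunction is nonzero as an element of L_2(R). *)
Definition is_eigenvalue mu (z : R[i]) : Prop :=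
  exists u : R -> R[i], H_graph mu u (fun x => z * u x) /\
    ~ {ae @lebesgue_measure R, forall x, u x = 0}.

End schroedinger.

(* Main.v *)
Require Import Defs.
From HB Require Import structures.
From mathcomp Require Import all_boot all_order all_algebra.
From mathcomp.real_closed Require Import complex.
From mathcomp Require Import all_classical all_reals all_analysis.
From mathcomp Require Import measurable_realfun ess_sup_inf ring lra.

Set Implicit Arguments.
Unset Strict Implicit.
Unset Printing Implicit Defensive.

Import Order.TTheory GRing.Theory Num.Theory.
Import numFieldNormedType.Exports.
Local Open Scope classical_set_scope.
Local Open Scope complex_scope.
Local Open Scope ring_scope.

(** Gordon's argument, carried out on a grid.

    Testing [- u'' + u mu = z u] against the piecewise linear hat function
    with nodes [a < b < c] gives an exact second-order difference equation,
<<
  (u c - u b) / (c - b) - (u b - u a) / (b - a)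
    = integral of u * hat a b c  against  mu - z dx
>>
    ([hat_identity]; hats are limits of smooth combinations of ramps).  It has
    two consequences.  First, a bound of [u] on a unit interval is also a
    Lipschitz bound there, so that the square integrability of [u] forces [u]
    and its slopes to tend to 0 at infinity ([u_decay]).  Secondly, on a grid
    of mesh [h = p / N] the samples of [u] solve a difference equation with
    coefficients [m_k], the integrals of the grid hats, up to an error which
    vanishes with [h] ([sample_equation]).  States (value, slope) are thus
    propagated by transfer matrices of determinant 1.  If
    [s ^ 2 >= |z| + |mu|_(unif, r)], those over a distance [l] have entries
    at most [c e^(s l)]: after multiplying the value by [s], every step is a
    product of two shears of norms at most [e^(s h / 2)] and
    [e^(|m_k| / (2 s))], and the [|m_k|] over a distance [l] add up to about
    [s ^ 2 l] ([transfer_mx_growth], [transfer_bound]).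

    Let [s < w < C_mu]; the hypothesis on [z] provides such an [s].  There are
    arbitrarily large [p] for which the seminorm of [mu - mu(. + p)] on
    [[- p, p]] is at most [e^(- w p)].  This seminorm is dual to Lipschitz
    functions, so it does not bound the differences [m_k - m_(k + N)]
    themselves, but a primitive [q] of them: [h] times the sum of the [|q_k|]
    is [O(p ^ 2 e^(- w p))] ([small_primitive]).  Summation by parts moves the
    difference operator from [q] to the product of [u] and a row of a transfer
    matrix, both of which vary slowly along the grid ([perturbed_pairing]).
    What remains are values of [q] at the two ends of the interval, and these
    are small if the ends are chosen by averaging ([good_index]).

    Consequently there is one matrix [M], the transfer matrix over a period,
    such that the states [Y_(-1), Y_0, Y_1, Y_2] of [u] near [- p, 0, p, 2 p]
    satisfy [adj M Y_0 = Y_(-1)], [M Y_0 = Y_1], [adj M Y_1 = Y_0] and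
    [M Y_1 = Y_2] up to errors of the order [p ^ 2 e^((s - w) p)].  As
    [M + adj M = tr M], this yields
    [|Y_0| <= |Y_(-1)| + |Y_1| + |Y_2| + errors]
    ([cayley_hamilton_three_steps]).  The right-hand side tends to 0 along
    these [p] by the decay of [u], and transporting the bound from the state
    near 0 to a given point costs a factor independent of [p], so that [u]
    vanishes everywhere.  The mesh is chosen after [p], which makes the
    discretisation errors negligible. *)

(** * Riemann sums for positive measures *)

Section riemann_sums.
Context {R : realType}.
Implicit Types (f g : R -> R) (a b e : R).

Definition vanishes_outside (T : zmodType) a b (g : R -> T) :=
  forall x, (x <= a) || (b <= x) -> g x = 0.

(** Continuity is only uniform on compact sets; one unit of room on either side
    of [[a, b]] takes care of pairs of points with one of them outside. *)
Lemma uniform_continuity f a b : continuous f -> vanishes_outside a b f ->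
  forall e, 0 < e ->
  exists2 d : R, 0 < d & forall x y : R, `|x - y| < d -> `|f x - f y| <= e.
Proof.
move=> cf f0 e e0.
have K : compact `[a - 1, b + 1]%classic by exact: segment_compact.
have /compact_near_coveringP/(_ R (at_right 0)
  (fun d x => forall y, `|x - y| < d -> `|f x - f y| <= e)) := K.
case.
  move=> x _; have := cf x.
  move=> /cvgrPdist_lt/(_ (e / 2)) => /(_ ltac:(lra)) [d /= d0 hd].
  exists (ball x (d / 2), [set t | 0 < t < d / 2]) => /=.
    split; first by apply: nbhsx_ballx; lra.
    exists (d / 2) => /=; first lra.
    by move=> t /=; rewrite sub0r normrN => ht t0; rewrite t0 (le_lt_trans (ler_norm t)).
  move=> [x' t] /= []; rewrite /ball/= => hx /andP[t0 td] y hy.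
  have h1 := hd x' ltac:(rewrite /=; lra).
  have h2 : `|f x - f y| < e / 2.
    apply: hd => /=; have : `|x - y| <= `|x - x'| + `|x' - y|.
      by rewrite (le_trans _ (ler_normD _ _))// subrKA.
    by lra.
  have -> : f x' - f y = (f x - f y) - (f x - f x') by ring.
  by rewrite (le_trans (ler_normB _ _))//; lra.
move=> d0 /= d0pos H.
pose d := Num.min (d0 / 2) 1.
have dpos : 0 < d by rewrite /d lt_min; apply/andP; split; lra.
have dd0 : `|0 - d| < d0.
  by rewrite sub0r normrN gtr0_norm// /d; rewrite gt_min; apply/orP; left; lra.
exists d => // x y xy.
have d1 : d <= 1 by rewrite /d ge_min lexx orbT.
have [xI|xI] := boolP (x \in `[a - 1, b + 1]); first exact: (H d dd0 dpos x).
suff [-> ->] : f x = 0 /\ f y = 0 by rewrite subrr normr0 ltW.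
move: xI; rewrite in_itv/= negb_and -!ltNge => xI.
move: xy; rewrite ltr_norml => /andP[xy1 xy2].
by split; apply: f0; case/orP: xI => xI; apply/orP; [left|right|left|right]; lra.
Qed.

Definition node a b n k : R := a + (b - a) / n%:R * k%:R.

Lemma node0 a b n : node a b n 0 = a.
Proof. by rewrite /node mulr0 addr0. Qed.

Lemma nodenn a b n : (0 < n)%N -> node a b n n = b.
Proof.
by move=> n0; rewrite /node divfK ?pnatr_eq0 -?lt0n//; ring.
Qed.

Lemma nodeS a b n k : node a b n k.+1 = node a b n k + (b - a) / n%:R.
Proof. by rewrite /node -natr1; ring. Qed.

Lemma node_le a b n k l : a <= b -> (k <= l)%N -> node a b n k <= node a b n l.
Proof.
move=> ab kl; rewrite /node lerD2l ler_wpM2l ?ler_nat//.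
by rewrite divr_ge0 ?subr_ge0.
Qed.

Lemma riemann_measure (P : {measure set (measurableTypeR R) -> \bar R}) f a b e n d :
  a <= b -> (P `]a, b]%classic < +oo)%E -> continuous f -> vanishes_outside a b f ->
  0 <= e -> 0 < d -> (forall x y, `|x - y| < d -> `|f x - f y| <= e) ->
  (0 < n)%N -> (b - a) / n%:R < d ->
  `|\int[P]_x f x
    - \sum_(k < n) f (node a b n k.+1)
        * fine (P `]node a b n k, node a b n k.+1]%classic)|
  <= e * fine (P `]a, b]%classic).
Proof.
move=> ab Pab cf f0 e0 d0 hd n0 nd.
have mf : measurable_fun setT (f : measurableTypeR R -> _).
  exact: continuous_measurable_fun.
have -> : \int[P]_x f x = \int[P]_(x in `]a, b]) f x.
  rewrite [RHS]Rintegral_mkcond; apply: eq_Rintegral => x _.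
  rewrite patchE; case: ifPn => //.
  rewrite notin_setE /= in_itv/= => /negP; rewrite negb_and -leNgt -ltNge => h.
  by apply: f0; case/orP: h => h; rewrite ?h// (ltW h) orbT.
have Psub c1 c2 : a <= c1 -> c2 <= b -> (P `]c1, c2]%classic < +oo)%E.
  move=> h1 h2; apply: le_lt_trans Pab; apply: le_measure; rewrite ?inE//.
  by move=> x /=; rewrite !in_itv/= => /andP[? ?]; lra.
have [B fB] : exists B : R, forall x, `|f x| <= B.
  have cnf : {within `[a, b], continuous (fun x => `|f x|)}.
    apply: continuous_subspaceT => x; apply: continuous_comp; first exact: cf.
    exact: norm_continuous.
  have [c cab hc] := EVT_max ab cnf.
  exists `|f c| => x; have [xab|] := boolP (x \in `[a, b]); first exact: hc.
  rewrite in_itv/= negb_and -!ltNge => h; rewrite f0 ?normr0//.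
  by case/orP: h => h; rewrite (ltW h) ?orbT.
have bint (h : R -> R) c1 c2 (B' : R) : a <= c1 -> c2 <= b ->
    measurable_fun setT (h : measurableTypeR R -> _) -> (forall x, `|h x| <= B') ->
    P.-integrable `]c1, c2]%classic (EFin \o h).
  move=> h1 h2 mh hB; apply: measurable_bounded_integrable => //.
  - exact: Psub.
  - exact: measurable_funS mh.
  - by exists B'; split; rewrite ?num_real// => M BM x _ /=; apply: le_trans (hB x) (ltW BM).
suff : forall m, (m <= n)%N ->
  `|\int[P]_(x in `]a, node a b n m]%classic) f x
    - \sum_(k < m) f (node a b n k.+1)
        * fine (P `]node a b n k, node a b n k.+1]%classic)|
  <= e * fine (P `]a, node a b n m]%classic).
  by move=> /(_ n (leqnn n)); rewrite nodenn.
elim=> [_|m IH mn].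
  by rewrite node0 big_ord0 set_itvoc0 Rintegral_set0 measure0 subrr normr0 mulr0.
rewrite big_ord_recr/=.
set s := node a b n m; set t := node a b n m.+1.
have as_ : a <= s by rewrite -(node0 a b n) node_le.
have st : s <= t by rewrite node_le.
have tb : t <= b by rewrite -[X in _ <= X](nodenn a b n0) node_le.
have eqU : `]a, t]%classic = `]a, s]%classic `|` `]s, t]%classic.
  apply/seteqP; split=> x /=; rewrite !in_itv/=.
    by case: (leP x s) => h /andP[h1 h2]; [left|right]; lra.
  by case=> /andP[? ?]; lra.
have disj : `]a, s]%classic `&` `]s, t]%classic = set0.
  by apply/seteqP; split=> x // [] /=; rewrite !in_itv/= => /andP[? ?] /andP[? ?]; lra.
rewrite eqU Rintegral_setU//; last 2 first.
- by rewrite -eqU; apply: bint mf fB.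
- exact/eqP.
rewrite measureU//.
rewrite fineD ?ge0_fin_numE//; [|by apply: Psub; lra|exact: Psub].
rewrite mulrDr opprD addrACA (le_trans (ler_normD _ _))// lerD//.
  exact: IH (ltnW mn).
pose c := f t.
have mfc : measurable_fun setT ((fun x => f x - c) : measurableTypeR R -> _).
  exact: measurable_funB.
have fcB x : `|f x - c| <= B + B.
  by apply: le_trans (ler_normB _ _) _; apply: lerD; exact: fB.
rewrite -(Rintegral_cst P (measurable_itv _) c) -RintegralB//; last 2 first.
- exact: bint mf fB.
- by apply: (@bint _ _ _ `|c|) => //.
apply: (le_trans (le_normr_Rintegral _ _)) => //.
  exact: bint mfc fcB.
rewrite -(Rintegral_cst P (measurable_itv _) e); apply: le_Rintegral => //.
- apply: (@bint _ _ _ (B + B)) => //; first exact: measurableT_comp.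
  by move=> x; rewrite normr_id.
- by apply: (@bint _ _ _ `|e|) => //.
move=> x /=; rewrite in_itv/= => /andP[sx xt]; apply: hd.
rewrite ltr_norml; have := nodeS a b n m; rewrite -/s -/t => h.
by apply/andP; split; lra.
Qed.
End riemann_sums.

(** * Modulus of complex numbers, and Riemann sums with complex weights *)

Section complex_modulus.
Context {R : realType}.
Implicit Types (x y z : R[i]).

Lemma cabs_ge0 z : 0 <= cabs z.
Proof. by case: z => a b /=; exact: sqrtr_ge0. Qed.

Lemma cabs0 : cabs (0 : R[i]) = 0.
Proof. exact: ComplexField.Normc.normc0. Qed.

Lemma cabs1 : cabs (1 : R[i]) = 1.
Proof. exact: ComplexField.Normc.normc1. Qed.

Lemma cabsM x y : cabs (x * y) = cabs x * cabs y.
Proof. exact: ComplexField.Normc.normcM. Qed.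

Lemma cabsN x : cabs (- x) = cabs x.
Proof. by case: x => a b /=; rewrite !sqrrN. Qed.

Lemma cabsE z : (cabs z)%:C = `|z|.
Proof. by case: z. Qed.

Lemma cabsD x y : cabs (x + y) <= cabs x + cabs y.
Proof. by rewrite -lecR rmorphD/= !cabsE ler_normD. Qed.

Lemma cabsB x y : cabs (x - y) <= cabs x + cabs y.
Proof. by rewrite -(cabsN y) cabsD. Qed.

Lemma cabs_distC x y : cabs (x - y) = cabs (y - x).
Proof. by rewrite -cabsN opprB. Qed.

Lemma cabs_real (a : R) : cabs a%:C = `|a|.
Proof. by rewrite /= expr0n/= addr0 sqrtr_sqr. Qed.

Lemma cabs_eq0 z : cabs z = 0 -> z = 0.
Proof. exact: ComplexField.Normc.eq0_normc. Qed.

Lemma cabs_sum (I : Type) (r : seq I) (P : pred I) (F : I -> R[i]) :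
  cabs (\sum_(i <- r | P i) F i) <= \sum_(i <- r | P i) cabs (F i).
Proof.
elim/big_rec2: _ => [|i a z _ h]; first by rewrite cabs0.
by rewrite (le_trans (cabsD _ _))// lerD2l.
Qed.

Lemma cabs_le_re_im z : cabs z <= `|re z| + `|im z|.
Proof.
case: z => a b /=; rewrite -[leRHS]ger0_norm ?addr_ge0// -sqrtr_sqr.
by rewrite ler_wsqrtr// sqrrD !real_normK ?num_real// lerD2r lerDl mulrn_wge0// mulr_ge0.
Qed.

Lemma re_le_cabs z : `|re z| <= cabs z.
Proof.
by case: z => a b /=; rewrite -sqrtr_sqr ler_wsqrtr// lerDl sqr_ge0.
Qed.

Lemma im_le_cabs z : `|im z| <= cabs z.
Proof.
by case: z => a b /=; rewrite -sqrtr_sqr ler_wsqrtr// lerDr sqr_ge0.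
Qed.

Lemma cabs_small_eq0 z (C : R) : (forall e, 0 < e -> cabs z <= C * e) -> z = 0.
Proof.
move=> h; apply: cabs_eq0; apply/eqP; rewrite eq_le cabs_ge0 andbT.
apply/ler_addgt0Pl => e e0; rewrite addr0.
have C0 : 0 < `|C| + 1 by rewrite ltr_wpDl.
apply: le_trans (h (e / (`|C| + 1)) _) _; first exact: divr_gt0.
rewrite mulrA ler_pdivrMr// mulrC ler_wpM2l ?(ltW e0)//.
by rewrite (le_trans (ler_norm _))// lerDl.
Qed.

Lemma sum_re (I : Type) (r : seq I) (P : pred I) (F : I -> R[i]) :
  re (\sum_(i <- r | P i) F i) = \sum_(i <- r | P i) re (F i).
Proof. by elim/big_rec2: _ => //= i a [x y] _ <-; case: (F i). Qed.

Lemma sum_im (I : Type) (r : seq I) (P : pred I) (F : I -> R[i]) :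
  im (\sum_(i <- r | P i) F i) = \sum_(i <- r | P i) im (F i).
Proof. by elim/big_rec2: _ => //= i a [x y] _ <-; case: (F i). Qed.

End complex_modulus.

Section riemann_integrals.
Context {R : realType}.
Implicit Types (f : R -> R) (g : R -> R[i]) (a b e : R) (k : R -> R -> R[i]).

(** A weight [k x y] stands for the measure of the half-open cell from [x] to
    [y]. *)
Definition riemann_sum k g a b n : R[i] :=
  \sum_(i < n) g (node a b n i.+1) * k (node a b n i) (node a b n i.+1).

Definition riemann_cvg k a b g (l : R[i]) := forall e, 0 < e ->
  exists n0 : nat, forall n, (n0 <= n)%N -> cabs (l - riemann_sum k g a b n) <= e.

Lemma riemann_cvg_unique k a b g l l' :
  riemann_cvg k a b g l -> riemann_cvg k a b g l' -> l = l'.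
Proof.
move=> h h'; apply/eqP; rewrite -subr_eq0; apply/eqP/(@cabs_small_eq0 _ _ 2) => e e0.
have [n0 H] := h e e0; have [n1 H'] := h' e e0.
have {}H := H (maxn n0 n1) (leq_maxl _ _); have {}H' := H' (maxn n0 n1) (leq_maxr _ _).
rewrite -(subrKA (riemann_sum k g a b (maxn n0 n1))) (le_trans (cabsD _ _))//.
by rewrite mulr2n mulrDl mul1r lerD// cabs_distC.
Qed.

Lemma riemann_cvgD k a b g g' l l' : riemann_cvg k a b g l ->
  riemann_cvg k a b g' l' -> riemann_cvg k a b (fun x => g x + g' x) (l + l').
Proof.
move=> h h' e e0.
have [n0 H] := h (e / 2) ltac:(lra); have [n1 H'] := h' (e / 2) ltac:(lra).
exists (maxn n0 n1) => n; rewrite geq_max => /andP[n0n n1n].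
have -> : riemann_sum k (fun x => g x + g' x) a b n = riemann_sum k g a b n + riemann_sum k g' a b n.
  by rewrite -big_split; apply: eq_bigr => i _; rewrite mulrDl.
rewrite opprD addrACA (le_trans (cabsD _ _))//.
by have := H n n0n; have := H' n n1n; lra.
Qed.

Lemma riemann_cvgZ k a b g l (c : R[i]) : riemann_cvg k a b g l ->
  riemann_cvg k a b (fun x => c * g x) (c * l).
Proof.
move=> h e e0; have C0 : 0 < cabs c + 1 by rewrite ltr_wpDl ?cabs_ge0.
have [n0 H] := h (e / (cabs c + 1)) (divr_gt0 e0 C0).
exists n0 => n /H {}H.
have -> : riemann_sum k (fun x => c * g x) a b n = c * riemann_sum k g a b n.
  by rewrite mulr_sumr; apply: eq_bigr => i _; rewrite mulrA.
rewrite -mulrBr cabsM (le_trans (ler_wpM2l (cabs_ge0 _) H))//.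
by rewrite mulrA ler_pdivrMr// mulrC ler_wpM2l ?(ltW e0)// lerDl.
Qed.

Lemma riemann_cvg_kernel k k' a b g l l' (c : R[i]) : riemann_cvg k a b g l ->
  riemann_cvg k' a b g l' ->
  riemann_cvg (fun x y => k x y - c * k' x y) a b g (l - c * l').
Proof.
move=> h h'; have h'' := riemann_cvgZ (- c) h'.
move=> e e0.
have [n0 H] := h (e / 2) ltac:(lra); have [n1 H'] := h'' (e / 2) ltac:(lra).
exists (maxn n0 n1) => n; rewrite geq_max => /andP[n0n n1n].
have -> : riemann_sum (fun x y => k x y - c * k' x y) g a b n =
    riemann_sum k g a b n + riemann_sum k' (fun x => - c * g x) a b n.
  by rewrite -big_split; apply: eq_bigr => i _ /=; ring.
have -> : forall u v : R[i], l - c * l' - (u + v) = (l - u) + (- c * l' - v).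
  by move=> u v; ring.
rewrite (le_trans (cabsD _ _))//.
by have := H n n0n; have := H' n n1n; lra.
Qed.

Lemma small_cells a b d : a <= b -> 0 < d ->
  exists n0 : nat, forall n, (n0 <= n)%N -> (0 < n)%N /\ (b - a) / n%:R < d.
Proof.
move=> ab d0; have := archi_boundP (divr_ge0 (_ : 0 <= b - a) (ltW d0)).
rewrite subr_ge0 => /(_ ab); set m := Num.bound _ => Hm.
exists m.+1 => n mn; have n0 : (0 < n)%N by exact: leq_trans mn.
split=> //; rewrite ltr_pdivrMr ?ltr0n// mulrC -ltr_pdivrMr//.
by rewrite (lt_le_trans Hm)// ler_nat ltnW.
Qed.

(** The total mass of the Jordan decomposition serves as constant: it depends
    neither on the function nor on the subdivision. *)
Lemma charge_riemann (nu : {charge set (measurableTypeR R) -> \bar R}) :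
  exists2 V : R, 0 <= V &
  forall f a b e n d, a <= b -> continuous f -> vanishes_outside a b f ->
  0 <= e -> 0 < d -> (forall x y, `|x - y| < d -> `|f x - f y| <= e) ->
  (0 < n)%N -> (b - a) / n%:R < d ->
  `|charge_integral nu f
    - \sum_(k < n) f (node a b n k.+1)
        * fine (nu `]node a b n k, node a b n k.+1]%classic)| <= e * V.
Proof.
rewrite /charge_integral.
move: (projT2 (cid (projT2 (cid (Hahn_decomposition nu))))) => nuPN.
have fin (Q : {finite_measure set (measurableTypeR R) -> \bar R}) A :
    measurable A -> (Q A < +oo)%E.
  by move=> mA; rewrite ltey_eq fin_num_measure.
exists (fine (jordan_pos nuPN setT) + fine (jordan_neg nuPN setT)).
  by rewrite addr_ge0// fine_ge0.
move=> f a b e n d ab cf f0 e0 d0 hd n0 nd.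
have leT (Q : {finite_measure set (measurableTypeR R) -> \bar R}) :
    e * fine (Q `]a, b]%classic) <= e * fine (Q setT).
  rewrite ler_wpM2l// fine_le ?ge0_fin_numE ?fin//.
  by apply: le_measure; rewrite ?inE.
have hp := @riemann_measure R (jordan_pos nuPN) f a b e n d ab (fin _ _ (measurable_itv _)) cf f0 e0 d0 hd n0 nd.
have hn := @riemann_measure R (jordan_neg nuPN) f a b e n d ab (fin _ _ (measurable_itv _)) cf f0 e0 d0 hd n0 nd.
have {}hp := le_trans hp (leT (jordan_pos nuPN)).
have {}hn := le_trans hn (leT (jordan_neg nuPN)).
have -> : \sum_(k < n) f (node a b n k.+1)
        * fine (nu `]node a b n k, node a b n k.+1]%classic) =
   \sum_(k < n) f (node a b n k.+1)
        * fine (jordan_pos nuPN `]node a b n k, node a b n k.+1]%classic) -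
   \sum_(k < n) f (node a b n k.+1)
        * fine (jordan_neg nuPN `]node a b n k, node a b n k.+1]%classic).
  rewrite -sumrB; apply: eq_bigr => i _; rewrite -mulrBr; congr (_ * _).
  have -> := jordan_decomp nuPN (measurable_itv `]node a b n i, node a b n i.+1]).
  rewrite /cadd/= cscaleN1 fineD ?fineN//.
  - by rewrite ge0_fin_numE// fin.
  - by rewrite fin_numN ge0_fin_numE// fin.
rewrite mulrDr.
have -> : forall x y u v : R, (x - y) - (u - v) = (x - u) - (y - v).
  by move=> x y u v; ring.
by rewrite (le_trans (ler_normB _ _))// lerD.
Qed.

End riemann_integrals.

(** * Integrals against a local measure as limits of Riemann sums *)

Section local_integrals.
Context {R : realType}.
Implicit Types (f : R -> R) (g : R -> R[i]) (a b e : R) (k : R -> R -> R[i]).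

(** The charges [c m] are truncations that agree on [[a, b]] from some [m] on.
    Both integrals are limits of the same Riemann sums, so the sequence of
    integrals is eventually constant and its limit is the limit of these
    sums. *)
Lemma lim_charge_riemann (c : nat -> {charge set (measurableTypeR R) -> \bar R})
    (rho : set R -> R) a b f : a <= b ->
  (exists m0 : nat, forall m, (m0 <= m)%N -> forall B : set R, B `<=` `[a, b] ->
    c m B = (rho B)%:E) ->
  continuous f -> vanishes_outside a b f -> forall e, 0 < e ->
  exists n0 : nat, forall n, (n0 <= n)%N ->
  `|lim (charge_integral (c m) f @[m --> \oo])
    - \sum_(i < n) f (node a b n i.+1)
        * rho `]node a b n i, node a b n i.+1]%classic| <= e.
Proof.
move=> ab [m0 cE] cf f0.
have cell n i : (i < n)%N -> `]node a b n i, node a b n i.+1]%classic `<=` `[a, b].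
  move=> ni x /=; rewrite !in_itv/= => /andP[h1 h2].
  have n0 : (0 < n)%N by exact: leq_ltn_trans ni.
  rewrite (le_trans _ (ltW h1)) -1?[X in X <= _](node0 a b n) ?node_le//=.
  by rewrite (le_trans h2)// -[X in _ <= X](nodenn a b n0) node_le.
have appr m : (m0 <= m)%N -> forall e, 0 < e -> exists n0 : nat, forall n, (n0 <= n)%N ->
  `|charge_integral (c m) f
    - \sum_(i < n) f (node a b n i.+1)
        * rho `]node a b n i, node a b n i.+1]%classic| <= e.
  move=> mm e e0; have [V V0 hV] := charge_riemann (c m).
  have V1 : 0 < V + 1 by rewrite ltr_wpDl.
  have e'0 : 0 < e / (V + 1) by rewrite divr_gt0.
  have [d d0 hd] := uniform_continuity cf f0 e'0.
  have [n0 hn0] := small_cells ab d0.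
  exists n0 => n /hn0[npos nd].
  have := hV f a b _ n d ab cf f0 (ltW e'0) d0 hd npos nd.
  have -> : \sum_(i < n) f (node a b n i.+1) *
      fine (c m `]node a b n i, node a b n i.+1]%classic) =
    \sum_(i < n) f (node a b n i.+1) * rho `]node a b n i, node a b n i.+1]%classic.
    by apply: eq_bigr => i _; rewrite cE//; exact: cell.
  move=> h; apply: (le_trans h); rewrite mulrAC ler_pdivrMr//.
  by rewrite ler_wpM2l ?(ltW e0)// lerDl.
have cst m : (m0 <= m)%N -> charge_integral (c m) f = charge_integral (c m0) f.
  move=> mm; apply/eqP; rewrite -subr_eq0 -normr_eq0 eq_le normr_ge0 andbT.
  apply/ler_addgt0Pl => e e0; rewrite addr0.
  have [n1 h1] := appr m mm (e / 2) ltac:(lra).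
  have [n2 h2] := appr m0 (leqnn _) (e / 2) ltac:(lra).
  have {}h1 := h1 (maxn n1 n2) (leq_maxl _ _); have {}h2 := h2 (maxn n1 n2) (leq_maxr _ _).
  move: h1 h2; set S := \sum_(i < _) _ => h1 h2.
  have -> : charge_integral (c m) f - charge_integral (c m0) f =
    (charge_integral (c m) f - S) - (charge_integral (c m0) f - S) by ring.
  by rewrite (le_trans (ler_normB _ _))//; lra.
have -> : lim (charge_integral (c m) f @[m --> \oo]) = charge_integral (c m0) f.
  apply: cvg_lim => //; apply: cvg_near_cst.
  by exists m0 => // m /= mm; exact: cst.
exact: appr.
Qed.

Lemma restr_subset a b : exists m0 : nat, forall m, (m0 <= m)%N ->
  forall B : set R, B `<=` `[a, b] -> B `&` `[- m%:R, m%:R] = B.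
Proof.
have [m1 h1] : exists m1 : nat, `|a| + `|b| <= m1%:R.
  by exists (Num.bound (`|a| + `|b|)); rewrite ltW// archi_boundP// addr_ge0.
exists m1 => m mm B Bab; apply/setIidPl => x /Bab /=; rewrite !in_itv/= => /andP[ax xb].
have {}h1 : `|a| + `|b| <= m%:R by rewrite (le_trans h1)// ler_nat.
have := ler_norm (- a); have := ler_norm b; have := normr_ge0 a; have := normr_ge0 b.
by rewrite normrN => *; apply/andP; split; lra.
Qed.

Definition measure_cell (mu : local_measure R) (x y : R) : R[i] := mu `]x, y]%classic.

Definition length_cell (x y : R) : R[i] := (y - x)%:C.

Lemma re_riemann_sum k g a b n : re (riemann_sum k g a b n) =
  \sum_(i < n) re (g (node a b n i.+1)) * re (k (node a b n i) (node a b n i.+1)) -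
  \sum_(i < n) im (g (node a b n i.+1)) * im (k (node a b n i) (node a b n i.+1)).
Proof.
rewrite /riemann_sum sum_re -sumrB; apply: eq_bigr => i _.
by case: (g _) => ? ?; case: (k _ _).
Qed.

Lemma im_riemann_sum k g a b n : im (riemann_sum k g a b n) =
  \sum_(i < n) im (g (node a b n i.+1)) * re (k (node a b n i) (node a b n i.+1)) +
  \sum_(i < n) re (g (node a b n i.+1)) * im (k (node a b n i) (node a b n i.+1)).
Proof.
rewrite /riemann_sum sum_im -big_split; apply: eq_bigr => i _.
by case: (g _) => x y; case: (k _ _) => z w /=; rewrite addrC.
Qed.

Lemma vanishes_re a b g : vanishes_outside a b g ->
  vanishes_outside a b (fun x => re (g x)).
Proof. by move=> g0 x /g0 ->. Qed.

Lemma vanishes_im a b g : vanishes_outside a b g ->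
  vanishes_outside a b (fun x => im (g x)).
Proof. by move=> g0 x /g0 ->. Qed.

(** The definition of the integral, through Jordan decompositions of truncations,
    is awkward for algebra; linearity, bounds by the variation and translation
    are read off from these Riemann sums instead. *)
Lemma local_integral_riemann mu g a b : a <= b -> ccontinuous g ->
  vanishes_outside a b g ->
  riemann_cvg (measure_cell mu) a b g (local_integral mu g).
Proof.
move=> ab [cr ci] g0 e e0.
have Hre f : continuous f -> vanishes_outside a b f -> forall e, 0 < e ->
    exists n0 : nat, forall n, (n0 <= n)%N -> `|integral_re mu f -
     \sum_(i < n) f (node a b n i.+1) *
        re (measure_cell mu (node a b n i) (node a b n i.+1))| <= e.
  move=> cf f0.
  apply: (lim_charge_riemann (c := fun m => restr_re mu m) (rho := fun B => re (mu B))) => //.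
  have [m0 h] := restr_subset a b; exists m0 => m mm B Bab.
  by rewrite /= /restr_re h.
have Him f : continuous f -> vanishes_outside a b f -> forall e, 0 < e ->
    exists n0 : nat, forall n, (n0 <= n)%N -> `|integral_im mu f -
     \sum_(i < n) f (node a b n i.+1) *
        im (measure_cell mu (node a b n i) (node a b n i.+1))| <= e.
  move=> cf f0.
  apply: (lim_charge_riemann (c := fun m => restr_im mu m) (rho := fun B => im (mu B))) => //.
  have [m0 h] := restr_subset a b; exists m0 => m mm B Bab.
  by rewrite /= /restr_im h.
have e4 : 0 < e / 4 by lra.
have [n1 h1] := Hre _ cr (vanishes_re g0) _ e4.
have [n2 h2] := Him _ ci (vanishes_im g0) _ e4.
have [n3 h3] := Hre _ ci (vanishes_im g0) _ e4.
have [n4 h4] := Him _ cr (vanishes_re g0) _ e4.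
exists (maxn (maxn n1 n2) (maxn n3 n4)) => n.
rewrite !geq_max => /andP[/andP[/h1 {}h1 /h2 {}h2] /andP[/h3 {}h3 /h4 {}h4]].
rewrite (le_trans (cabs_le_re_im _))//.
have -> : forall z w : R[i], re (z - w) = re z - re w by move=> [? ?] [? ?].
have -> : forall z w : R[i], im (z - w) = im z - im w by move=> [? ?] [? ?].
rewrite re_riemann_sum im_riemann_sum /=.
move: h1 h2 h3 h4.
set s1 := \sum_(i < n) _; set s2 := \sum_(i < n) _.
set s3 := \sum_(i < n) _; set s4 := \sum_(i < n) _ => h1 h2 h3 h4.
have E : e = (e / 4 + e / 4) + (e / 4 + e / 4) by field.
rewrite [leRHS]E; apply: lerD.
  have -> : forall x y u v : R, (x - y) - (u - v) = (x - u) - (y - v).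
    by move=> *; ring.
  by rewrite (le_trans (ler_normB _ _))// lerD.
rewrite opprD addrACA.
by rewrite (le_trans (ler_normD _ _))// lerD.
Qed.

Lemma lebesgue_integral_riemann g a b : a <= b -> ccontinuous g ->
  vanishes_outside a b g ->
  riemann_cvg length_cell a b g (lebesgue_cintegral g).
Proof.
move=> ab [cr ci] g0 e e0.
have H f : continuous f -> vanishes_outside a b f -> forall e, 0 < e ->
    exists n0 : nat, forall n, (n0 <= n)%N -> `|\int[lebesgue_measure]_x f x -
     \sum_(i < n) f (node a b n i.+1) *
        re (length_cell (node a b n i) (node a b n i.+1))| <= e.
  move=> cf f0 e' e'0.
  have V1 : 0 < b - a + 1 by lra.
  have [d d0 hd] := uniform_continuity cf f0 (divr_gt0 e'0 V1).
  have [n0 hn0] := small_cells ab d0.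
  exists n0 => n /hn0[npos nd].
  have lenE (x y : R) : x <= y -> lebesgue_measure `]x, y]%classic = (y - x)%:E.
    move=> xy; rewrite lebesgue_measure_itv/= lte_fin; case: ltP => // yx.
    by congr EFin; lra.
  have lfin : (lebesgue_measure `]a, b]%classic < +oo)%E by rewrite lenE// ltry.
  have h := @riemann_measure R lebesgue_measure f a b _ n d ab lfin cf f0 (ltW (divr_gt0 e'0 V1)) d0 hd npos nd.
  have -> : \sum_(i < n) f (node a b n i.+1) *
        re (length_cell (node a b n i) (node a b n i.+1)) =
     \sum_(k < n) f (node a b n k.+1) *
        fine (lebesgue_measure `]node a b n k, node a b n k.+1]%classic).
    by apply: eq_bigr => i _; rewrite lenE// node_le.
  apply: (le_trans h); rewrite [X in _ * X](_ : _ = b - a); last first.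
    exact: (congr1 fine (lenE _ _ ab)).
  by rewrite mulrAC ler_pdivrMr// ler_wpM2l ?(ltW e'0)//; lra.
have [n1 h1] := H _ cr (vanishes_re g0) (e / 2) ltac:(lra).
have [n2 h2] := H _ ci (vanishes_im g0) (e / 2) ltac:(lra).
exists (maxn n1 n2) => n.
rewrite !geq_max => /andP[/h1 {}h1 /h2 {}h2].
rewrite (le_trans (cabs_le_re_im _))//.
have -> : forall z w : R[i], re (z - w) = re z - re w by move=> [? ?] [? ?].
have -> : forall z w : R[i], im (z - w) = im z - im w by move=> [? ?] [? ?].
rewrite re_riemann_sum im_riemann_sum /=.
rewrite [X in _ - (_ - X)]big1 ?subr0; last by move=> i _; rewrite mulr0.
rewrite [X in _ - (_ + X)]big1 ?addr0; last by move=> i _; rewrite mulr0.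
have E : e = e / 2 + e / 2 by field.
by rewrite [leRHS]E; apply: lerD.
Qed.

End local_integrals.

(** * The functional of integration against mu - z dx *)

Section continuous_functions.
Context {R : realType}.
Implicit Types (f : R -> R) (g : R -> R[i]) (a b : R).

Lemma ccontinuousD g g' : ccontinuous g -> ccontinuous g' ->
  ccontinuous (fun x => g x + g' x).
Proof.
move=> [gr gi] [gr' gi']; split=> x.
  rewrite (_ : (fun _ => _) = fun x => re (g x) + re (g' x)); last first.
    by apply/funext => y; case: (g y) (g' y) => ? ? [? ?].
  by apply: cvgD; [exact: gr|exact: gr'].
rewrite (_ : (fun _ => _) = fun x => im (g x) + im (g' x)); last first.
  by apply/funext => y; case: (g y) (g' y) => ? ? [? ?].
by apply: cvgD; [exact: gi|exact: gi'].
Qed.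

Lemma ccontinuousM g g' : ccontinuous g -> ccontinuous g' ->
  ccontinuous (fun x => g x * g' x).
Proof.
move=> [gr gi] [gr' gi']; split=> x.
  rewrite (_ : (fun _ => _) = fun x => re (g x) * re (g' x) - im (g x) * im (g' x)); last first.
    by apply/funext => y; case: (g y) (g' y) => ? ? [? ?].
  by apply: cvgB; apply: cvgM; [exact: gr|exact: gr'|exact: gi|exact: gi'].
rewrite (_ : (fun _ => _) = fun x => re (g x) * im (g' x) + im (g x) * re (g' x)); last first.
  by apply/funext => y; case: (g y) (g' y) => ? ? [? ?].
by apply: cvgD; apply: cvgM; [exact: gr|exact: gi'|exact: gi|exact: gr'].
Qed.

Lemma ccontinuous_cst (c : R[i]) : ccontinuous (fun _ : R => c).
Proof. by split=> x; exact: cvg_cst. Qed.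

Lemma ccontinuous_real f : continuous f -> ccontinuous (fun x => (f x)%:C).
Proof. by move=> cf; split=> x /=; [exact: cf|exact: cvg_cst]. Qed.

Lemma ccontinuous_sum (m : nat) (g : 'I_m -> R -> R[i]) :
  (forall i, ccontinuous (g i)) -> ccontinuous (fun x => \sum_(i < m) g i x).
Proof.
elim: m g => [|m IH] g cg.
  by under eq_fun do rewrite big_ord0; exact: ccontinuous_cst.
by under eq_fun do rewrite big_ord_recr/=; apply: ccontinuousD => //; exact: IH.
Qed.

Lemma vanishes_shift (g : R -> R[i]) a b p : vanishes_outside a b g ->
  vanishes_outside (a + p) (b + p) (fun x => g (x - p)).
Proof. by move=> g0 x h; apply: g0; rewrite lerBlDr lerBrDr. Qed.

Lemma ccontinuous_shift g p : ccontinuous g -> ccontinuous (fun x => g (x - p)).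
Proof.
move=> [gr gi]; split=> x.
  apply: (@continuous_comp _ _ _ (fun y => y - p) (fun x => re (g x))); last exact: gr.
  by apply: cvgB; [exact: cvg_id|exact: cvg_cst].
apply: (@continuous_comp _ _ _ (fun y => y - p) (fun x => im (g x))); last exact: gi.
by apply: cvgB; [exact: cvg_id|exact: cvg_cst].
Qed.

End continuous_functions.

Definition variation_bound {R : realType} (mu : local_measure R) (r V : R) :=
  forall y : R, (var_measure mu `]y, (y + r)%R] <= V%:E)%E.

Section perturbed_functional.
Context {R : realType}.
Variables (mu : local_measure R) (z : R[i]).
Implicit Types (f : R -> R) (g : R -> R[i]) (a b e r V : R).

Definition shifted_cell x y : R[i] := measure_cell mu x y - z * length_cell x y.

Definition shifted_integral g : R[i] := local_integral mu g - z * lebesgue_cintegral g.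

Lemma shifted_integral_riemann g a b : a <= b -> ccontinuous g -> vanishes_outside a b g ->
  riemann_cvg shifted_cell a b g (shifted_integral g).
Proof.
move=> ab cg g0; apply: riemann_cvg_kernel.
  exact: local_integral_riemann.
exact: lebesgue_integral_riemann.
Qed.

(** Subdivisions are finite partitions into Borel sets, hence compete in the
    supremum which defines the variation. *)
Lemma sum_measure_cells V r x n : (var_measure mu `]x, (x + r)%R] <= V%:E)%E ->
  0 < r -> (0 < n)%N ->
  \sum_(i < n) cabs (measure_cell mu (node x (x + r) n i) (node x (x + r) n i.+1))
  <= V.
Proof.
move=> hV r0 n0; rewrite -lee_fin; apply: le_trans hV.
apply: ereal_sup_ubound; exists n, (fun i : 'I_n => `]node x (x + r) n i, node x (x + r) n i.+1]%classic).
have nle i j : (i <= j)%N -> node x (x + r) n i <= node x (x + r) n j.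
  by apply: node_le; lra.
split.
- by move=> i; exact: measurable_itv.
- apply/trivIsetP => i j _ _ ij; apply/seteqP; split=> // t [] /=.
  rewrite !in_itv/= => /andP[h1 h2] /andP[h3 h4].
  have [h|h|h] := ltngtP i j.
  + by have := nle _ _ h; lra.
  + by have := nle _ _ h; lra.
  + by move/negP: ij; apply; apply/eqP/val_inj.
- apply/seteqP; split=> t /=.
    move=> [i _] /=; rewrite !in_itv/= => /andP[h1 h2].
    have := nle 0%N i (leq0n _); have := nle i.+1 n (ltn_ord i).
    by rewrite node0 nodenn// => *; apply/andP; split; lra.
  rewrite in_itv/= => /andP[h1 h2].
  have hex : exists m, t <= node x (x + r) n m by exists n; rewrite nodenn.
  case: (ex_minnP hex) => m transfer_mx mmin.
  have m0 : (0 < m)%N.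
    by rewrite lt0n; apply/eqP => E; move: transfer_mx; rewrite E node0; lra.
  have mn : (m <= n)%N by apply: mmin; rewrite nodenn.
  have mpn : (m.-1 < n)%N by rewrite prednK.
  exists (Ordinal mpn) => //=; rewrite in_itv/= prednK// transfer_mx andbT ltNge.
  by apply/negP => /mmin; rewrite leqNgt prednK ?leqnn.
- by rewrite sumEFin.
Qed.

Lemma sum_shifted_cells V r x n : (var_measure mu `]x, (x + r)%R] <= V%:E)%E ->
  0 < r -> (0 < n)%N ->
  \sum_(i < n) cabs (shifted_cell (node x (x + r) n i) (node x (x + r) n i.+1))
  <= V + cabs z * r.
Proof.
move=> hV r0 n0.
apply: (@le_trans _ _ (\sum_(i < n)
  (cabs (measure_cell mu (node x (x + r) n i) (node x (x + r) n i.+1)) +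
   cabs z * (r / n%:R)))).
  apply: ler_sum => i _; rewrite /shifted_cell (le_trans (cabsB _ _))// lerD2l.
  rewrite cabsM ler_wpM2l ?cabs_ge0// /length_cell cabs_real nodeS.
  have -> : x + r - x = r by ring.
  by rewrite addrAC subrr add0r ger0_norm// divr_ge0// ltW.
rewrite big_split/= lerD ?sum_measure_cells//.
rewrite sumr_const card_ord -[leLHS]mulr_natr -mulrA divfK//.
by rewrite pnatr_eq0 -lt0n.
Qed.

(** Used to split a subdivision of a long interval into subdivisions of blocks of
    length [r], on each of which the variation is bounded. *)
Lemma sum_blocks (F : nat -> R) K n :
  \sum_(i < K * n) F i = \sum_(j < K) \sum_(i < n) F (j * n + i)%N.
Proof.
elim: K => [|K IH]; first by rewrite mul0n !big_ord0.
rewrite big_ord_recr/= -IH -!(big_mkord xpredT) mulSnr.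
rewrite (big_cat_nat (n := K * n))//= ?leq_addr//; congr (_ + _).
have -> : \sum_(K * n <= i < K * n + n) F i = \sum_(0 <= i < n) F (i + K * n)%N.
  by rewrite -{1}[(K * n)%N]add0n big_addn addKn.
by rewrite big_mkord; apply: eq_bigr => i _; rewrite addnC.
Qed.

Lemma sum_shifted_cells_blocks V r x K n :
  variation_bound mu r V ->
  0 < r -> (0 < n)%N -> (0 < K)%N ->
  \sum_(i < K * n) cabs (shifted_cell (node x (x + K%:R * r) (K * n) i)
                              (node x (x + K%:R * r) (K * n) i.+1))
  <= K%:R * (V + cabs z * r).
Proof.
move=> hV r0 n0 K0.
rewrite (sum_blocks (fun i => cabs (shifted_cell (node x (x + K%:R * r) (K * n) i)
   (node x (x + K%:R * r) (K * n) i.+1)))).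
have nodeE j i : node x (x + K%:R * r) (K * n) (j * n + i) =
    node (x + j%:R * r) (x + j%:R * r + r) n i.
  have Kn : K%:R != 0 :> R by rewrite pnatr_eq0 -lt0n.
  have nn : n%:R != 0 :> R by rewrite pnatr_eq0 -lt0n.
  by rewrite /node natrD !natrM; field; apply/andP; split.
have block (j : 'I_K) : \sum_(i < n)
    cabs (shifted_cell (node x (x + K%:R * r) (K * n) (j * n + i))
               (node x (x + K%:R * r) (K * n) (j * n + i).+1)) <= V + cabs z * r.
  under eq_bigr do rewrite -addnS !nodeE.
  exact: sum_shifted_cells.
apply: (le_trans (ler_sum _ (fun j _ => block j))).
by rewrite sumr_const card_ord mulr_natl.
Qed.

(** The bound is not the sum of the individual bounds: what enters is the
    pointwise sum of the [|g i|], because all integrals are approximated with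
    one and the same subdivision, adapted to the blocks of length [r]. *)
Lemma shifted_integral_sum_bound V r a (K m : nat) (G : R) (g : 'I_m -> R -> R[i]) :
  variation_bound mu r V ->
  0 < r -> (0 < K)%N ->
  (forall i, ccontinuous (g i)) ->
  (forall i, vanishes_outside a (a + K%:R * r) (g i)) ->
  (forall x, \sum_(i < m) cabs (g i x) <= G) ->
  \sum_(i < m) cabs (shifted_integral (g i)) <= G * (K%:R * (V + cabs z * r)).
Proof.
move=> hV r0 K0 cg g0 hG.
have G0 : 0 <= G.
  by apply: le_trans (hG 0); apply: sumr_ge0 => i _; exact: cabs_ge0.
set b := a + K%:R * r in g0 *.
have ab : a <= b by rewrite lerDl mulr_ge0// ltW.
apply/ler_addgt0Pr => e e0.
have m0R : 0 < m.+1%:R :> R by rewrite ltr0n.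
have /choice[N hN] i : exists n0 : nat, forall n, (n0 <= n)%N ->
    cabs (shifted_integral (g i) - riemann_sum shifted_cell (g i) a b n) <= e / m.+1%:R.
  exact: (shifted_integral_riemann ab (cg i) (g0 i) (divr_gt0 e0 m0R)).
(* one subdivision, fine enough for all [g i] and a multiple of the blocks *)
pose n := (\max_i N i).+1.
have nK i : (N i <= K * n)%N.
  rewrite (leq_trans (leq_bigmax i))// (leq_trans (leqnSn _))//.
  by rewrite leq_pmull.
have step i : cabs (shifted_integral (g i)) <= cabs (riemann_sum shifted_cell (g i) a b (K * n)) + e / m.+1%:R.
  have h := hN i _ (nK i).
  have -> : shifted_integral (g i) = riemann_sum shifted_cell (g i) a b (K * n) +
    (shifted_integral (g i) - riemann_sum shifted_cell (g i) a b (K * n)) by ring.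
  by rewrite (le_trans (cabsD _ _))// lerD2l.
apply: (le_trans (ler_sum _ (fun i _ => step i))).
rewrite big_split/= sumr_const card_ord; apply: lerD; last first.
  rewrite -[leLHS]mulr_natr mulrAC ler_pdivrMr// ler_wpM2l ?(ltW e0)//.
  by rewrite ler_nat.
apply: (@le_trans _ _ (\sum_(i < m) \sum_(k < K * n)
  cabs (g i (node a b (K * n) k.+1)) *
  cabs (shifted_cell (node a b (K * n) k) (node a b (K * n) k.+1)))).
  apply: ler_sum => i _; rewrite (le_trans (cabs_sum _ _ _))//.
  by apply: ler_sum => k _; rewrite cabsM.
rewrite exchange_big/=.
apply: (@le_trans _ _ (\sum_(k < K * n) G * cabs (shifted_cell (node a b (K * n) k) (node a b (K * n) k.+1)))).
  apply: ler_sum => k _; rewrite -mulr_suml ler_wpM2r ?cabs_ge0//.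
by rewrite -mulr_sumr ler_wpM2l// sum_shifted_cells_blocks.
Qed.

Lemma shifted_integral_bound V r a (K : nat) (G : R) (g : R -> R[i]) :
  variation_bound mu r V ->
  0 < r -> (0 < K)%N ->
  ccontinuous g -> vanishes_outside a (a + K%:R * r) g ->
  (forall x, cabs (g x) <= G) ->
  cabs (shifted_integral g) <= G * (K%:R * (V + cabs z * r)).
Proof.
move=> hV r0 K0 cg g0 hG.
have := @shifted_integral_sum_bound V r a K 1 G (fun=> g) hV r0 K0 (fun=> cg) (fun=> g0).
by rewrite big_ord1; apply=> x; rewrite big_ord1.
Qed.

Lemma shifted_integralD g g' a b : a <= b -> ccontinuous g -> ccontinuous g' ->
  vanishes_outside a b g -> vanishes_outside a b g' ->
  shifted_integral (fun x => g x + g' x) = shifted_integral g + shifted_integral g'.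
Proof.
move=> ab cg cg' g0 g0'; apply: (@riemann_cvg_unique _ shifted_cell a b (fun x => g x + g' x)).
  apply: shifted_integral_riemann => //; first exact: ccontinuousD.
  by move=> x h; rewrite g0// g0'// addr0.
by apply: riemann_cvgD; exact: shifted_integral_riemann.
Qed.

Lemma shifted_integralZ g (c : R[i]) a b : a <= b -> ccontinuous g -> vanishes_outside a b g ->
  shifted_integral (fun x => c * g x) = c * shifted_integral g.
Proof.
move=> ab cg g0; apply: (@riemann_cvg_unique _ shifted_cell a b (fun x => c * g x)).
  apply: shifted_integral_riemann => //; first by apply: ccontinuousM => //; exact: ccontinuous_cst.
  by move=> x h; rewrite g0// mulr0.
by apply: riemann_cvgZ; exact: shifted_integral_riemann.
Qed.

Lemma shifted_integral0 : shifted_integral (fun=> 0) = 0.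
Proof.
have h := @shifted_integralZ (fun=> 0) 0 0 0 (lexx _) (ccontinuous_cst 0) (fun _ _ => erefl).
by move: h; rewrite !mul0r.
Qed.

Lemma shifted_integral_sum (m : nat) (g : 'I_m -> R -> R[i]) (c : 'I_m -> R[i]) a b : a <= b ->
  (forall i, ccontinuous (g i)) -> (forall i, vanishes_outside a b (g i)) ->
  shifted_integral (fun x => \sum_(i < m) c i * g i x) = \sum_(i < m) c i * shifted_integral (g i).
Proof.
move=> ab; elim: m g c => [|m IH] g c cg g0.
  by under eq_fun do rewrite big_ord0; rewrite big_ord0 shifted_integral0.
under eq_fun do rewrite big_ord_recr/=.
rewrite big_ord_recr/= (@shifted_integralD _ _ a b)//.
- by rewrite IH// (@shifted_integralZ _ _ a b).
- by apply: ccontinuous_sum => i; apply: ccontinuousM => //; exact: ccontinuous_cst.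
- by apply: ccontinuousM => //; exact: ccontinuous_cst.
- by move=> x h; rewrite big1// => i _; rewrite g0// mulr0.
- by move=> x h; rewrite g0// mulr0.
Qed.

(** The Lebesgue part of the functional is translation invariant and drops
    out. *)
Lemma shifted_integral_translate g p a b : a <= b -> ccontinuous g -> vanishes_outside a b g ->
  local_integral (sub_measure mu (translate mu p)) g =
  shifted_integral g - shifted_integral (fun x => g (x - p)).
Proof.
move=> ab cg g0.
apply: (@riemann_cvg_unique _ (measure_cell (sub_measure mu (translate mu p))) a b g).
  exact: local_integral_riemann.
have h1 := shifted_integral_riemann ab cg g0.
have h2 : riemann_cvg shifted_cell (a + p) (b + p) (fun x => g (x - p)) (shifted_integral (fun x => g (x - p))).
  by apply: shifted_integral_riemann; [rewrite lerD2r|exact: ccontinuous_shift|exact: vanishes_shift].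
move=> e e0.
have [n1 {}h1] := h1 (e / 2) ltac:(lra); have [n2 {}h2] := h2 (e / 2) ltac:(lra).
exists (maxn n1 n2) => n; rewrite geq_max => /andP[/h1 {}h1 /h2 {}h2].
have nodeE i : node (a + p) (b + p) n i = node a b n i + p.
  by rewrite /node; ring.
have -> : riemann_sum (measure_cell (sub_measure mu (translate mu p))) g a b n =
    riemann_sum shifted_cell g a b n - riemann_sum shifted_cell (fun x => g (x - p)) (a + p) (b + p) n.
  rewrite -sumrB; apply: eq_bigr => i _.
  rewrite !nodeE addrK -mulrBr; congr (_ * _).
  rewrite /shifted_cell /measure_cell /= /length_cell.
  have -> x y : shift_set `]x, y]%classic p = `](x + p), (y + p)]%classic.
    rewrite shift_setE; apply/seteqP; split=> t /=; rewrite !in_itv/=;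
    by rewrite ltrBrDr lerBlDr.
  have -> : forall x y : R, y + p - (x + p) = y - x by move=> x y; ring.
  by ring.
have -> : forall u v w t : R[i], u - v - (w - t) = (u - w) - (v - t) by move=> *; ring.
by rewrite (le_trans (cabsB _ _))//; lra.
Qed.

End perturbed_functional.

(** * A smooth approximation of the positive part *)

Section smooth_functions.
Context {R : realType}.
Implicit Types (f g : R -> R).

(** Explicit successive derivatives make the closure properties inductive, which
    is not the case for iterates of a derivative operator. *)
Fixpoint ntimes_differentiable n f : Prop :=
  if n is m.+1 then
    exists2 g : R -> R, (forall x : R, is_derive x (1 : R) f (g x)) & ntimes_differentiable m g
  else True.

Definition smooth f := forall n, ntimes_differentiable n f.

Lemma ntimesW n f : ntimes_differentiable n.+1 f -> ntimes_differentiable n f.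
Proof.
elim: n f => // n IH f [g fg hg]; exists g => //; exact: IH.
Qed.

Lemma ntimes_cst n (c : R) : ntimes_differentiable n (fun=> c).
Proof.
elim: n c => // n IH c; exists (fun=> 0) => [x|]; last exact: IH.
exact: is_derive_cst.
Qed.

Lemma ntimesD n f g : ntimes_differentiable n f -> ntimes_differentiable n g ->
  ntimes_differentiable n (fun x => f x + g x).
Proof.
elim: n f g => // n IH f g [f' hf cf] [g' hg cg].
exists (fun x => f' x + g' x) => [x|]; last exact: IH.
exact: is_deriveD.
Qed.

Lemma ntimesM n f g : ntimes_differentiable n f -> ntimes_differentiable n g ->
  ntimes_differentiable n (fun x => f x * g x).
Proof.
elim: n f g => // n IH f g cf cg; have [f' hf cf'] := cf; have [g' hg cg'] := cg.
exists (fun x => f x * g' x + g x * f' x) => [x|].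
  exact: is_deriveM.
by apply: ntimesD; apply: IH => //; exact: ntimesW.
Qed.

Lemma ntimesV n f : (forall x, f x != 0) -> ntimes_differentiable n f ->
  ntimes_differentiable n (fun x => (f x)^-1).
Proof.
move=> f0; elim: n => // n IH cf; have [f' hf cf'] := cf.
exists (fun x => (- 1) * ((f x)^-1 * (f x)^-1) * f' x) => [x|].
  apply: is_derive_eq (is_deriveV (f0 x) (hf x)) _.
  by rewrite /GRing.scale/= expr2 invfM mulN1r.
have cV : ntimes_differentiable n (fun x => (f x)^-1) by apply: IH; exact: ntimesW.
by apply: ntimesM => //; apply: ntimesM; [exact: ntimes_cst|exact: ntimesM].
Qed.

Lemma is_derive_affine (a b x : R) : is_derive x (1 : R) (fun y => a * y + b) a.
Proof.
have h : is_derive x (1 : R) (fun y : R => a * y + b) (a *: 1 + 0).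
  by apply: is_deriveD.
by apply: is_derive_eq; rewrite /GRing.scale/= mulr1 addr0.
Qed.

Lemma is_derive_comp_affine f (a b x d : R) : is_derive (a * x + b) (1 : R) f d ->
  is_derive x (1 : R) (fun y => f (a * y + b)) (d * a).
Proof.
move=> h; apply: (@is_derive1_comp _ f (fun y => a * y + b)) => //.
exact: is_derive_affine.
Qed.

Lemma ntimes_affine n f (a b : R) : ntimes_differentiable n f ->
  ntimes_differentiable n (fun x => f (a * x + b)).
Proof.
elim: n f => // n IH f [f' hf cf]; exists (fun x => f' (a * x + b) * a) => [x|].
  exact: is_derive_comp_affine.
by apply: ntimesM; [exact: IH|exact: ntimes_cst].
Qed.

Lemma smooth_derivable f : smooth f ->
  forall n x, derivable (derive1n n f) x 1.
Proof.
move=> sf n.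
suff [g -> hg] : exists2 g, derive1n n f = g & ntimes_differentiable 1 g.
  by move=> x; have [g' h _] := hg; exact: ex_derive.
have : ntimes_differentiable (n + 1) f by exact: sf.
elim: n f {sf} 1%N => [|n IH] f m; first by exists f.
rewrite addSnnS => /IH[g gE [g' hg' cg']]; exists g' => //.
rewrite derive1nS gE; apply/funext => x; rewrite derive1E; exact: derive_val.
Qed.

Lemma is_derive_continuous f f' : (forall x : R, is_derive x (1 : R) f (f' x)) -> continuous f.
Proof.
move=> h x; apply: differentiable_continuous; apply/derivable1_diffP.
exact: ex_derive.
Qed.

(** The denominator [y] leaves a factor to spare in the difference quotient of a
    flat function at 0. *)
Lemma expR_beats_horner (p : {poly R}) :
  exists2 C : R, 0 <= C & forall y, 1 <= y -> `|p.[y]| * expR (- y) <= C / y.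
Proof.
pose S := \sum_(i < size p) `|p`_i|; pose n := size p.
exists (S * n.+1`!%:R).
  by rewrite mulr_ge0// sumr_ge0.
move=> y y1; have y0 : 0 < y by lra.
have h1 : `|p.[y]| <= S * y ^+ n.
  rewrite horner_coef (le_trans (ler_norm_sum _ _ _))// mulr_suml; apply: ler_sum => i _.
  rewrite normrM ler_wpM2l// normrX ger0_norm ?(ltW y0)//.
  by rewrite ler_weXn2l// ltnW.
have h2 : y ^+ n.+1 / n.+1`!%:R <= expR y.
  by apply: le_trans (expR_ge1Dxn n (ltW y0)); rewrite lerDr.
have F0 : 0 < n.+1`!%:R :> R by rewrite ltr0n fact_gt0.
rewrite expRN ler_pdivlMr//.
apply: (@le_trans _ _ (S * y ^+ n / expR y * y)).
  by rewrite ler_wpM2r ?(ltW y0)// ler_wpM2r ?invr_ge0 ?expR_ge0.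
have -> : S * y ^+ n / expR y * y = S * (y ^+ n.+1 / expR y).
  by rewrite exprSr -!mulrA [y * _]mulrC.
rewrite ler_wpM2l ?sumr_ge0// ler_pdivrMr ?expR_gt0//.
by move: h2; rewrite ler_pdivrMr// mulrC.
Qed.

(** The functions [p(1/x) exp(- 1/x)] on the positive half line, extended by 0,
    form a class which is stable under differentiation. *)
Definition flat (p : {poly R}) (x : R) : R :=
  if 0 < x then p.[x^-1] * expR (- x^-1) else 0.

Lemma is_derive_flat p (x : R) :
  is_derive x (1 : R) (flat p) (flat ('X^2 * (p - p^`())) x).
Proof.
have [x0|x0|<-] := ltgtP 0 x.
- have nearE : \forall y \near x, (fun y => p.[y^-1] * expR (- y^-1)) y = flat p y.
    by near=> y; rewrite /flat ifT//; near: y; exact: lt_nbhsr.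
  rewrite {2}/flat x0; apply: (near_eq_is_derive nearE).
  have hV : is_derive x (1 : R) (fun y : R => y^-1) (- x ^- 2).
    have xn0 : x != 0 by rewrite gt_eqF.
    apply: is_derive_eq (is_deriveV (f := id) xn0 (is_derive_id x 1)) _.
    by rewrite /GRing.scale/= mulr1.
  have h1 : is_derive x (1 : R) (fun y : R => p.[y^-1]) (p^`().[x^-1] * - x ^- 2).
    exact: (@is_derive1_comp _ (horner p) (fun y => y^-1)).
  have h2 : is_derive x (1 : R) (fun y : R => expR (- y^-1)) (expR (- x^-1) * - (- x ^- 2)).
    exact: (@is_derive1_comp _ expR (fun y => - y^-1)).
  apply: is_derive_eq (is_deriveM h1 h2) _.
  rewrite /GRing.scale/= !hornerE/= exprVn; ring.
- have nearE : \forall y \near x, cst 0 y = flat p y.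
    near=> y; rewrite /flat ifF//; apply/negbTE; rewrite -leNgt ltW//.
    by near: y; exact: lt_nbhsl.
  rewrite {2}/flat ifF; last by apply/negbTE; rewrite -leNgt ltW.
  exact: (near_eq_is_derive nearE).
have [C C0 hC] := expR_beats_horner (p * 'X).
have lim0 : (fun h : R => h^-1 *: (flat p (h *: 1 + 0) - flat p 0)) @ 0^' --> (0 : R).
  have C1 : 0 < C + 1 by lra.
  apply/cvgrPdist_le => e e0; near=> h.
  rewrite sub0r normrN /GRing.scale/= mulr1 addr0 {2}/flat ltxx subr0 /flat.
  case: ifPn => h0; last by rewrite mulr0 normr0 ltW.
  have h1 : h <= 1.
    by apply: (le_trans (ler_norm _)); near: h; exact: dnbhs0_le.
  have hV : 1 <= h^-1 by rewrite -[leLHS]invr1 lef_pV2 ?posrE.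
  have := hC h^-1 hV; rewrite hornerM hornerX invrK => H.
  rewrite mulrA [h^-1 * _]mulrC normrM [`|expR _|]ger0_norm ?expR_ge0//.
  rewrite (le_trans H)//.
  apply: (@le_trans _ _ ((C + 1) * (e / (C + 1)))); last first.
    by rewrite mulrC divfK ?gt_eqF.
  have he : h <= e / (C + 1).
    apply: (le_trans (ler_norm _)); near: h; apply: dnbhs0_le.
    by rewrite divr_gt0.
  by apply: ler_pM => //; [exact: ltW|lra].
rewrite /flat ltxx.
apply: DeriveDef.
  by apply: cvgP lim0.
exact: cvg_lim lim0.
Unshelve. all: by end_near.
Qed.

Lemma smooth_flat p : smooth (flat p).
Proof.
move=> n; elim: n p => // n IH p; exists (flat ('X^2 * (p - p^`()))) => [x|].
  exact: is_derive_flat.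
exact: IH.
Qed.

Lemma continuous_eq_left (g : R -> R) (c x : R) : {for x, continuous g} ->
  (forall y, y < x -> g y = c) -> g x = c.
Proof.
move=> cg h; have h1 : g y @[y --> x^'-] --> g x by exact: cvg_at_left_filter.
have h2 : g y @[y --> x^'-] --> c.
  by apply: cvg_near_cst; near=> y; apply: h; near: y; exact: nbhs_left_lt.
exact: (cvg_unique _ h1 h2).
Unshelve. all: by end_near. Qed.

Lemma continuous_eq_right (g : R -> R) (c x : R) : {for x, continuous g} ->
  (forall y, x < y -> g y = c) -> g x = c.
Proof.
move=> cg h; have h1 : g y @[y --> x^'+] --> g x by exact: cvg_at_right_filter.
have h2 : g y @[y --> x^'+] --> c.
  by apply: cvg_near_cst; near=> y; apply: h; near: y; exact: nbhs_right_gt.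
exact: (cvg_unique _ h1 h2).
Unshelve. all: by end_near. Qed.

Lemma is_derive_near_affine (f : R -> R) (a b x d : R) : is_derive x (1 : R) f d ->
  (\forall y \near x, f y = a * y + b) -> d = a.
Proof.
move=> fd h; have nearE : \forall y \near x, (fun y => a * y + b) y = f y.
  by near=> y; apply: esym; near: y.
have [_ <-] := near_eq_is_derive nearE (is_derive_affine a b x).
by have [_ <-] := fd.
Unshelve. all: by end_near. Qed.

(** The function is [t f(t) / (f t + f (1 - t))] with [f = exp(- 1/t)].  Its first
    derivative rises from 0 to 1 over the unit interval, so the second
    derivative is a kernel of integral 1 there. *)
Lemma smooth_ramp : exists Psi Psi1 Psi2 : R -> R,
  [/\ smooth Psi, forall x : R, is_derive x (1 : R) Psi (Psi1 x),
      forall x : R, is_derive x (1 : R) Psi1 (Psi2 x),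
      continuous Psi2 /\ vanishes_outside 0 1 Psi2 &
      [/\ Psi1 0 = 0, Psi1 1 = 1, forall t : R, t <= 0 -> Psi t = 0,
          forall t : R, 1 <= t -> Psi t = t &
          forall t : R, 0 <= t -> 0 <= Psi t <= t]].
Proof.
pose f := flat 1.
have fE t : 0 < t -> f t = expR (- t^-1) by move=> t0; rewrite /f /flat t0 hornerE mul1r.
have f0 t : t <= 0 -> f t = 0 by move=> t0; rewrite /f /flat ifF//; apply/negbTE; rewrite -leNgt.
have fpos t : 0 <= f t.
  by have [/f0 ->//|/fE ->] := leP t 0; exact: expR_ge0.
pose den t := f t + f ((- 1) * t + 1).
have den0 t : 0 < den t.
  rewrite /den; have [t0|t0] := leP t 0.
    by rewrite (f0 _ t0) add0r fE ?expR_gt0//; lra.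
  by rewrite ltr_pwDl// fE// expR_gt0.
pose Psi t := t * (f t * (den t)^-1).
have sf : smooth f by exact: smooth_flat.
have sPsi : smooth Psi.
  move=> n; have idn : ntimes_differentiable n (fun x : R => x).
    clear. elim: n => // n IH; exists (fun=> 1) => [x|]; last exact: ntimes_cst.
    exact: is_derive_id.
  apply: ntimesM => //; apply: ntimesM; first exact: sf.
  apply: ntimesV => [x|]; first by rewrite gt_eqF.
  by apply: ntimesD; [exact: sf|apply: ntimes_affine; exact: sf].
have [P1 hP1 [P2 hP2 [P3 hP3 _]]] := sPsi 3%N.
have cP1 : continuous P1 by exact: is_derive_continuous hP2.
have cP2 : continuous P2 by exact: is_derive_continuous hP3.
have Psi0 t : t <= 0 -> Psi t = 0 by move=> t0; rewrite /Psi (f0 _ t0) mul0r mulr0.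
have Psi1E t : 1 <= t -> Psi t = t.
  move=> t1; have E : den t = f t by rewrite /den [f (_ + _)]f0 ?addr0//; lra.
  by rewrite /Psi E divff ?mulr1// -E gt_eqF.
have P1n t : t < 0 -> P1 t = 0.
  move=> t0; apply: (is_derive_near_affine (b := 0) (hP1 t)).
  near=> y; rewrite mul0r addr0 Psi0// ltW//; near: y; exact: lt_nbhsl.
have P1p t : 1 < t -> P1 t = 1.
  move=> t0; apply: (is_derive_near_affine (b := 0) (hP1 t)).
  near=> y; rewrite mul1r addr0 Psi1E// ltW//; near: y; exact: lt_nbhsr.
have P10 : P1 0 = 0 by apply: continuous_eq_left P1n; exact: cP1.
have P11 : P1 1 = 1 by apply: continuous_eq_right P1p; exact: cP1.
have P2n t : t < 0 -> P2 t = 0.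
  move=> t0; apply: (is_derive_near_affine (b := 0) (hP2 t)).
  near=> y; rewrite mul0r addr0 P1n//; near: y; exact: lt_nbhsl.
have P2p t : 1 < t -> P2 t = 0.
  move=> t0; apply: (is_derive_near_affine (b := 1) (hP2 t)).
  near=> y; rewrite mul0r add0r P1p//; near: y; exact: lt_nbhsr.
exists Psi, P1, P2; split => //.
- split=> // x /orP[]; rewrite le_eqVlt => /orP[/eqP|].
  + by move=> ->; apply: continuous_eq_left P2n; exact: cP2.
  + exact: P2n.
  + by move=> <-; apply: continuous_eq_right P2p; exact: cP2.
  + exact: P2p.
- split=> // t t0; apply/andP; split.
    by rewrite mulr_ge0// mulr_ge0// invr_ge0 ltW.
  rewrite -[leRHS]mulr1 ler_wpM2l// ler_pdivrMr// mul1r /den lerDl; exact: fpos.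
Unshelve. all: by end_near.
Qed.

End smooth_functions.

(** * Hat functions and the weak equation *)

Section hat_functions.
Context {R : realType}.
Implicit Types (a b c x t : R).

Definition pos_part t x : R := Num.max (x - t) 0.

Definition hat a b c x : R :=
  (pos_part a x - pos_part b x) / (b - a) - (pos_part b x - pos_part c x) / (c - b).

Lemma pos_part_continuous t : continuous (pos_part t).
Proof.
move=> x; apply: (@continuous_max _ _ (fun x => x - t) (fun=> 0)); last exact: cvg_cst.
by apply: cvgB; [exact: cvg_id|exact: cvg_cst].
Qed.

Lemma hat_continuous a b c : continuous (hat a b c).
Proof.
move=> x; apply: cvgB; apply: cvgM; (try exact: cvg_cst); apply: cvgB; exact: pos_part_continuous.
Qed.

Lemma pos_partE t x : t <= x -> pos_part t x = x - t.
Proof. by move=> tx; rewrite /pos_part max_l// subr_ge0. Qed.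

Lemma pos_part0 t x : x <= t -> pos_part t x = 0.
Proof. by move=> tx; rewrite /pos_part max_r// subr_le0. Qed.

Lemma hat_vanishes a b c : a < b -> b < c -> vanishes_outside a c (hat a b c).
Proof.
move=> ab bc x /orP[xa|cx]; rewrite /hat.
  by rewrite !pos_part0 ?subrr ?mul0r ?subrr//; lra.
rewrite !pos_partE; [|lra..]; have b1 : b - a != 0 by rewrite subr_eq0 gt_eqF.
have b2 : c - b != 0 by rewrite subr_eq0 gt_eqF.
by field; apply/andP.
Qed.

Lemma hat_ge0_le1 a b c x : a < b -> b < c -> 0 <= hat a b c x <= 1.
Proof.
move=> ab bc; have b1 : 0 < b - a by lra.
have b2 : 0 < c - b by lra.
have [xa|ax] := leP x a.
  by rewrite hat_vanishes ?xa// lexx ler01.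
have [cx|xc] := leP c x.
  by rewrite hat_vanishes ?cx ?orbT// lexx ler01.
rewrite /hat (pos_partE (ltW ax)) (pos_part0 (ltW xc)) subr0.
have [xb|bx] := leP x b.
  rewrite pos_part0// subr0 mul0r subr0 divr_ge0 ?(ltW b1)//=; last lra.
  by rewrite ler_pdivrMr//; lra.
rewrite (pos_partE (ltW bx)) (_ : x - a - (x - b) = b - a); last by ring.
rewrite divff ?gt_eqF// subr_ge0 ler_pdivrMr// mul1r gerBl.
by rewrite divr_ge0 ?(ltW b2)//; lra.
Qed.

(** A hat is a second difference of positive parts. *)
Lemma hatE a b c x : hat a b c x = (b - a)^-1 * pos_part a x
  - ((b - a)^-1 + (c - b)^-1) * pos_part b x + (c - b)^-1 * pos_part c x.
Proof. by rewrite /hat; ring. Qed.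

End hat_functions.

Definition weak_solution {R : realType} (mu : local_measure R) (z : R[i])
    (u : R -> R[i]) := forall phi : R -> R[i], test_function phi ->
  lebesgue_cintegral (fun x => z * u x * phi x) =
  - lebesgue_cintegral (fun x => u x * cderiven 2 phi x)
  + local_integral mu (fun x => u x * phi x).

Definition hat_equation {R : realType} (mu : local_measure R) (z : R[i])
    (u : R -> R[i]) := forall a b c : R, a < b -> b < c ->
  shifted_integral mu z (fun x => u x * (hat a b c x)%:C) =
  (c - b)^-1%:C * (u c - u b) - (b - a)^-1%:C * (u b - u a).

Section weak_equation.
Context {R : realType}.
Implicit Types (f : R -> R) (g : R -> R[i]).

Lemma cabs_continuous g : ccontinuous g -> continuous (fun x => cabs (g x)).
Proof.
move=> [gr gi] x.
rewrite (_ : (fun _ => _) = fun x => Num.sqrt (re (g x) ^+ 2 + im (g x) ^+ 2)); last first.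
  by apply/funext => y; case: (g y).
apply: continuous_comp; last exact: sqrt_continuous.
by apply: cvgD; rewrite ?expr2; apply: cvgM; [exact: gr|exact: gr|exact: gi|exact: gi].
Qed.

Lemma cabs_bounded g a b : a <= b -> ccontinuous g ->
  exists U : R, forall x, a <= x <= b -> cabs (g x) <= U.
Proof.
move=> ab cg; have cg' : {within `[a, b], continuous (fun x => cabs (g x))}.
  exact/continuous_subspaceT/cabs_continuous.
by have [c _ hc] := EVT_max ab cg'; exists (cabs (g c)) => x xab; apply: hc; rewrite in_itv.
Qed.

Lemma lebesgue_cintegralZ g (c : R[i]) a b : a <= b -> ccontinuous g ->
  vanishes_outside a b g ->
  lebesgue_cintegral (fun x => c * g x) = c * lebesgue_cintegral g.
Proof.
move=> ab cg g0; apply: (@riemann_cvg_unique _ length_cell a b (fun x => c * g x)).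
  apply: lebesgue_integral_riemann => //.
    by apply: ccontinuousM => //; exact: ccontinuous_cst.
  by move=> x h; rewrite g0// mulr0.
by apply: riemann_cvgZ; exact: lebesgue_integral_riemann.
Qed.

Lemma lebesgue_cintegralD g g' a b : a <= b -> ccontinuous g -> ccontinuous g' ->
  vanishes_outside a b g -> vanishes_outside a b g' ->
  lebesgue_cintegral (fun x => g x + g' x) =
  lebesgue_cintegral g + lebesgue_cintegral g'.
Proof.
move=> ab cg cg' g0 g0'.
apply: (@riemann_cvg_unique _ length_cell a b (fun x => g x + g' x)).
  apply: lebesgue_integral_riemann => //; first exact: ccontinuousD.
  by move=> x h; rewrite g0// g0'// addr0.
by apply: riemann_cvgD; exact: lebesgue_integral_riemann.
Qed.

Lemma lebesgue_cintegral_bound g a b (G : R) : a <= b -> ccontinuous g ->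
  vanishes_outside a b g -> (forall x, cabs (g x) <= G) ->
  cabs (lebesgue_cintegral g) <= G * (b - a).
Proof.
move=> ab cg g0 hG; apply/ler_addgt0Pr => e e0.
have [n0 /(_ n0.+1 (leqnSn _)) h] := lebesgue_integral_riemann ab cg g0 e0.
have -> : lebesgue_cintegral g = riemann_sum length_cell g a b n0.+1 +
  (lebesgue_cintegral g - riemann_sum length_cell g a b n0.+1) by ring.
rewrite (le_trans (cabsD _ _))// lerD//.
apply: (le_trans (cabs_sum _ _ _)).
have step (i : 'I_n0.+1) : cabs (g (node a b n0.+1 i.+1) *
    length_cell (node a b n0.+1 i) (node a b n0.+1 i.+1)) <= G * ((b - a) / n0.+1%:R).
  have -> : length_cell (node a b n0.+1 i) (node a b n0.+1 i.+1) = ((b - a) / n0.+1%:R)%:C.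
    by rewrite /length_cell nodeS addrAC subrr add0r.
  rewrite cabsM cabs_real ger0_norm ?divr_ge0 ?subr_ge0//.
  by rewrite ler_wpM2r// divr_ge0 ?subr_ge0.
apply: (le_trans (ler_sum _ (fun i _ => step i))).
by rewrite sumr_const card_ord -[leLHS]mulr_natr -mulrA divfK ?pnatr_eq0.
Qed.

Lemma spt_subset g a b : vanishes_outside a b g -> spt g `<=` `[a, b].
Proof.
move=> g0; rewrite /spt closureE; apply: smallest_sub; first exact: interval_closed.
move=> x /= gx; rewrite in_itv/=; apply: contraT.
rewrite negb_and -!ltNge => h; case/negP: gx; apply/eqP; apply: g0.
by case/orP: h => /ltW ->; rewrite ?orbT.
Qed.

Variables (mu : local_measure R) (z : R[i]) (u : R -> R[i]).
Hypothesis cu : ccontinuous u.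
Hypothesis weak_u : weak_solution mu z u.

Lemma weak_equation_real f f1 f2 a b : a <= b -> smooth f ->
  (forall x : R, is_derive x (1 : R) f (f1 x)) ->
  (forall x : R, is_derive x (1 : R) f1 (f2 x)) ->
  vanishes_outside a b f ->
  shifted_integral mu z (fun x => u x * (f x)%:C) = lebesgue_cintegral (fun x => u x * (f2 x)%:C).
Proof.
move=> ab sf hf1 hf2 f0.
have cf : continuous f by exact: is_derive_continuous hf1.
have tf : test_function (fun x => (f x)%:C).
  split.
    move=> n x; split; first exact: smooth_derivable.
    apply: smooth_derivable => m; exact: ntimes_cst.
  apply: (@subclosed_compact _ _ `[a, b]); first exact: closed_closure.
    exact: segment_compact.
  by apply: spt_subset => x h; rewrite f0.
have := weak_u tf.
rewrite (_ : (fun x => u x * cderiven 2 _ x) = fun x => u x * (f2 x)%:C); last first.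
  apply/funext => x; congr (_ * _); rewrite /cderiven /=; congr Complex.
    have -> : f^`()%classic = f1.
      by apply/funext => y; rewrite derive1E; exact: derive_val.
    by rewrite derive1E; exact: derive_val.
  have E (c : R) : (fun _ : R => c)^`()%classic = fun=> 0.
    by apply/funext => y; rewrite derive1E; exact: derive_val.
  by rewrite !E.
rewrite (_ : (fun x => z * u x * _) = fun x => z * (u x * (f x)%:C)); last first.
  by apply/funext => x; rewrite mulrA.
rewrite (@lebesgue_cintegralZ _ z a b)//.
- by rewrite /shifted_integral => ->; ring.
- by apply: ccontinuousM => //; exact: ccontinuous_real.
- by move=> x h; rewrite f0// mulr0.
Qed.

(** The kernel [P2] has integral [P1 1 - P1 0 = 1].  As it may change sign, its
    rescalings are controlled in [L^1] by its supremum. *)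
Lemma approximate_identity (P1 P2 : R -> R) t0 :
  (forall x : R, is_derive x (1 : R) P1 (P2 x)) -> continuous P2 ->
  vanishes_outside 0 1 P2 -> P1 0 = 0 -> P1 1 = 1 ->
  forall e, 0 < e -> exists2 d : R, 0 < d & forall s, 0 < s -> s < d ->
  cabs (lebesgue_cintegral (fun x => u x * (s^-1 * P2 (s^-1 * x + - (t0 / s)))%:C) - u t0) <= e.
Proof.
move=> hP1 cP2 P20 P10 P11 e e0.
have [B hB] : exists B : R, forall x, `|P2 x| <= B.
  have [B hB] := @cabs_bounded (fun x => (P2 x)%:C) 0 1 ler01 (ccontinuous_real cP2).
  exists B => x; have [h|h] := boolP (0 <= x <= 1); first by rewrite -cabs_real hB.
  have B0 : 0 <= B by apply: le_trans (hB 0 _); rewrite ?cabs_ge0// lexx ler01.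
  by rewrite P20 ?normr0//; move: h; rewrite negb_and -!ltNge => /orP[] /ltW ->; rewrite ?orbT.
have B0 : 0 <= B by exact: le_trans (hB 0).
have cu0 : continuous (fun x => cabs (u x - u t0)).
  by apply: cabs_continuous; apply: ccontinuousD => //; exact: ccontinuous_cst.
have B1 : 0 < B + 1 by lra.
have := cu0 t0 => /cvgrPdist_lt/(_ (e / (B + 1)) (divr_gt0 e0 B1)).
rewrite subrr cabs0 => -[d /= d0 hd].
exists d => // s s0 sd.
pose k x := s^-1 * P2 (s^-1 * x + - (t0 / s)).
have ck : continuous k.
  move=> x; apply: cvgM; first exact: cvg_cst.
  apply: (@continuous_comp _ _ _ (fun x => s^-1 * x + - (t0 / s)) P2); last exact: cP2.
  by apply: cvgD; [apply: cvgM; [exact: cvg_cst|exact: cvg_id]|exact: cvg_cst].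
have argE x : s^-1 * x + - (t0 / s) = (x - t0) / s by ring.
have k0 : vanishes_outside t0 (t0 + s) k.
  move=> x h; rewrite /k argE P20 ?mulr0// ler_pdivrMr// ler_pdivlMr//.
  by rewrite mul0r mul1r subr_le0 lerBrDl.
have t0s : t0 <= t0 + s by lra.
have intk : lebesgue_cintegral (fun x => (k x)%:C) = 1.
  rewrite /lebesgue_cintegral /=; apply/eqP; rewrite eq_complex /=; apply/andP; split; last first.
    by rewrite /Rintegral; under eq_integral do rewrite /=; rewrite integral0.
  have -> : \int[lebesgue_measure]_x k x = \int[lebesgue_measure]_(x in `[t0, t0 + s]) k x.
    rewrite [RHS]Rintegral_mkcond; apply: eq_Rintegral => x _.
    rewrite patchE; case: ifPn => //.
    rewrite notin_setE /= in_itv/= => /negP; rewrite negb_and -!ltNge => h.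
    by apply: k0; case/orP: h => /ltW ->; rewrite ?orbT.
  have hk x : is_derive x (1 : R) (fun x => P1 (s^-1 * x + - (t0 / s))) (k x).
    rewrite /k [s^-1 * P2 _]mulrC; exact: (is_derive_comp_affine (hP1 _)).
  have := @continuous_FTC2 R k (fun x => P1 (s^-1 * x + - (t0 / s))) t0 (t0 + s).
  have E1 : (t0 + s - t0) / s = 1 by field; rewrite gt_eqF.
  rewrite !argE subrr mul0r P10 E1 P11 sube0 => H.
  rewrite /Rintegral H//; first lra.
  - exact: continuous_subspaceT.
  - split.
    + by move=> x _; case: (hk x).
    + by apply: cvg_at_right_filter; exact: (is_derive_continuous hk).
    + by apply: cvg_at_left_filter; exact: (is_derive_continuous hk).
  - by move=> x _; rewrite derive1E; case: (hk x).
rewrite -[X in _ - X]mulr1 -intk -(@lebesgue_cintegralZ _ (u t0) t0 (t0 + s))//; last 2 first.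
- exact: ccontinuous_real.
- by move=> x h; rewrite k0.
set g1 := fun x => u x * _; set g2 := fun x => u t0 * _.
have cg1 : ccontinuous g1 by apply: ccontinuousM => //; exact: ccontinuous_real.
have cg2 : ccontinuous (fun x => (- 1) * g2 x).
  apply: ccontinuousM; first exact: ccontinuous_cst.
  by apply: ccontinuousM; [exact: ccontinuous_cst|exact: ccontinuous_real].
have g10 : vanishes_outside t0 (t0 + s) g1.
  by move=> x h; have := k0 x h; rewrite /k /g1 => ->; rewrite mulr0.
have g20 : vanishes_outside t0 (t0 + s) g2.
  by move=> x h; rewrite /g2 k0// mulr0.
rewrite -mulN1r -(@lebesgue_cintegralZ _ _ t0 (t0 + s))//; last first.
  by apply: ccontinuousM; [exact: ccontinuous_cst|exact: ccontinuous_real].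
rewrite -(@lebesgue_cintegralD _ _ t0 (t0 + s))//; last first.
  by move=> x h; rewrite g20// mulr0.
have := @lebesgue_cintegral_bound (fun x => g1 x + - 1 * g2 x) t0 (t0 + s) (e / s) t0s.
have -> : e / s * (t0 + s - t0) = e by field; rewrite gt_eqF.
apply.
- exact: ccontinuousD.
- by move=> x h; rewrite g10// g20// mulr0 addr0.
move=> x; have -> : g1 x + -1 * g2 x = (u x - u t0) * (k x)%:C.
  by rewrite /g1 /g2 /k; ring.
rewrite cabsM cabs_real.
have [/orP h|h] := boolP ((x <= t0) || (t0 + s <= x)).
  rewrite k0; first by rewrite normr0 mulr0 divr_ge0 ?ltW.
  exact/orP.
move: h; rewrite negb_or -!ltNge => /andP[h1 h2].
have hx : cabs (u x - u t0) <= e / (B + 1).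
  have := hd x; rewrite /= ltr_norml => /(_ ltac:(apply/andP; split; lra)).
  by rewrite sub0r normrN ger0_norm ?cabs_ge0// => /ltW.
have hk : `|k x| <= (B + 1) / s.
  have sV : 0 <= s^-1 by rewrite invr_ge0 ltW.
  rewrite /k normrM ger0_norm// [leRHS]mulrC ler_wpM2l//.
  by rewrite (le_trans (hB _))//; lra.
apply: (le_trans (ler_pM (cabs_ge0 _) (normr_ge0 _) hx hk)).
by rewrite mulrA divfK// gt_eqF.
Qed.

End weak_equation.

(** * Testing the equation with hat functions *)

Section hat_identity.
Context {R : realType}.
Variables (mu : local_measure R) (z : R[i]) (u : R -> R[i]).
Hypothesis cu : ccontinuous u.
Hypothesis weak_u : weak_solution mu z u.
Variable V : R.
Hypothesis hV : variation_bound mu 1 V.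
Implicit Types (f : R -> R) (g : R -> R[i]).

Lemma is_derive_scale f (x d k : R) : is_derive x (1 : R) f d ->
  is_derive x (1 : R) (fun y => k * f y) (k * d).
Proof.
move=> h; apply: is_derive_eq (is_deriveM (is_derive_cst k x 1) h) _.
by rewrite /GRing.scale/= mulr0 addr0.
Qed.

Lemma outside_subset (a b c d x : R) : c <= a -> b <= d ->
  (x <= c) || (d <= x) -> (x <= a) || (b <= x).
Proof.
move=> ca bd /orP[xc|dx]; apply/orP; first by left; exact: le_trans ca.
by right; exact: le_trans dx.
Qed.

Lemma scale_exists (d1 d2 d3 e : R) : 0 < d1 -> 0 < d2 -> 0 < d3 -> 0 < e ->
  exists s : R, [/\ 0 < s, s < d1, s < d2 & [/\ s < d3, s <= 1 & s <= e]].
Proof.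
move=> d10 d20 d30 e0.
pose m := Num.min (Num.min d1 d2) (Num.min d3 (Num.min 1 e)).
have m0 : 0 < m by rewrite /m !lt_min d10 d20 d30 ltr01 e0.
have : m <= m by []; rewrite {2}/m !le_min => /andP[/andP[? ?] /and3P[? ? ?]].
by exists (m / 2); split; [lra..|split; lra].
Qed.

(** Replacing the positive parts in the hat by [s Psi((x - t)/s)] gives test
    functions whose second derivatives are combinations of approximate
    identities at the three nodes.  They are uniformly [O(s)]-close to the hat,
    which controls the other side of the equation. *)
Lemma hat_identity : hat_equation mu z u.
Proof.
move=> a b c ab bc.
have [Psi [P1 [P2 [sPsi hPsi hP1 [cP2 P20] [P10 P11 Psi0 PsiE Psi01]]]]] := @smooth_ramp R.
pose al := (b - a)^-1; pose ga := (c - b)^-1; pose be := - (al + ga).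
have al0 : b - a != 0 by rewrite subr_eq0 gt_eqF.
have ga0 : c - b != 0 by rewrite subr_eq0 gt_eqF.
have ac : a <= c by lra.
have c1 : c <= c + 1 by rewrite lerDl.
have ac1 : a <= c + 1 by exact: le_trans c1.
(* [Ps s t] is a smooth approximation of the positive part at [t], within [s] *)
pose Ps s t x := s * Psi (s^-1 * x + - (t / s)).
pose P1s s t x := P1 (s^-1 * x + - (t / s)).
pose P2s s t x := s^-1 * P2 (s^-1 * x + - (t / s)).
have argE (s t x : R) : s^-1 * x + - (t / s) = (x - t) / s by ring.
pose phi s x := al * Ps s a x + be * Ps s b x + ga * Ps s c x.
pose phi1 s x := al * P1s s a x + be * P1s s b x + ga * P1s s c x.
pose phi2 s x := al * P2s s a x + be * P2s s b x + ga * P2s s c x.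
have dPs (s t x : R) : 0 < s -> is_derive x (1 : R) (Ps s t) (P1s s t x).
  move=> s0; have h := is_derive_comp_affine (a := s^-1) (b := - (t / s)) (x := x) (hPsi _).
  apply: is_derive_eq (is_derive_scale s h) _.
  by rewrite mulrCA divff ?mulr1// gt_eqF.
have dP1s (s t x : R) : is_derive x (1 : R) (P1s s t) (P2s s t x).
  have h := is_derive_comp_affine (a := s^-1) (b := - (t / s)) (x := x) (hP1 _).
  by apply: is_derive_eq h _; rewrite mulrC.
have dphi (s : R) (x : R) : 0 < s -> is_derive x (1 : R) (phi s) (phi1 s x).
  move=> s0; exact: (is_deriveD (is_deriveD (is_derive_scale al (dPs s a x s0))
    (is_derive_scale be (dPs s b x s0))) (is_derive_scale ga (dPs s c x s0))).
have dphi1 (s : R) (x : R) : is_derive x (1 : R) (phi1 s) (phi2 s x).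
  exact: (is_deriveD (is_deriveD (is_derive_scale al (dP1s s a x))
    (is_derive_scale be (dP1s s b x))) (is_derive_scale ga (dP1s s c x))).
have sPs (s t k : R) : smooth (fun x => k * Ps s t x).
  move=> n; apply: ntimesM; first exact: ntimes_cst.
  by apply: ntimesM; [exact: ntimes_cst|apply: ntimes_affine; exact: sPsi].
have sphi (s : R) : smooth (phi s).
  by move=> n; apply: ntimesD; [apply: ntimesD|]; exact: sPs.
have PsE0 (s t x : R) : 0 < s -> x <= t -> Ps s t x = 0.
  move=> s0 xt; rewrite /Ps argE Psi0 ?mulr0// ler_pdivrMr// mul0r; lra.
have PsE1 (s t x : R) : 0 < s -> t + s <= x -> Ps s t x = x - t.
  move=> s0 xt; rewrite /Ps argE PsiE; first by rewrite mulrC divfK ?gt_eqF.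
  by rewrite ler_pdivlMr// mul1r; lra.
have phi0 (s : R) : 0 < s -> s <= 1 -> vanishes_outside a (c + 1) (phi s).
  move=> s0 s1 x /orP[xa|cx]; rewrite /phi.
    by rewrite !PsE0 ?mulr0 ?addr0//; lra.
  by rewrite !PsE1//; try lra; rewrite /be /al /ga; field; apply/andP.
have [U hU] := cabs_bounded ac1 cu.
have U0 : 0 <= U by apply: le_trans (hU a _); rewrite ?cabs_ge0// lexx.
pose S := `|al| + `|be| + `|ga|.
have close (s t x : R) : 0 < s -> `|Ps s t x - pos_part t x| <= s.
  move=> s0; have [xt|tx] := leP x t.
    by rewrite PsE0// pos_part0// subr0 normr0 ltW.
  have [h|h] := leP (t + s) x.
    by rewrite PsE1// pos_partE ?subrr ?normr0// ltW.
  rewrite pos_partE ?(ltW tx)// ler_norml.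
  have := Psi01 (s^-1 * x + - (t / s)); rewrite argE divr_ge0 ?(ltW s0) ?subr_ge0 ?(ltW tx)//.
  move=> /(_ isT) /andP[h1 h2]; rewrite /Ps argE.
  have h3 : 0 <= s * Psi ((x - t) / s) by rewrite mulr_ge0// ltW.
  have h4 : s * Psi ((x - t) / s) <= x - t.
    by rewrite mulrC -ler_pdivlMr.
  by apply/andP; split; lra.
have close_phi (s x : R) : 0 < s -> `|hat a b c x - phi s x| <= s * S.
  move=> s0; rewrite hatE /phi -/al -/ga.
  have -> : al * pos_part a x - (al + ga) * pos_part b x + ga * pos_part c x -
    (al * Ps s a x + be * Ps s b x + ga * Ps s c x) =
    - (al * (Ps s a x - pos_part a x) + be * (Ps s b x - pos_part b x) + ga * (Ps s c x - pos_part c x)).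
    by rewrite /be; ring.
  rewrite normrN (_ : s * S = s * `|al| + s * `|be| + s * `|ga|); last by rewrite /S; ring.
  apply: (le_trans (ler_normD _ _)); apply: lerD.
    apply: (le_trans (ler_normD _ _)); apply: lerD.
      by rewrite normrM [leRHS]mulrC ler_wpM2l// close.
    by rewrite normrM [leRHS]mulrC ler_wpM2l// close.
  by rewrite normrM [leRHS]mulrC ler_wpM2l// close.
have [K [K0 hK]] : exists K : nat, (0 < K)%N /\ c + 1 <= a + K%:R * 1.
  exists (Num.bound (c + 1 - a)).+1; split=> //; rewrite mulr1.
  have := archi_boundP (_ : 0 <= c + 1 - a); rewrite subr_ge0 => /(_ ac1) h.
  by rewrite -natr1; lra.
have cK : c <= a + K%:R * 1 by exact: le_trans hK.
pose C := U * S * (K%:R * (V + cabs z * 1)).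
have cPhi (s : R) : 0 < s -> continuous (phi s).
  by move=> s0; apply: is_derive_continuous (fun x => dphi s x s0).
apply/eqP; rewrite -subr_eq0; apply/eqP.
apply: (@cabs_small_eq0 _ _ (C + (`|al| + `|be| + `|ga|))) => e e0.
have [d1 d10 h1] := @approximate_identity R u cu P1 P2 a hP1 cP2 P20 P10 P11 e e0.
have [d2 d20 h2] := @approximate_identity R u cu P1 P2 b hP1 cP2 P20 P10 P11 e e0.
have [d3 d30 h3] := @approximate_identity R u cu P1 P2 c hP1 cP2 P20 P10 P11 e e0.
have [s [s0 sd1 sd2 [sd3 s1 se]]] := scale_exists d10 d20 d30 e0.
have {}h1 := h1 s s0 sd1; have {}h2 := h2 s s0 sd2; have {}h3 := h3 s s0 sd3.
pose L t := lebesgue_cintegral (fun x => u x * (P2s s t x)%:C).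
have Jphi : shifted_integral mu z (fun x => u x * (phi s x)%:C) = al%:C * L a + be%:C * L b + ga%:C * L c.
  rewrite (weak_equation_real cu weak_u ac1 (sphi s) (fun x => dphi s x s0) (dphi1 s) (phi0 s s0 s1)).
  have van t : a <= t -> t <= c -> vanishes_outside a (c + 1) (fun x => u x * (P2s s t x)%:C).
    move=> h4 h5 x h; rewrite /P2s argE P20 ?mulr0// ler_pdivrMr// ler_pdivlMr// mul0r mul1r.
    rewrite subr_le0 lerBrDl.
    exact: outside_subset h4 (lerD h5 s1) h.
  have cP2s t : ccontinuous (fun x => u x * (P2s s t x)%:C).
    apply: ccontinuousM => //; apply: ccontinuous_real => x.
    apply: cvgM; first exact: cvg_cst.
    apply: (@continuous_comp _ _ _ (fun x => s^-1 * x + - (t / s)) P2); last exact: cP2.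
    by apply: cvgD; [apply: cvgM; [exact: cvg_cst|exact: cvg_id]|exact: cvg_cst].
  have ck k t : ccontinuous (fun x => k * (u x * (P2s s t x)%:C)).
    by apply: ccontinuousM => //; exact: ccontinuous_cst.
  have vk k t : a <= t -> t <= c -> vanishes_outside a (c + 1) (fun x => k * (u x * (P2s s t x)%:C)).
    by move=> h4 h5 x h; rewrite (van t)// mulr0.
  have bc1 : b <= c by exact: ltW.
  have ab1 : a <= b by exact: ltW.
  rewrite (_ : (fun x => u x * _) = (fun x =>
     (al%:C * (u x * (P2s s a x)%:C) + be%:C * (u x * (P2s s b x)%:C)) +
      ga%:C * (u x * (P2s s c x)%:C))); last first.
    by apply/funext => x; rewrite /phi2 !rmorphD !rmorphM/=; ring.
  rewrite (@lebesgue_cintegralD _ _ _ a (c + 1))//; last 3 first.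
  - exact: ccontinuousD.
  - by move=> x h; rewrite (vk _ a)// (vk _ b)// addr0.
  - exact: vk.
  rewrite (@lebesgue_cintegralD _ _ _ a (c + 1))//; last 2 first.
  - exact: vk.
  - exact: vk.
  by rewrite !(@lebesgue_cintegralZ _ _ _ a (c + 1))//; exact: van.
have Jdiff : cabs (shifted_integral mu z (fun x => u x * (hat a b c x)%:C) -
                   shifted_integral mu z (fun x => u x * (phi s x)%:C)) <= C * e.
  have vhat : vanishes_outside a (a + K%:R * 1) (fun x => u x * (hat a b c x)%:C).
    by move=> x h; rewrite hat_vanishes ?mulr0//; exact: outside_subset (lexx a) cK h.
  have vphi : vanishes_outside a (a + K%:R * 1) (fun x => u x * (phi s x)%:C).
    by move=> x h; rewrite phi0 ?mulr0//; exact: outside_subset (lexx a) hK h.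
  have aK : a <= a + K%:R * 1 by exact: le_trans ac1 hK.
  have ch : ccontinuous (fun x => u x * (hat a b c x)%:C).
    by apply: ccontinuousM => //; apply: ccontinuous_real; exact: hat_continuous.
  have cp : ccontinuous (fun x => u x * (phi s x)%:C).
    by apply: ccontinuousM => //; apply: ccontinuous_real; exact: cPhi.
  rewrite -mulN1r -(@shifted_integralZ _ mu z _ _ a (a + K%:R * 1))//.
  rewrite -(@shifted_integralD _ mu z _ _ a (a + K%:R * 1))//; last 2 first.
  - by apply: ccontinuousM => //; exact: ccontinuous_cst.
  - by move=> x h; rewrite vphi// mulr0.
  apply: (@le_trans _ _ ((U * S * e) * (K%:R * (V + cabs z * 1)))); last first.
    by rewrite /C mulrAC.
  apply: (@shifted_integral_bound _ mu z V 1 a K (U * S * e) _ hV ltr01 K0).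
  - by apply: ccontinuousD => //; apply: ccontinuousM => //; exact: ccontinuous_cst.
  - by move=> x h; rewrite vphi// vhat// mulr0 addr0.
  move=> x; have -> : u x * (hat a b c x)%:C + -1 * (u x * (phi s x)%:C) =
    u x * (hat a b c x - phi s x)%:C.
    by move: (hat a b c x) (phi s x) => h1' h2'; rewrite rmorphB; ring.
  rewrite cabsM cabs_real.
  have [h|h] := boolP (a <= x <= c + 1).
    rewrite -mulrA ler_pM ?cabs_ge0 ?hU//.
    apply: (le_trans (close_phi _ _ s0)); rewrite mulrC ler_wpM2l//.
    by rewrite /S !addr_ge0.
  have {}h : (x <= a) || (c + 1 <= x).
    by move: h; rewrite negb_and -!ltNge => /orP[]/ltW ->; rewrite ?orbT.
  rewrite hat_vanishes//; last exact: outside_subset (lexx a) c1 h.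
  rewrite phi0//.
  rewrite subrr normr0 mulr0 !mulr_ge0 ?(ltW e0)// /S !addr_ge0//.
rewrite mulrDl.
have -> : shifted_integral mu z (fun x => u x * (hat a b c x)%:C) -
   ((c - b)^-1%:C * (u c - u b) - (b - a)^-1%:C * (u b - u a)) =
   (shifted_integral mu z (fun x => u x * (hat a b c x)%:C) - shifted_integral mu z (fun x => u x * (phi s x)%:C)) +
   (al%:C * (L a - u a) + be%:C * (L b - u b) + ga%:C * (L c - u c)).
  by rewrite Jphi /be rmorphN rmorphD/= -/al -/ga; ring.
apply: (le_trans (cabsD _ _)); apply: lerD => //.
rewrite !mulrDl.
apply: (le_trans (cabsD _ _)); apply: lerD; last first.
  by rewrite cabsM cabs_real ler_wpM2l.
apply: (le_trans (cabsD _ _)); apply: lerD.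
  by rewrite cabsM cabs_real ler_wpM2l.
by rewrite cabsM cabs_real ler_wpM2l.
Qed.

End hat_identity.

(** * Decay of square integrable solutions *)

Section decay.
Context {R : realType}.
Variables (mu : local_measure R) (z : R[i]) (u : R -> R[i]).
Hypothesis cu : ccontinuous u.
Hypothesis weak_u : weak_solution mu z u.
Variable V : R.
Hypothesis hV : variation_bound mu 1 V.
Hypothesis L2u : (\int[lebesgue_measure]_x (cabs (u x) ^+ 2)%:E < +oo)%E.

Let k := V + cabs z.

Lemma variation_ge0 (y r W : R) : (var_measure mu `]y, (y + r)%R] <= W%:E)%E ->
  0 < r -> 0 <= W.
Proof.
move=> h r0; have := sum_measure_cells h r0 (erefl : (0 < 1)%N).
by apply: le_trans; rewrite big_ord1 cabs_ge0.
Qed.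

Let k0 : 0 <= k.
Proof. by rewrite addr_ge0 ?cabs_ge0//; apply: (variation_ge0 (hV 0)). Qed.

Lemma shifted_integral_hat_bound a b c (A : R) : a < b -> b < c -> c - a <= 1 ->
  (forall x, a <= x <= c -> cabs (u x) <= A) ->
  cabs (shifted_integral mu z (fun x => u x * (hat a b c x)%:C)) <= A * k.
Proof.
move=> ab bc ac1 hA.
have A0 : 0 <= A by apply: le_trans (hA a _); rewrite ?cabs_ge0// lexx; lra.
have -> : A * k = A * (1%:R * (V + cabs z * 1)) by rewrite /k mulr1 mul1r.
apply: (@shifted_integral_bound _ mu z V 1 a 1 A _ hV ltr01 isT).
- by apply: ccontinuousM => //; apply: ccontinuous_real; exact: hat_continuous.
- move=> x h; rewrite hat_vanishes ?mulr0//; apply/orP.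
  by case/orP: h => h; [left|right]; lra.
move=> x; rewrite cabsM cabs_real.
have /andP[h0 h1] := @hat_ge0_le1 R a b c x ab bc.
have [xac|] := boolP (a <= x <= c).
  by rewrite ger0_norm// -[leRHS]mulr1 ler_pM ?cabs_ge0 ?hA.
rewrite negb_and -!ltNge => h.
rewrite hat_vanishes ?normr0 ?mulr0//; apply/orP.
by case/orP: h => h; [left|right]; lra.
Qed.

Lemma slope_jump a b c (A : R) : a < b -> b < c -> c - a <= 1 ->
  (forall x, a <= x <= c -> cabs (u x) <= A) ->
  cabs ((c - b)^-1%:C * (u c - u b) - (b - a)^-1%:C * (u b - u a)) <= A * k.
Proof.
by move=> ab bc ac hA; rewrite -(hat_identity cu weak_u hV ab bc) shifted_integral_hat_bound.
Qed.

Lemma realC_divff (a : R) : a != 0 -> a%:C * a^-1%:C = 1 :> R[i].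
Proof. by move=> a0; rewrite -rmorphM/= divff. Qed.

(** The slope between [s] and [t] differs from the slopes over [[x, s]] and
    [[t, x + 1]] by at most [A k], by the hat identity.  As the three increments
    add up to [u (x + 1) - u x], this bounds the slope itself. *)
Lemma lipschitz_unit x (A : R) : (forall y, x <= y <= x + 1 -> cabs (u y) <= A) ->
  forall s t, x <= s <= x + 1 -> x <= t <= x + 1 ->
  cabs (u t - u s) <= (2 + k) * A * `|t - s|.
Proof.
move=> hA.
have A0 : 0 <= A by apply: le_trans (hA x _); rewrite ?cabs_ge0// lexx; lra.
have H s t : x <= s -> s < t -> t <= x + 1 -> cabs (u t - u s) <= (2 + k) * A * (t - s).
  move=> xs st tx.
  pose S := (t - s)^-1%:C * (u t - u s).
  have ts0 : 0 < t - s by lra.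
  have SE : u t - u s = (t - s)%:C * S.
    by rewrite /S mulrA realC_divff ?mul1r// gt_eqF.
  have h1 : cabs (u s - u x - (s - x)%:C * S) <= A * k * (s - x).
    have [xs'|sx] := ltP x s; last first.
      have -> : s = x by lra.
      by rewrite !subrr mul0r subr0 cabs0 mulr0.
    have sx0 : s - x != 0 by rewrite subr_eq0 gt_eqF.
    have -> : u s - u x - (s - x)%:C * S =
        (s - x)%:C * - (S - (s - x)^-1%:C * (u s - u x)).
      by rewrite -[u s - u x in LHS]mul1r -(realC_divff sx0); ring.
    rewrite cabsM cabs_real cabsN ger0_norm ?subr_ge0// mulrC ler_wpM2r ?subr_ge0//.
    apply: slope_jump => //; first by lra.
    by move=> y /andP[? ?]; apply: hA; apply/andP; split; lra.
  have h3 : cabs (u (x + 1) - u t - (x + 1 - t)%:C * S) <= A * k * (x + 1 - t).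
    have [tx'|xt] := ltP t (x + 1); last first.
      have -> : t = x + 1 by lra.
      by rewrite !subrr mul0r subr0 cabs0 mulr0.
    have tx0 : x + 1 - t != 0 by rewrite subr_eq0 gt_eqF.
    have -> : u (x + 1) - u t - (x + 1 - t)%:C * S =
        (x + 1 - t)%:C * ((x + 1 - t)^-1%:C * (u (x + 1) - u t) - S).
      by rewrite -[u (x + 1) - u t in LHS]mul1r -(realC_divff tx0); ring.
    rewrite cabsM cabs_real ger0_norm ?subr_ge0// mulrC ler_wpM2r ?subr_ge0//.
    apply: slope_jump => //; first by lra.
    by move=> y /andP[? ?]; apply: hA; apply/andP; split; lra.
  have S_E : S = (u (x + 1) - u x) - (u s - u x - (s - x)%:C * S)
                 - (u (x + 1) - u t - (x + 1 - t)%:C * S).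
    have E : (s - x)%:C + (t - s)%:C + (x + 1 - t)%:C = 1 :> R[i].
      by rewrite -!rmorphD/= (_ : s - x + (t - s) + (x + 1 - t) = 1)//; ring.
    rewrite -[LHS]mul1r -E !mulrDl -SE; ring.
  have hS : cabs S <= (2 + k) * A.
    rewrite S_E.
    have g1 : cabs (u x) <= A by apply: hA; lra.
    have g2 : cabs (u (x + 1)) <= A by apply: hA; lra.
    apply: (le_trans (cabsB _ _)).
    have g3 := cabsB (u (x + 1) - u x) (u s - u x - (s - x)%:C * S).
    have g4 := cabsB (u (x + 1)) (u x).
    have g5 : A * k * (s - x) + A * k * (x + 1 - t) <= A * k.
      rewrite -mulrDr -[leRHS]mulr1 ler_wpM2l ?mulr_ge0//; lra.
    have -> : (2 + k) * A = A + A + A * k by ring.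
    lra.
  by rewrite SE cabsM cabs_real mulrC ger0_norm ?(ltW ts0)// ler_wpM2r ?(ltW ts0).
move=> s t /andP[s1 s2] /andP[t1 t2]; have [st|ts|->] := ltgtP s t.
- by rewrite ger0_norm ?subr_ge0 ?(ltW st)// H.
- by rewrite cabs_distC distrC ger0_norm ?subr_ge0 ?(ltW ts)// H.
- by rewrite !subrr cabs0 normr0 mulr0.
Qed.

Let cabs2 (x : measurableTypeR R) : \bar R := (cabs (u x) ^+ 2)%:E.

Let measurable_cabs2 (D : set (measurableTypeR R)) : measurable_fun D cabs2.
Proof.
apply: (@measurable_funS _ _ _ _ setT) => //.
apply/measurable_EFinP; apply: measurable_funX.
by apply: continuous_measurable_fun; apply: cabs_continuous.
Qed.

Let cabs2_ge0 x : (0 <= cabs2 x)%E.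
Proof. by rewrite lee_fin exprn_ge0// cabs_ge0. Qed.

Lemma sup_attained x : exists2 A : R, (forall y, x <= y <= x + 1 -> cabs (u y) <= A) &
  exists2 x0, x <= x0 <= x + 1 & cabs (u x0) = A.
Proof.
have xx1 : x <= x + 1 by lra.
have cu' : {within `[x, x + 1], continuous (fun y => cabs (u y))}.
  by apply: continuous_subspaceT; apply: cabs_continuous.
have [c cx hc] := EVT_max xx1 cu'.
exists (cabs (u c)); first by move=> y hy; apply: hc; rewrite in_itv.
by exists c => //; move: cx; rewrite in_itv.
Qed.

(** By the Lipschitz bound, [|u|] stays above half of its maximum [A] on an
    interval of length [1 / (2 (2 + k))] around the point of maximum. *)
Lemma sup_L2 x (A : R) : (forall y, x <= y <= x + 1 -> cabs (u y) <= A) ->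
  (exists2 x0, x <= x0 <= x + 1 & cabs (u x0) = A) ->
  ((A ^+ 2 / (8 * (2 + k)))%:E <=
    \int[lebesgue_measure]_(y in `[x, (x + 1)%R]) cabs2 y)%E.
Proof.
move=> hA [x0 /andP[xx0 x0x] Ax0].
have A0 : 0 <= A by rewrite -Ax0 cabs_ge0.
pose l := (2 * (2 + k))^-1.
have kk0 : 0 <= k := k0.
have k2 : 0 < 2 + k by rewrite ltr_pwDl.
have l0 : 0 < l by rewrite invr_gt0; lra.
have l1 : l <= 1 / 4.
  by rewrite /l -[1 / 4]invrK lef_pV2 ?posrE//; lra.
have lE : l = (2 * (2 + k))^-1 by [].
clearbody l.
(* to the right of [x0] if there is room in the unit interval, else to the left *)
have [s xs [sx hs]] : exists2 s : R, x <= s & s + l <= x + 1 /\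
    forall y, s <= y <= s + l -> `|y - x0| <= l.
  have [h|h] := leP (x0 + l) (x + 1).
    exists x0 => //; split=> // y /andP[? ?]; rewrite ler_norml; apply/andP; split; lra.
  exists (x0 - l); first lra.
  by split=> [|y /andP[? ?]]; [lra|rewrite ler_norml; apply/andP; split; lra].
have low y : s <= y <= s + l -> A / 2 <= cabs (u y).
  move=> hy; have xy : x <= y <= x + 1 by case/andP: hy => ? ?; apply/andP; split; lra.
  have := @lipschitz_unit x A hA x0 y; rewrite xx0 x0x => /(_ isT xy) h.
  have h2 : (2 + k) * A * `|y - x0| <= A / 2.
    apply: (@le_trans _ _ ((2 + k) * A * l)).
      by rewrite ler_wpM2l ?hs// mulr_ge0// ltW.
    by rewrite le_eqVlt; apply/orP; left; apply/eqP; rewrite lE; field; rewrite gt_eqF.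
  have := cabsB (u y) (u y - u x0); rewrite opprB addrCA subrr addr0 Ax0; lra.
apply: (@le_trans _ _ (\int[lebesgue_measure]_(y in `[s, (s + l)%R]) ((A / 2) ^+ 2)%:E)%E).
  rewrite integral_cst//= lebesgue_measure_itv/= lte_fin ltrDl l0 -EFinD -EFinM lee_fin.
  by rewrite le_eqVlt; apply/orP; left; apply/eqP; rewrite lE; field; rewrite gt_eqF.
apply: (@le_trans _ _ (\int[lebesgue_measure]_(y in `[s, (s + l)%R]) cabs2 y)%E).
  apply: ge0_le_integral => //.
  - by move=> y _; rewrite lee_fin exprn_ge0// divr_ge0.
  - move=> y /=; rewrite in_itv/= => hy; rewrite lee_fin ler_pXn2r ?nnegrE ?low ?cabs_ge0//.
    by rewrite divr_ge0.
apply: ge0_subset_integral => // y /=; rewrite !in_itv/= => /andP[? ?].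
by apply/andP; split; lra.
Qed.

(** The integrals over [[- n, n]] tend to the finite integral over the line, and a
    unit interval far out is disjoint from [[- n, n]]. *)
Lemma L2_tail e : 0 < e -> exists X : R, forall x, X <= `|x| ->
  (\int[lebesgue_measure]_(y in `[x, (x + 1)%R]) cabs2 y <= e%:E)%E.
Proof.
move=> e0.
pose F (n : nat) : set (measurableTypeR R) := `[- n%:R, n%:R]%classic.
have ndF : nondecreasing_seq F.
  move=> n m nm; apply/subsetPset => y; rewrite /F /= !in_itv/= => /andP[h1 h2].
  have : n%:R <= m%:R :> R by rewrite ler_nat.
  by move=> ?; apply/andP; split; lra.
have UF : \bigcup_n F n = setT.
  apply/seteqP; split=> // y _; exists (Num.bound `|y|) => //.
  rewrite /F /= in_itv/=; have := archi_boundP (normr_ge0 y).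
  by rewrite ltr_norml => /andP[/ltW -> /ltW ->].
have := @ge0_nondecreasing_set_cvg_integral _ _ R F cabs2 lebesgue_measure ndF
  (fun i => measurable_itv _) (fun i => @measurable_cabs2 (F i)) (fun _ _ _ => cabs2_ge0 _).
rewrite UF.
set I := (\int[_]_(x in setT) _)%E => cvgI.
have Ifin : I \is a fin_num.
  by rewrite ge0_fin_numE; [exact: L2u|exact: integral_ge0].
have [n hn] : exists n : nat, (I - e%:E < \int[lebesgue_measure]_(x in F n) cabs2 x)%E.
  have lt : (I - e%:E < I)%E by rewrite lteBlDr// lteDl// lte_fin.
  have := cvgI (fun y => (I - e%:E < y)%E); rewrite nbhs_simpl.
  case; first by apply: open_nbhs_nbhs; split => //; exact: open_ereal_gt_ereal.
  by move=> n _ /(_ n (leqnn _)) hn; exists n.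
exists (n%:R + 2) => x hx.
have disj : F n `&` `[x, x + 1]%classic = set0.
  apply/seteqP; split=> // y []; rewrite /F /= !in_itv/= => /andP[y1 y2] /andP[y3 y4].
  have n0 : 0 <= n%:R :> R by [].
  by move: hx; have [x0|x0] := leP 0 x; [rewrite ger0_norm//|rewrite ltr0_norm//] => hx; lra.
have : (\int[lebesgue_measure]_(y in F n `|` `[x, (x + 1)%R]) cabs2 y <= I)%E.
  apply: ge0_subset_integral => //.
  by apply: measurableU => //; exact: measurable_itv.
rewrite ge0_integral_setU//; last 2 first.
- exact: measurable_itv.
- exact/eqP.
set P := (X in (X + _ <= _)%E); set Q := (X in (_ + X <= _)%E) => PQ.
rewrite -/Q; have {}hn : (I - e%:E < P)%E := hn.
have P0 : (0 <= P)%E by apply: integral_ge0.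
have Q0 : (0 <= Q)%E by apply: integral_ge0.
have Pfin : P \is a fin_num.
  rewrite ge0_fin_numE//; apply: le_lt_trans (_ : I < +oo)%E; last by rewrite ltey_eq Ifin.
  by apply: le_trans PQ; rewrite leeDl.
have Qfin : Q \is a fin_num.
  rewrite ge0_fin_numE//; apply: le_lt_trans (_ : I < +oo)%E; last by rewrite ltey_eq Ifin.
  by apply: le_trans PQ; rewrite leeDr.
move: hn PQ; rewrite -(fineK Pfin) -(fineK Qfin) -(fineK Ifin) -EFinB -EFinD !lee_fin lte_fin.
lra.
Qed.

Lemma u_decay e : 0 < e -> exists X : R, forall x, X <= `|x| ->
  (forall y, x <= y <= x + 1 -> cabs (u y) <= e) /\
  (forall s t, x <= s <= x + 1 -> x <= t <= x + 1 ->
    cabs (u t - u s) <= e * `|t - s|).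
Proof.
move=> e0.
have kk0 : 0 <= k := k0.
have k2 : 0 < 2 + k by rewrite ltr_pwDl.
pose e1 := e / (2 + k).
have e10 : 0 < e1 by rewrite divr_gt0.
have [X hX] := @L2_tail (e1 ^+ 2 / (8 * (2 + k))) ltac:(by rewrite divr_gt0 ?exprn_gt0//; lra).
exists X => x /hX h; have [A hA hx0] := sup_attained x.
have A0 : 0 <= A by case: hx0 => x0 _ <-; exact: cabs_ge0.
have Ae1 : A <= e1.
  have := le_trans (sup_L2 hA hx0) h; rewrite lee_fin ler_pM2r ?invr_gt0; last by lra.
  by rewrite ler_pXn2r// nnegrE// ltW.
have Ae : (2 + k) * A <= e.
  by rewrite mulrC -ler_pdivlMr.
split=> [y hy|s t hs ht].
  apply: (le_trans (hA y hy)); apply: le_trans Ae.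
  by rewrite ler_peMl//; lra.
by apply: (le_trans (lipschitz_unit hA hs ht)); rewrite ler_wpM2r.
Qed.

Lemma u_bounded_lipschitz : exists2 F : R, 0 <= F & (forall x, cabs (u x) <= F) /\
  (forall s t, cabs (u t - u s) <= F * `|t - s|).
Proof.
have kk0 : 0 <= k := k0.
have k2 : 0 < 2 + k by rewrite ltr_pwDl.
pose I := fine (\int[lebesgue_measure]_(y in setT) cabs2 y)%E.
have I0 : 0 <= I by apply: fine_ge0; exact: integral_ge0.
pose B := Num.sqrt (I * (8 * (2 + k))).
have B0 : 0 <= B by exact: sqrtr_ge0.
have k20 : 0 <= 8 * (2 + k) by lra.
have hB x : cabs (u x) <= B.
  have [A hA hx0] := sup_attained x.
  have A0 : 0 <= A by case: hx0 => x0 _ <-; exact: cabs_ge0.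
  apply: (le_trans (hA x _)); first by rewrite lexx; lra.
  rewrite -[A]ger0_norm// -sqrtr_sqr ler_wsqrtr// -ler_pdivrMr; last by lra.
  rewrite -lee_fin; apply: (le_trans (sup_L2 hA hx0)).
  rewrite fineK; last by rewrite ge0_fin_numE; [exact: L2u|exact: integral_ge0].
  by apply: ge0_subset_integral => //; exact: measurable_itv.
exists ((2 + k) * B); first by rewrite mulr_ge0// ltW.
have BF : 2 * B <= (2 + k) * B by rewrite ler_wpM2r//; lra.
split=> [x|].
  by apply: (le_trans (hB x)); lra.
have H s t : s <= t -> cabs (u t - u s) <= (2 + k) * B * (t - s).
  move=> st; have [h|h] := leP t (s + 1).
    have := @lipschitz_unit s B (fun y _ => hB y) s t; rewrite ger0_norm ?subr_ge0//.
    by apply; rewrite ?lexx ?st//=; lra.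
  apply: (le_trans (cabsB _ _)); apply: (@le_trans _ _ (2 * B)).
    by have := hB t; have := hB s; lra.
  rewrite -[leLHS]mulr1 ler_pM//; lra.
move=> s t; have [st|ts] := leP s t.
  by rewrite ger0_norm ?subr_ge0// H.
by rewrite cabs_distC distrC ger0_norm ?subr_ge0 ?(ltW ts)// H// ltW.
Qed.

End decay.

(** * Difference equations and their transfer matrices *)

Section discrete.
Context {R : realType}.
Local Notation C := R[i].

(** [b <= sinh b], by the mean value theorem. *)
Lemma expR_sub_ge (b : R) : 0 <= b -> 2 * b <= expR b - expR (- b).
Proof.
rewrite le_eqVlt => /orP[/eqP <-|b0]; first by rewrite oppr0 mulr0 subrr.
pose f (x : R) := expR x - expR (- x) - 2 * x.
pose f' (x : R) := expR x - expR (- x) * (- 1) - 2 * 1.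
have df (x : R) : is_derive x (1 : R) f (f' x).
  have h1 := is_derive_expR x.
  have h2 : is_derive x (1 : R) (fun y : R => expR (- y)) (expR (- x) * (- 1)).
    exact: (@is_derive1_comp _ expR (fun y : R => - y)).
  have h3 : is_derive x (1 : R) (fun y : R => 2 * y) (2 * 1).
    have := is_deriveM (is_derive_cst (2 : R) x (1 : R)) (is_derive_id x (1 : R)).
    by move=> h; apply: is_derive_eq h _; rewrite /GRing.scale/= mulr0 addr0.
  exact: (is_deriveB (is_deriveB h1 h2) h3).
have cf : {within `[0, b], continuous f}.
  apply: continuous_subspaceT => x; apply: differentiable_continuous.
  by apply/derivable1_diffP; case: (df x).
have [c _] := @MVT R f f' 0 b b0 (fun x _ => df x) cf.
have f0 : f 0 = 0 by rewrite /f oppr0 subrr mulr0 subr0.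
rewrite f0 !subr0 => E.
have : 0 <= f' c * b.
  rewrite mulr_ge0 ?(ltW b0)// /f' expRN mulrN1 opprK mulr1.
  have e0 := expR_gt0 c.
  have -> : expR c + (expR c)^-1 - 2 = (expR c - 1) ^+ 2 / expR c.
    by field; rewrite gt_eqF.
  by rewrite divr_ge0 ?sqr_ge0// ltW.
by rewrite -E /f; lra.
Qed.

(** The squared norm of the shear with parameter [a] is at most [exp a]; this comes
    down to [a <= 2 sinh (a / 2)].  The Frobenius norm would only give
    [2 + a ^ 2], which is useless for a product of many shears. *)
Lemma shear_growth (x y a : R) : 0 <= a ->
  (x + a * y) ^+ 2 + y ^+ 2 <= expR a * (x ^+ 2 + y ^+ 2).
Proof.
move=> a0; set E := expR a.
have E0 : 0 < E by exact: expR_gt0.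
have hE : a ^+ 2 * E <= (E - 1) ^+ 2.
  have b0 : 0 <= a / 2 by lra.
  have h := expR_sub_ge b0; rewrite (_ : 2 * (a / 2) = a) in h; last by field.
  have EE : E = expR (a / 2) ^+ 2.
    by rewrite expr2 -expRD /E; congr expR; field.
  have e0 := expR_gt0 (a / 2).
  have hh : a * expR (a / 2) <= E - 1.
    rewrite EE; apply: (@le_trans _ _ ((expR (a / 2) - expR (- (a / 2))) * expR (a / 2))).
      by rewrite ler_wpM2r// ltW.
    by rewrite mulrBl -[X in _ - X]expRD addNr expR0 expr2.
  have -> : a ^+ 2 * E = (a * expR (a / 2)) ^+ 2 by rewrite EE; ring.
  have h0 : 0 <= a * expR (a / 2) by rewrite mulr_ge0// ltW.
  by rewrite ler_pXn2r// nnegrE// (le_trans h0).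
have E1 : 1 <= E by rewrite /E -expR0 ler_expR.
have [az|a1] := eqVneq a 0; first by rewrite /E az expR0 mul0r addr0 mul1r.
have apos : 0 < a by rewrite lt_neqAle eq_sym a1.
have E1' : 0 < E - 1.
  by rewrite subr_gt0 /E -expR0 ltr_expR.
(* [E - 1] times the difference of the two sides is the following sum *)
have : 0 <= ((E - 1) * x - a * y) ^+ 2 + ((E - 1) ^+ 2 - a ^+ 2 * E) * y ^+ 2.
  by rewrite addr_ge0 ?sqr_ge0// mulr_ge0 ?sqr_ge0// subr_ge0.
have -> : ((E - 1) * x - a * y) ^+ 2 + ((E - 1) ^+ 2 - a ^+ 2 * E) * y ^+ 2 =
  (E - 1) * (E * (x ^+ 2 + y ^+ 2) - ((x + a * y) ^+ 2 + y ^+ 2)) by ring.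
by rewrite pmulr_rge0// subr_ge0.
Qed.

Lemma cshear_growth (X Y a : C) : cabs (X + a * Y) ^+ 2 + cabs Y ^+ 2 <=
  expR (cabs a) * (cabs X ^+ 2 + cabs Y ^+ 2).
Proof.
apply: le_trans (shear_growth (cabs X) (cabs Y) (cabs_ge0 a)).
have le : cabs (X + a * Y) <= cabs X + cabs a * cabs Y.
  by rewrite (le_trans (cabsD _ _))// cabsM.
by rewrite lerD2r !expr2 ler_pM ?cabs_ge0.
Qed.

Variables (h s : R) (m : nat -> C).
Hypotheses (h0 : 0 < h) (s0 : 0 < s).

(** One step of the recursion in the coordinates value and slope:
    [(f, d)] becomes [(f', d + m f')] with [f' = f + h d]. *)
Definition step_mx (i : nat) : 'M[C]_2 := \matrix_(j, l)
  if j == 0 then (if l == 0 then 1 else h%:C)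
  else (if l == 0 then m i else 1 + m i * h%:C).

Fixpoint transfer_mx (k n : nat) : 'M[C]_2 :=
  if n is n'.+1 then step_mx (k + n) *m transfer_mx k n' else 1%:M.

Lemma mulmx2E (p : nat) (A : 'M[C]_2) (B : 'M[C]_(2, p)) i j :
  (A *m B) i j = A i 0 * B 0 j + A i 1 * B 1 j.
Proof.
rewrite mxE big_ord_recl big_ord1; congr (_ + A i _ * B _ j); exact: val_inj.
Qed.

Lemma ord2P (P : 'I_2 -> Prop) : P 0 -> P 1 -> forall i, P i.
Proof.
move=> P0 P1 [[|[|//]] hi].
- by rewrite (_ : Ordinal hi = 0)//; exact: val_inj.
- by rewrite (_ : Ordinal hi = 1)//; exact: val_inj.
Qed.

Lemma transfer_mx_cat k n n' : transfer_mx k (n + n') = transfer_mx (k + n) n' *m transfer_mx k n.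
Proof.
elim: n' => [|n' IH]; first by rewrite addn0 mul1mx.
by rewrite addnS /= IH mulmxA !addnS addnA.
Qed.

Lemma transfer_mxS k n : transfer_mx k n.+1 = transfer_mx k.+1 n *m step_mx k.+1.
Proof. by have := transfer_mx_cat k 1 n; rewrite add1n addn1 => ->; rewrite /= mulmx1 addn1. Qed.

(** The weight [s] balances the two shears of a step: their parameters become
    [s h] and [m / s]. *)
Definition energy (f d : C) : R := s ^+ 2 * cabs f ^+ 2 + cabs d ^+ 2.

Lemma step_growth i (f d : C) :
  energy (f + h%:C * d) (d + m i * (f + h%:C * d)) <=
  expR (s * h + cabs (m i) / s) * energy f d.
Proof.
rewrite expRD; pose f' := f + h%:C * d; rewrite -/f'.
have sE : cabs s%:C = s by rewrite cabs_real ger0_norm// ltW.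
have sn0 : s%:C != 0 :> C.
  by apply/eqP => /(congr1 (@cabs R)); rewrite sE cabs0; move: s0 => /lt0r_neq0/eqP.
have W f1 d1 : energy f1 d1 = cabs (s%:C * f1) ^+ 2 + cabs d1 ^+ 2.
  by rewrite /energy cabsM sE exprMn.
have st1 : energy f' d <= expR (s * h) * energy f d.
  have := cshear_growth (s%:C * f) d (s * h)%:C.
  rewrite cabs_real ger0_norm ?mulr_ge0 ?(ltW s0) ?(ltW h0)// !W.
  by rewrite (_ : s%:C * f + (s * h)%:C * d = s%:C * f')// rmorphM/= /f'; ring.
have st2 : energy f' (d + m i * f') <= expR (cabs (m i) / s) * energy f' d.
  have := cshear_growth d (s%:C * f') (m i * s^-1%:C).
  have -> : cabs (m i * s^-1%:C) = cabs (m i) / s.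
    by rewrite cabsM cabs_real ger0_norm// invr_ge0 ltW.
  rewrite !W.
  rewrite (_ : m i * s^-1%:C * (s%:C * f') = m i * f'); last first.
    have E : s^-1%:C * s%:C = 1 :> C by rewrite -rmorphM/= mulVf// gt_eqF.
    by rewrite -[RHS]mulr1 -E; ring.
  by rewrite (addrC (cabs (d + _) ^+ 2)) (addrC (cabs d ^+ 2)).
apply: (le_trans st2); rewrite [expR _ * expR _]mulrC -mulrA.
by rewrite ler_wpM2l ?expR_ge0.
Qed.

Definition growth k n : R := expR (\sum_(i < n) (s * h + cabs (m (k + i.+1)) / s)).

Lemma transfer_mx_growth k n (v : 'cV[C]_2) :
  energy ((transfer_mx k n *m v) 0 0) ((transfer_mx k n *m v) 1 0) <= growth k n * energy (v 0 0) (v 1 0).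
Proof.
elim: n => [|n IH]; first by rewrite /growth big_ord0 expR0 mul1r mul1mx.
rewrite /= -mulmxA; set w := transfer_mx k n *m v in IH *.
have -> : (step_mx (k + n.+1) *m w) 0 0 = w 0 0 + h%:C * w 1 0.
  by rewrite mulmx2E !mxE /= mul1r.
have -> : (step_mx (k + n.+1) *m w) 1 0 = w 1 0 + m (k + n.+1) * (w 0 0 + h%:C * w 1 0).
  by rewrite mulmx2E !mxE /=; ring.
apply: (le_trans (step_growth _ _ _)).
have -> : growth k n.+1 = growth k n * expR (s * h + cabs (m (k + n.+1)) / s).
  by rewrite /growth big_ord_recr/= expRD.
by rewrite [leRHS]mulrAC [leRHS]mulrC ler_wpM2l ?expR_ge0.
Qed.

Lemma transfer_mx_bound k n (E : R) : growth k n <= E ^+ 2 -> 0 <= E ->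
  forall i j, cabs (transfer_mx k n i j) <= (1 + s + s^-1) * E.
Proof.
move=> hE E0.
have sV : 0 < s^-1 by rewrite invr_gt0.
have c1 := @transfer_mx_growth k n (\col_i (i == 0)%:R).
have c2 := @transfer_mx_growth k n (\col_i (i == 1)%:R).
have col (i l : 'I_2) : (transfer_mx k n *m (\col_(j < 2) ((j == l)%:R : C))) i 0 = transfer_mx k n i l.
  rewrite mulmx2E !mxE; move: l; apply: ord2P => /=.
    by rewrite mulr1 mulr0 addr0.
  by rewrite mulr1 mulr0 add0r.
rewrite !col !mxE /= /energy cabs0 cabs1 expr0n/= !expr1n addr0 mulr1 mulr0 add0r mulr1 in c1 c2.
have {}c1 := le_trans c1 (ler_wpM2r (sqr_ge0 s) hE).
have {}c2 := le_trans c2 hE.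
have sq (x y : R) : 0 <= y -> 0 <= x -> x ^+ 2 <= y ^+ 2 -> x <= y.
  by move=> y0 x0; rewrite ler_pXn2r// nnegrE.
have b00 : cabs (transfer_mx k n 0 0) <= E.
  apply: sq => //; first exact: cabs_ge0.
  have s2 : 0 < s ^+ 2 by rewrite exprn_gt0.
  rewrite -(ler_pM2l s2) [leRHS]mulrC; apply: le_trans c1.
  by rewrite lerDl sqr_ge0.
have b10 : cabs (transfer_mx k n 1 0) <= s * E.
  apply: sq; [by rewrite mulr_ge0// ltW|exact: cabs_ge0|].
  rewrite exprMn [leRHS]mulrC; apply: le_trans c1.
  by rewrite lerDr mulr_ge0 ?sqr_ge0.
have b01 : cabs (transfer_mx k n 0 1) <= s^-1 * E.
  apply: sq; [by rewrite mulr_ge0// ltW|exact: cabs_ge0|].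
  rewrite exprMn exprVn mulrC ler_pdivlMr ?exprn_gt0// mulrC; apply: le_trans c2.
  by rewrite lerDl sqr_ge0.
have b11 : cabs (transfer_mx k n 1 1) <= E.
  apply: sq => //; first exact: cabs_ge0.
  by apply: le_trans c2; rewrite lerDr mulr_ge0 ?sqr_ge0.
have sE : 0 <= s * E by rewrite mulr_ge0// ltW.
have sVE : 0 <= s^-1 * E by rewrite mulr_ge0// ltW.
rewrite !mulrDl mul1r.
by apply: ord2P; apply: ord2P; lra.
Qed.

(** The entries of a row [A i] subject to [A i = A i.+1 *m step_mx i.+1], that is,
    of a solution of the adjoint recursion: the pairing with a solution of the
    difference equation is constant. *)
Definition backward_row (al be : nat -> C) k n := forall i, (k <= i < k + n)%N ->
  al i = al i.+1 + m i.+1 * be i.+1 /\ be i = be i.+1 + h%:C * al i.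

Definition pairing (al be f : nat -> C) i : C :=
  al i * f i + be i * ((f i.+1 - f i) / h%:C).

(** The coefficients of the equation for [f] are perturbed by the differences of
    [q].  Summation by parts, done here by adding [q be f] to the pairing,
    moves the difference to [be f], whose increments are of the order [h].  Only
    boundary values of [q] and [h] times the sum of its moduli remain. *)
Lemma perturbed_pairing (al be f q eta : nat -> C) k n (G F : R) :
  backward_row al be k n ->
  (forall i, (k < i <= k + n)%N ->
    f i.+1 - f i = f i - f i.-1 + h%:C * (m i * f i + (q i.-1 - q i) * f i + eta i)) ->
  (forall i, (k <= i <= k + n)%N -> cabs (al i) <= G /\ cabs (be i) <= G) ->
  (forall i, cabs (f i) <= F) -> (forall i, cabs (f i.+1 - f i) <= F * h) ->
  cabs (pairing al be f (k + n) - pairing al be f k) <=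
    G * F * (cabs (q (k + n)) + cabs (q k) + 2 * h * \sum_(i < n) cabs (q (k + i)%N))
    + G * \sum_(i < n) cabs (eta (k + i.+1)%N).
Proof.
move=> row eqf hG hF hdF.
have hC0 : h%:C != 0 :> C.
  apply/eqP => /(congr1 (@cabs R)); rewrite cabs_real cabs0 ger0_norm ?(ltW h0)//.
  by move: h0 => /lt0r_neq0/eqP.
have G0 : 0 <= G.
  by have [h1 _] := hG k ltac:(by rewrite leqnn leq_addr); apply: le_trans h1; exact: cabs_ge0.
have F0 : 0 <= F by apply: le_trans (hF 0%N); exact: cabs_ge0.
(* the increments of the modified pairing do not contain differences of [q] *)
pose Z i := pairing al be f i + q i * be i * f i.
have dZ i : (k <= i < k + n)%N -> cabs (Z i.+1 - Z i) <=
    G * cabs (eta i.+1) + 2 * h * (G * F) * cabs (q i).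
  move=> /andP[ki ik]; have [h1 h2] := row i ltac:(by rewrite ki ik).
  have h3 := eqf i.+1 ltac:(by rewrite ltnS ki).
  have [g1 g2] := hG i ltac:(by rewrite ki ltnW).
  have [g3 g4] := hG i.+1 ltac:(by rewrite (leq_trans ki)//).
  have -> : Z i.+1 - Z i = be i.+1 * eta i.+1 +
     q i * (be i * (f i.+1 - f i) - h%:C * al i * f i.+1).
    rewrite /Z /pairing h3 /= h2 h1; field; exact: hC0.
  have t1 : cabs (be i.+1 * eta i.+1) <= G * cabs (eta i.+1).
    by rewrite cabsM ler_wpM2r ?cabs_ge0.
  have t2 : cabs (q i * (be i * (f i.+1 - f i) - h%:C * al i * f i.+1)) <=
      2 * h * (G * F) * cabs (q i).
    rewrite cabsM mulrC ler_wpM2r ?cabs_ge0//.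
    apply: (le_trans (cabsB _ _)).
    have -> : 2 * h * (G * F) = G * (F * h) + h * G * F by ring.
    apply: lerD.
      by rewrite cabsM ler_pM ?cabs_ge0.
    rewrite !cabsM cabs_real ger0_norm ?(ltW h0)// ler_pM ?mulr_ge0 ?cabs_ge0 ?(ltW h0)//.
    by rewrite ler_wpM2l ?(ltW h0).
  by apply: (le_trans (cabsD _ _)); exact: lerD.
have tel l : (l <= n)%N -> cabs (Z (k + l)%N - Z k) <=
    \sum_(i < l) (G * cabs (eta (k + i.+1)%N) + 2 * h * (G * F) * cabs (q (k + i)%N)).
  elim: l => [|l IH] ln; first by rewrite addn0 subrr cabs0 big_ord0.
  have -> : Z (k + l.+1)%N - Z k = (Z (k + l)%N - Z k) + (Z (k + l.+1)%N - Z (k + l)%N).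
    by ring.
  rewrite big_ord_recr/=; apply: (le_trans (cabsD _ _)); apply: lerD.
    exact: IH (ltnW ln).
  by rewrite !addnS; apply: dZ; rewrite leq_addr ltn_add2l.
have {}tel := tel n (leqnn n).
have -> : pairing al be f (k + n) - pairing al be f k =
  (Z (k + n)%N - Z k) - (q (k + n)%N * be (k + n)%N * f (k + n)%N - q k * be k * f k).
  by rewrite /Z; ring.
have qb i : (k <= i <= k + n)%N -> cabs (q i * be i * f i) <= G * F * cabs (q i).
  move=> /hG[_ g]; rewrite !cabsM -mulrA [leRHS]mulrC ler_wpM2l ?cabs_ge0//.
  by rewrite ler_pM ?cabs_ge0.
apply: (le_trans (cabsB _ _)).
have b1 := qb (k + n)%N ltac:(by rewrite leq_addr leqnn).
have b2 := qb k ltac:(by rewrite leqnn leq_addr).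
have b3 := cabsB (q (k + n)%N * be (k + n)%N * f (k + n)%N) (q k * be k * f k).
move: tel; rewrite big_split/= -!mulr_sumr => tel.
rewrite !mulrDr; lra.
Qed.

Lemma forward_row k n (l : 'I_2) : backward_row
  (fun i => transfer_mx i (k + n - i) l 0) (fun i => transfer_mx i (k + n - i) l 1) k n.
Proof.
move=> i /andP[ki ik]; have -> : (k + n - i = (k + n - i.+1).+1)%N.
  by rewrite -subSn.
rewrite !transfer_mxS !mulmx2E !mxE /=; split; ring.
Qed.

(** The adjugate; for the transfer matrices, which have determinant 1, it is the
    inverse. *)
Definition adjugate2 (A : 'M[C]_2) : 'M[C]_2 := \matrix_(i, j)
  if i == 0 then (if j == 0 then A 1 1 else - A 0 1)
  else (if j == 0 then - A 1 0 else A 0 0).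

Lemma adjugate2E (A : 'M[C]_2) : (adjugate2 A 0 0 = A 1 1) * (adjugate2 A 0 1 = - A 0 1)
  * (adjugate2 A 1 0 = - A 1 0) * (adjugate2 A 1 1 = A 0 0).
Proof. by rewrite !mxE. Qed.

Lemma step_mxE i : (step_mx i 0 0 = 1) * (step_mx i 0 1 = h%:C)
  * (step_mx i 1 0 = m i) * (step_mx i 1 1 = 1 + m i * h%:C).
Proof. by rewrite !mxE. Qed.

Lemma adjoint_row k n (l : 'I_2) : backward_row
  (fun i => adjugate2 (transfer_mx k (i - k)) l 0) (fun i => adjugate2 (transfer_mx k (i - k)) l 1) k n.
Proof.
move=> i /andP[ki ik]; rewrite subSn//= addnS subnKC//.
move: l; apply: ord2P; rewrite !adjugate2E !mulmx2E !step_mxE; split; ring.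
Qed.

Lemma adjugate2_bound (A : 'M[C]_2) (E : R) : (forall i j, cabs (A i j) <= E) ->
  forall i j, cabs (adjugate2 A i j) <= E.
Proof.
by move=> hA; apply: ord2P; apply: ord2P; rewrite mxE /= ?cabsN.
Qed.

End discrete.

(** * Lipschitz functions as tests of a local measure *)

Section lipschitz_tests.
Context {R : realType}.
Implicit Types (g phi : R -> R[i]).

(** A Lipschitz function need not be differentiable everywhere, and the real and
    imaginary parts may fail to be at different points.  Where a limit of
    difference quotients does not exist, its value is 0 by convention, so that
    the bound holds at every point. *)
Lemma cabs_cderiven_le1 phi : (forall x y, cabs (phi x - phi y) <= `|x - y|) ->
  forall x, cabs (cderiven 1 phi x) <= 1.
Proof.
move=> lip x; rewrite /cderiven /=.
pose dr (t : R) := t^-1 *: (re (phi (t + x)) - re (phi x)).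
pose di (t : R) := t^-1 *: (im (phi (t + x)) - im (phi x)).
have le1 t : t != 0 -> dr t ^+ 2 + di t ^+ 2 <= 1.
  move=> t0; have := lip (t + x) x; rewrite addrK => h.
  have tt : 0 < `|t| by rewrite normr_gt0.
  have E : dr t ^+ 2 + di t ^+ 2 = (cabs (phi (t + x) - phi x) / `|t|) ^+ 2.
    rewrite expr_div_n -[`|t| ^+ 2]normrX ger0_norm ?sqr_ge0//.
    have -> : cabs (phi (t + x) - phi x) ^+ 2 =
       (re (phi (t + x)) - re (phi x)) ^+ 2 + (im (phi (t + x)) - im (phi x)) ^+ 2.
      by case: (phi _) (phi _) => [a b] [c d] /=; rewrite sqr_sqrtr ?addr_ge0 ?sqr_ge0.
    rewrite /dr /di /GRing.scale/= !exprMn -mulrDr exprVn mulrC //.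
  by rewrite E -[leRHS](expr1n _ 2) !expr2 mul1r; apply: mulr_ile1;
    rewrite ?divr_ge0 ?cabs_ge0 ?ler_pdivrMr ?mul1r.
have near1 : \forall t \near 0^', dr t ^+ 2 + di t ^+ 2 <= 1.
  by near=> t; apply: le1; near: t; exact: nbhs_dnbhs_neq.
suff sq : derive1 (fun y => re (phi y)) x ^+ 2 + derive1 (fun y => im (phi y)) x ^+ 2 <= 1.
  by rewrite -[leRHS]sqrtr1 ler_wsqrtr.
rewrite /derive1.
have cr : cvg (dr t @[t --> 0^']) \/ lim (dr t @[t --> 0^']) = 0.
  by have [?|/dvgP h] := pselect (cvg (dr t @[t --> 0^'])); [left|right; rewrite h].
have ci : cvg (di t @[t --> 0^']) \/ lim (di t @[t --> 0^']) = 0.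
  by have [?|/dvgP h] := pselect (cvg (di t @[t --> 0^'])); [left|right; rewrite h].
rewrite -/dr -/di; case: cr => [cr|->]; case: ci => [ci|->].
- apply: (@cvgr_to_le R (0^') _ _ (fun t => dr t ^+ 2 + di t ^+ 2)) near1.
  exact: (cvgD (cvgM cr cr) (cvgM ci ci)).
- rewrite expr0n/= addr0; apply: (@cvgr_to_le R (0^') _ _ (fun t => dr t ^+ 2)).
    exact: (cvgM cr cr).
  near=> t; apply: (@le_trans _ _ (dr t ^+ 2 + di t ^+ 2)); first by rewrite lerDl sqr_ge0.
  by near: t.
- rewrite expr0n/= add0r; apply: (@cvgr_to_le R (0^') _ _ (fun t => di t ^+ 2)).
    exact: (cvgM ci ci).
  near=> t; apply: (@le_trans _ _ (dr t ^+ 2 + di t ^+ 2)); first by rewrite lerDr sqr_ge0.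
  by near: t.
- by rewrite !expr0n/= addr0.
Unshelve. all: by end_near.
Qed.

Lemma sup_norm_derivative_le1 phi : (forall x y, cabs (phi x - phi y) <= `|x - y|) ->
  (sup_norm_derivative phi <= 1)%E.
Proof.
move=> lip; rewrite /sup_norm_derivative unlock; case: ifP => // _.
apply/ess_supP; apply: aeW => x /=.
by rewrite lee_fin ger0_norm ?cabs_ge0// cabs_cderiven_le1.
Qed.

Lemma ccontinuous_lipschitz phi (L : R) :
  (forall x y, cabs (phi x - phi y) <= L * `|x - y|) -> ccontinuous phi.
Proof.
move=> lip.
have H (f : R -> R) : (forall x y, `|f x - f y| <= L * `|x - y|) -> continuous f.
  move=> hf x; apply/cvgrPdist_le => e e0.
  have L1 : 0 < `|L| + 1 by rewrite ltr_wpDl.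
  near=> t; apply: (le_trans (hf x t)).
  apply: (@le_trans _ _ ((`|L| + 1) * `|x - t|)).
    by rewrite ler_wpM2r// (le_trans (ler_norm _))// lerDl.
  rewrite mulrC -ler_pdivlMr//.
  near: t; have : 0 < e / (`|L| + 1) by rewrite divr_gt0.
  by move=> d0; exists (e / (`|L| + 1)) => //= t /= /ltW.
split; apply: H => x y; apply: le_trans (lip x y).
  by apply: le_trans (re_le_cabs _); case: (phi x) (phi y) => ? ? [].
by apply: le_trans (im_le_cabs _); case: (phi x) (phi y) => ? ? [].
Unshelve. all: by end_near.
Qed.

Lemma local_integral_short (nu : local_measure R) phi (I : set R) (L a b del : R) :
  (seminorm_on nu I <= del%:E)%E -> 0 < L ->
  (forall x y, cabs (phi x - phi y) <= L * `|x - y|) ->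
  a <= b -> b <= a + 2 -> vanishes_outside a b phi -> `[a, b]%classic `<=` I ->
  cabs (local_integral nu phi) <= L * del.
Proof.
move=> hdel L0 lip ab ba2 phi0 abI.
have cphi := ccontinuous_lipschitz lip.
have LC : cabs (L^-1%:C : R[i]) = L^-1 by rewrite cabs_real ger0_norm// invr_ge0 ltW.
pose u x := L^-1%:C * phi x.
have lipu x y : cabs (u x - u y) <= `|x - y|.
  rewrite /u -mulrBr cabsM LC mulrC ler_pdivrMr// mulrC; exact: lip.
have sptu : spt u `<=` `[a, b].
  by apply: spt_subset => x h; rewrite /u phi0// mulr0.
have ubd : cabs (local_integral nu u) <= del.
  rewrite -lee_fin; apply: le_trans hdel; apply: ereal_sup_ubound.
  exists u => //; split.
  - by exists 1 => x y; rewrite mul1r.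
  - exact: subset_trans abI.
  - apply: ge_ereal_sup => _ [x /sptu xs] [y /sptu ys] <-.
    move: xs ys; rewrite /= !in_itv/= => /andP[? ?] /andP[? ?].
    by rewrite lee_fin ler_norml; apply/andP; split; lra.
  - exact: sup_norm_derivative_le1.
have uE : local_integral nu u = L^-1%:C * local_integral nu phi.
  apply: (@riemann_cvg_unique _ (measure_cell nu) a b u).
    apply: local_integral_riemann => //.
      by apply: ccontinuousM => //; exact: ccontinuous_cst.
    by move=> x h; rewrite /u phi0// mulr0.
  by apply: riemann_cvgZ; exact: local_integral_riemann.
by move: ubd; rewrite uE cabsM LC mulrC ler_pdivrMr// mulrC.
Qed.

Lemma ramp_increment (a b x y : R) : a <= b -> x <= y ->
  0 <= (pos_part a y - pos_part b y) - (pos_part a x - pos_part b x) <= y - x.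
Proof.
move=> ab xy; rewrite /pos_part.
by case: (leP (x - a) 0) (leP (x - b) 0) (leP (y - a) 0) (leP (y - b) 0) => ? [] ? [] ? [] ?;
  apply/andP; split; lra.
Qed.

Definition tent (j x : R) : R := hat (j - 1) j (j + 1) x.

Lemma tentE (j x : R) : tent j x =
  (pos_part (j - 1) x - pos_part j x) - (pos_part j x - pos_part (j + 1) x).
Proof.
rewrite /tent /hat (_ : j - (j - 1) = 1); last by ring.
by rewrite (_ : j + 1 - j = 1) ?divr1//; ring.
Qed.

Lemma tent_lipschitz (j x y : R) : `|tent j x - tent j y| <= `|x - y|.
Proof.
wlog xy : x y / x <= y.
  move=> H; have [/H//|/ltW/H] := leP x y.
  by rewrite distrC [X in _ -> _ <= X]distrC.
rewrite distrC [leRHS]distrC [leRHS]ger0_norm ?subr_ge0//.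
have := @ramp_increment (j - 1) j x y; have := @ramp_increment j (j + 1) x y.
rewrite !tentE gerBl ler01 lerDl ler01 xy.
move=> /(_ isT isT)/andP[? ?] /(_ isT isT)/andP[? ?].
by rewrite ler_norml; apply/andP; split; lra.
Qed.

Lemma tent01 (j x : R) : 0 <= tent j x <= 1.
Proof. by apply: hat_ge0_le1; lra. Qed.

(** Each tent is a difference of two consecutive unit ramps, so the sum
    telescopes. *)
Lemma partition_of_unity (K : nat) (x : R) : - K%:R <= x <= K%:R ->
  \sum_(i < (2 * K).+1) tent (i%:R - K%:R) x = 1.
Proof.
move=> /andP[Kx xK].
pose r (n : nat) := pos_part (n%:R - K%:R - 1) x - pos_part (n%:R - K%:R) x.
have tel n : \sum_(i < n) tent (i%:R - K%:R) x = r 0%N - r n.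
  elim: n => [|n IH]; first by rewrite big_ord0 subrr.
  rewrite big_ord_recr/= IH tentE /r -natr1.
  have -> : n%:R + 1 - K%:R - 1 = n%:R - K%:R :> R by ring.
  have -> : n%:R - K%:R + 1 = n%:R + 1 - K%:R :> R by ring.
  ring.
rewrite tel /r sub0r -natr1 natrM.
rewrite (@pos_partE _ (- K%:R - 1)); last lra.
rewrite (@pos_partE _ (- K%:R))//.
by rewrite !pos_part0; [ring|lra..].
Qed.

(** The seminorm only tests functions with support of diameter at most 2.  A
    partition of unity by tents of width 2 cuts [phi] into at most [2 p + 3]
    such pieces, each with Lipschitz constant at most [L + G]. *)
Lemma local_integral_lipschitz (nu : local_measure R) phi (p L G del : R) :
  (seminorm_on nu `[(- p)%R, p] <= del%:E)%E -> 0 < L -> 0 <= G -> 0 < p ->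
  (forall x y, cabs (phi x - phi y) <= L * `|x - y|) ->
  (forall x, cabs (phi x) <= G) ->
  vanishes_outside (- p) p phi ->
  cabs (local_integral nu phi) <= (2 * p + 3) * ((L + G) * del).
Proof.
move=> hdel L0 G0 p0 lip hG phi0.
have cphi := ccontinuous_lipschitz lip.
have [K [pK Kp]] : exists K : nat, p <= K%:R /\ K%:R <= p + 1.
  have := truncn_itv (ltW p0); set t := Num.truncn p => /andP[h1 h2].
  by exists t.+1; split; [exact: ltW|rewrite -natr1 lerD2r].
have del0 : 0 <= del.
  have : cabs (local_integral nu (fun=> 0 : R[i])) <= 1 * del.
    apply: (local_integral_short hdel (phi := fun=> 0) (L := 1) (a := 0) (b := 0)) => //.
    - by move=> x y; rewrite subrr cabs0 mulr_ge0.
    - by move=> x; rewrite /= !in_itv/= => /andP[? ?]; apply/andP; split; lra.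
  by rewrite mul1r; apply: le_trans; exact: cabs_ge0.
have lint : forall g, local_integral nu g = shifted_integral nu 0 g by move=> g; rewrite /shifted_integral mul0r subr0.
pose g (i : 'I_(2 * K).+1) x := phi x * (tent (i%:R - K%:R) x)%:C.
have lipg i x y : cabs (g i x - g i y) <= (L + G) * `|x - y|.
  rewrite /g; set T := tent _.
  have -> : phi x * (T x)%:C - phi y * (T y)%:C =
     (phi x - phi y) * (T x)%:C + phi y * (T x - T y)%:C.
    by move: (T x) (T y) => t1 t2; rewrite rmorphB; ring.
  rewrite [leRHS]mulrDl; apply: (le_trans (cabsD _ _)); apply: lerD.
    rewrite cabsM cabs_real -[leRHS]mulr1 ler_pM ?cabs_ge0//.
    by have /andP[t0 t1] := tent01 (i%:R - K%:R) x; rewrite ger0_norm.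
  by rewrite cabsM cabs_real ler_pM ?cabs_ge0// tent_lipschitz.
have vg i : vanishes_outside (- p) p (g i) by move=> x h; rewrite /g phi0// mul0r.
have LG : 0 < L + G by lra.
have Jg i : cabs (local_integral nu (g i)) <= (L + G) * del.
  pose j : R := i%:R - K%:R.
  (* the pieces next to [- p] and [p] are cut off there *)
  pose a := Num.max (- p) (j - 1); pose b := Num.min p (j + 1).
  have vab : vanishes_outside a b (g i).
    move=> x; rewrite /a /b le_max ge_min => /orP[] /orP[] h.
    - by apply: vg; rewrite h.
    - by rewrite /g -/j /tent hat_vanishes ?mulr0 ?h//; lra.
    - by apply: vg; rewrite h orbT.
    - by rewrite /g -/j /tent hat_vanishes ?mulr0 ?h ?orbT//; lra.
  have [ab|ba] := leP a b.
    apply: (local_integral_short hdel (phi := g i) (L := L + G) (a := a) (b := b)) => //.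
      have h1 : b <= j + 1 by rewrite /b ge_min lexx orbT.
      have h2 : j - 1 <= a by rewrite /a le_max lexx orbT.
      by apply: (le_trans h1); move: h2; move: (a) => a' h2; lra.
    move=> x; rewrite /= !in_itv/= /a /b ge_max le_min => /andP[/andP[-> _] /andP[-> _]] //.
  have -> : g i = fun=> 0.
    apply/funext => x; apply: vab; apply/orP; have [h|h] := leP x a; first by left.
    by right; exact: (le_trans (ltW ba) (ltW h)).
  by rewrite lint shifted_integral0 cabs0 mulr_ge0// ltW.
have -> : local_integral nu phi = \sum_i 1 * local_integral nu (g i).
  rewrite lint; under eq_bigr do rewrite lint.
  rewrite -(@shifted_integral_sum _ _ _ _ _ _ (- p) p)//.
  - congr shifted_integral; apply/funext => x; rewrite /g.
    under eq_bigr do rewrite mul1r.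
    rewrite -mulr_sumr -rmorph_sum/=.
    have [h|h] := boolP ((x <= - p) || (p <= x)); first by rewrite phi0// mul0r.
    rewrite partition_of_unity ?mulr1//.
    by move: h; rewrite negb_or -!ltNge => /andP[? ?]; apply/andP; split; lra.
  - lra.
  - by move=> i; apply: ccontinuous_lipschitz (lipg i).
apply: (le_trans (cabs_sum _ _ _)).
have step (i : 'I_(2 * K).+1) : cabs (1 * local_integral nu (g i)) <= (L + G) * del.
  by rewrite mul1r.
apply: (le_trans (ler_sum _ (fun i _ => step i))).
rewrite sumr_const card_ord -[leLHS]mulr_natl ler_wpM2r ?mulr_ge0 ?(ltW LG)//.
by rewrite -natr1 natrM; lra.
Qed.

End lipschitz_tests.

(** * A small primitive of the difference of the coefficients *)

Section discrete_defect.
Context {R : realType}.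

Lemma abel_summation (T : comPzRingType) (th r : nat -> T) n :
  \sum_(k < n.+1) th k * r k = (\sum_(i < n.+1) th i) * r n +
    \sum_(k < n) (\sum_(i < k.+1) th i) * (r k - r k.+1).
Proof.
elim: n => [|n IH]; first by rewrite !big_ord1 big_ord0 addr0.
rewrite big_ord_recr/= IH [X in _ = X * _ + _]big_ord_recr/= [X in _ = _ + X]big_ord_recr/=.
ring.
Qed.

Lemma unit_phase (w : R[i]) : exists2 s : R[i], cabs s <= 1 & s * w = (cabs w)%:C.
Proof.
have [->|w0] := eqVneq w 0.
  by exists 0; rewrite ?mul0r cabs0// ler01.
exists ((cabs w)%:C / w); last by rewrite divfK.
rewrite cabsM cabs_real ger0_norm ?cabs_ge0//.
have -> : cabs w^-1 = (cabs w)^-1 by exact: ComplexField.Normc.normcV.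
by rewrite divff//; apply/eqP => /cabs_eq0/eqP; exact/negP.
Qed.

Variables (mu : local_measure R) (z : R[i]) (p : R) (N : nat).
Hypotheses (p0 : 0 < p) (N0 : (0 < N)%N).

Definition mesh : R := p / N%:R.
Definition grid_node (k : nat) : R := - p + k%:R * mesh.
Definition grid_hat (k : nat) (x : R) : R :=
  hat (grid_node k - mesh) (grid_node k) (grid_node k + mesh) x.
(** The coefficients [m_k] of the difference equation. *)
Definition grid_coef (k : nat) : R[i] := shifted_integral mu z (fun x => (grid_hat k x)%:C).
(** Increases from 0 to [mesh] across the [k]-th cell. *)
Definition ramp (k : nat) (x : R) : R := pos_part (grid_node k) x - pos_part (grid_node k.+1) x.

Lemma mesh_gt0 : 0 < mesh.
Proof. by rewrite divr_gt0// ltr0n. Qed.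

Lemma grid_nodeS k : grid_node k.+1 = grid_node k + mesh.
Proof. by rewrite /grid_node -natr1; ring. Qed.

Lemma mesh_N : N%:R * mesh = p.
Proof. by rewrite mulrC divfK// pnatr_eq0 -lt0n. Qed.

Lemma grid_node_shift k : grid_node (k + N) = grid_node k + p.
Proof. by rewrite /grid_node natrD mulrDl mesh_N; ring. Qed.

Lemma grid_node_le k l : (k <= l)%N -> grid_node k <= grid_node l.
Proof. by move=> kl; rewrite lerD2l ler_wpM2r ?ler_nat// ltW ?mesh_gt0. Qed.

Lemma grid_hat_continuous k : ccontinuous (fun x => (grid_hat k x)%:C).
Proof. exact/ccontinuous_real/hat_continuous. Qed.

Lemma grid_hat_vanishes k : vanishes_outside (grid_node k - mesh) (grid_node k + mesh) (grid_hat k).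
Proof. by have h := mesh_gt0; apply: hat_vanishes; lra. Qed.

Lemma grid_hat01 k x : 0 <= grid_hat k x <= 1.
Proof. by have h := mesh_gt0; apply: hat_ge0_le1; lra. Qed.

Lemma grid_hatE k x : grid_hat k.+1 x = (ramp k x - ramp k.+1 x) / mesh.
Proof.
rewrite /grid_hat /hat /ramp !grid_nodeS !addrK.
rewrite (_ : grid_node k + mesh - grid_node k = mesh); last by ring.
rewrite (_ : grid_node k + mesh + mesh - (grid_node k + mesh) = mesh); last by ring.
by rewrite [RHS]mulrBl.
Qed.

Lemma ramp_sum M x : \sum_(k < M) ramp k x = pos_part (grid_node 0) x - pos_part (grid_node M) x.
Proof.
elim: M => [|M IH]; first by rewrite big_ord0 subrr.
by rewrite big_ord_recr/= IH /ramp; ring.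
Qed.

Lemma ramp_mono k x y : x <= y -> 0 <= ramp k y - ramp k x.
Proof.
move=> xy; have := @ramp_increment R (grid_node k) (grid_node k.+1) x y.
by rewrite grid_node_le// => /(_ isT xy)/andP[].
Qed.

Lemma ramp_ge0 k x : 0 <= ramp k x.
Proof.
have [h|h] := leP x (grid_node k).
  by rewrite /ramp !pos_part0 ?subrr// (le_trans h)// grid_node_le.
have := ramp_mono k (ltW h); rewrite [X in _ - X](_ : _ = 0) ?subr0//.
by rewrite /ramp !pos_part0 ?subrr// grid_node_le.
Qed.

Lemma grid_coef_defect k :
  grid_coef k - grid_coef (k + N) =
  local_integral (sub_measure mu (translate mu p)) (fun x => (grid_hat k x)%:C).
Proof.
have h := mesh_gt0.
rewrite (@shifted_integral_translate _ mu z _ p (grid_node k - mesh) (grid_node k + mesh)).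
- rewrite /grid_coef (_ : grid_hat (k + N) = fun x => grid_hat k (x - p)) //.
  apply/funext => x; rewrite /grid_hat grid_node_shift /hat /pos_part.
  have E c : x - p - c = x - (c + p) by ring.
  rewrite !E (addrAC (grid_node k)) (addrAC _ mesh p).
  by congr (_ / _ - _ / _); ring.
- by lra.
- exact: grid_hat_continuous.
- by move=> x /grid_hat_vanishes ->.
Qed.

(** By duality: the function whose slope on the [k]-th cell is the conjugate
    phase of [q k], minus the mean of these phases, vanishes at both ends of
    [[- p, p]] and is Lipschitz.  Summation by parts turns its integral into
    [h] times the sum of the [|q k|], provided that [q] has mean 0, which fixes
    the additive constant of the primitive. *)
Lemma small_primitive (del : R) :
  (seminorm_on (sub_measure mu (translate mu p)) `[(- p)%R, p] <= del%:E)%E ->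
  exists q : nat -> R[i],
    (forall k, (0 < k)%N -> grid_coef k - grid_coef (k + N) = q k - q k.-1) /\
    mesh * \sum_(k < 2 * N) cabs (q k) <= (2 * p + 3) * ((2 + 4 * p) * del).
Proof.
have pp0 : 0 < p := p0.
move=> hdel; set nu := sub_measure _ _ in hdel.
have [n nE] : exists n, (2 * N = n.+1)%N.
  by exists (2 * N).-1; rewrite prednK// muln_gt0.
pose D k := grid_coef k - grid_coef (k + N).
pose P k := \sum_(i < k) D i.+1.
have n0 : n.+1%:R != 0 :> R[i] by rewrite pnatr_eq0.
(* the constant for which [q] has mean 0 *)
pose c := (\sum_(k < n.+1) P k) / n.+1%:R.
pose q k := P k - c.
have qsum : \sum_(k < n.+1) q k = 0.
  by rewrite sumrB sumr_const card_ord -[X in _ - X]mulr_natr divfK// subrr.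
have /choice[sg hsg] : forall k, exists s : R[i], cabs s <= 1 /\ s * q k = (cabs (q k))%:C.
  by move=> k; have [s h1 h2] := unit_phase (q k); exists s.
pose av := (\sum_(k < n.+1) sg k) / n.+1%:R.
have n1R : n.+1%:R != 0 :> R by rewrite pnatr_eq0.
have av1 : cabs av <= 1.
  have -> : av = (n.+1%:R^-1)%:C * \sum_(k < n.+1) sg k.
    by rewrite /av mulrC; congr (_ * _); rewrite fmorphV rmorph_nat.
  rewrite cabsM cabs_real ger0_norm// mulrC ler_pdivrMr// mul1r.
  apply: (le_trans (cabs_sum _ _ _)).
  apply: (@le_trans _ _ (\sum_(k < n.+1) (1 : R))).
    by apply: ler_sum => k _; case: (hsg k).
  by rewrite sumr_const card_ord.
(* the slopes of [phi]; they add up to 0, so that [phi] vanishes at [p] *)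
pose th k := sg k - av.
have th2 k : cabs (th k) <= 2.
  by rewrite (le_trans (cabsB _ _))//; have [h _] := hsg k; lra.
have thsum : \sum_(k < n.+1) th k = 0.
  by rewrite sumrB sumr_const card_ord -[X in _ - X]mulr_natr divfK// subrr.
pose S k := \sum_(i < k) th i.
pose phi x := \sum_(k < n.+1) th k * (ramp k x)%:C.
have hm := mesh_gt0.
have end2 : grid_node n.+1 = p.
  by rewrite -nE /grid_node natrM -mulrA mesh_N; ring.
have start : grid_node 0 = - p by rewrite /grid_node mul0r addr0.
have lip x y : cabs (phi x - phi y) <= 2 * `|x - y|.
  wlog xy : x y / x <= y.
    move=> H; have [/H//|/ltW/H] := leP x y.
    by rewrite cabs_distC distrC.
  rewrite cabs_distC distrC ger0_norm ?subr_ge0// /phi -sumrB.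
  apply: (le_trans (cabs_sum _ _ _)).
  apply: (@le_trans _ _ (\sum_(k < n.+1) 2 * (ramp k y - ramp k x))).
    apply: ler_sum => k _; rewrite -mulrBr -rmorphB/= cabsM cabs_real.
    rewrite ger0_norm ?ramp_mono//; apply: ler_wpM2r => //; exact: ramp_mono.
  rewrite -mulr_sumr ler_wpM2l// sumrB !ramp_sum start end2.
  have := @ramp_increment R (- p) p x y; rewrite ge0_cp ?(ltW p0)// => /(_ isT xy)/andP[_].
  by [].
have bnd x : cabs (phi x) <= 4 * p.
  apply: (le_trans (cabs_sum _ _ _)).
  apply: (@le_trans _ _ (\sum_(k < n.+1) 2 * ramp k x)).
    apply: ler_sum => k _; rewrite cabsM cabs_real.
    by rewrite ger0_norm ?ramp_ge0// ler_wpM2r ?ramp_ge0.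
  rewrite -mulr_sumr ramp_sum start end2 /pos_part.
  by case: (leP (x - - p) 0) (leP (x - p) 0) => ? [] ?; lra.
have phi0 : vanishes_outside (- p) p phi.
  move=> x /orP[xp|px]; rewrite /phi.
    rewrite big1// => k _; rewrite /ramp !pos_part0 ?subrr ?mulr0//;
    by rewrite (le_trans xp)// -start grid_node_le.
  transitivity (\sum_(k < n.+1) th k * mesh%:C).
    apply: eq_bigr => k _; congr (_ * _%:C).
    have kle : grid_node k.+1 <= x by rewrite (le_trans _ px)// -end2 grid_node_le.
    have kle' : grid_node k <= x by rewrite (le_trans _ kle)// grid_node_le.
    by rewrite /ramp !pos_partE// grid_nodeS; ring.
  by rewrite -mulr_suml thsum mul0r.
have hatE x : phi x = \sum_(k < n) (S k.+1 * mesh%:C) * (grid_hat k.+1 x)%:C.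
  rewrite /phi (abel_summation th (fun k => (ramp k x)%:C)) thsum mul0r add0r.
  apply: eq_bigr => k _; rewrite -mulrA -/(S k.+1); congr (_ * _).
  by rewrite -rmorphB -rmorphM grid_hatE mulrCA divff ?mulr1// gt_eqF.
have lint : forall g, local_integral nu g = shifted_integral nu 0 g by move=> g; rewrite /shifted_integral mul0r subr0.
have intphi : local_integral nu phi = - (mesh * \sum_(k < n.+1) cabs (q k))%:C.
  have -> : phi = fun x => \sum_(k < n) (S k.+1 * mesh%:C) * (grid_hat k.+1 x)%:C.
    by apply/funext => x; exact: hatE.
  rewrite lint (@shifted_integral_sum _ nu 0 n (fun k x => (grid_hat k.+1 x)%:C)
      (fun k => S k.+1 * mesh%:C) (- p) p); last 3 first.
  - by lra.
  - by move=> k; exact: grid_hat_continuous.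
  - move=> k x h; rewrite grid_hat_vanishes//.
    have h1 : - p <= grid_node k by rewrite -start grid_node_le.
    have h2 : grid_node k.+2 <= p by rewrite -end2 grid_node_le// ltnS.
    rewrite grid_nodeS addrK -grid_nodeS -grid_nodeS; apply/orP.
    by case/orP: h => h; [left|right]; lra.
  transitivity (\sum_(k < n) - (mesh%:C * (S k.+1 * (P k - P k.+1)))).
    apply: eq_bigr => k _; rewrite -lint -grid_coef_defect -/(D k.+1).
    by rewrite [P k.+1]big_ord_recr/= -/(P k); ring.
  rewrite sumrN -mulr_sumr; congr (- _).
  suff -> : \sum_(k < n) S k.+1 * (P k - P k.+1) = (\sum_(k < n.+1) cabs (q k))%:C.
    by rewrite -rmorphM.
  have := abel_summation th P n; rewrite thsum mul0r add0r => <-.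
  transitivity (\sum_(k < n.+1) th k * q k).
    rewrite /q; under [RHS]eq_bigr do rewrite mulrBr.
    by rewrite sumrB -mulr_suml thsum mul0r subr0.
  transitivity (\sum_(k < n.+1) sg k * q k).
    rewrite /th; under eq_bigr do rewrite mulrBl.
    by rewrite sumrB -mulr_sumr qsum mulr0 subr0.
  rewrite rmorph_sum; apply: eq_bigr => k _; by have [_ ->] := hsg k.
exists q; split.
  move=> [//|k] _ /=; rewrite /q [P k.+1]big_ord_recr/= -/(P k) -/(D k.+1).
  by ring.
have p4 : 0 <= 4 * p by lra.
have := @local_integral_lipschitz R nu phi p 2 (4 * p) del hdel _ p4 p0 lip bnd phi0.
rewrite intphi cabsN cabs_real ger0_norm ?nE; first by apply.
by rewrite mulr_ge0 ?(ltW hm)// sumr_ge0// => k _; exact: cabs_ge0.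
Qed.

End discrete_defect.

(** * The difference equation for the samples of a solution *)

Section discretised_equation.
Context {R : realType}.
Variables (mu : local_measure R) (z : R[i]) (u : R -> R[i]).
Hypothesis cu : ccontinuous u.
Hypothesis hat_eq : hat_equation mu z u.
Variables (r s Vr F : R).
Hypotheses (r0 : 0 < r) (s0 : 0 < s).
Hypothesis hVr : variation_bound mu r Vr.
Hypothesis hs : Vr + cabs z * r <= s ^+ 2 * r.
Hypothesis hF : forall x, cabs (u x) <= F.
Hypothesis lipF : forall x y, cabs (u y - u x) <= F * `|y - x|.
Variables (p : R) (N : nat).
Hypotheses (p0 : 0 < p) (N0 : (0 < N)%N).

Local Notation h := (mesh p N).
Local Notation t := (grid_node p N).
Local Notation Lam := (grid_hat p N).
Local Notation m := (grid_coef mu z p N).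

Definition sample (k : nat) : R[i] := u (t k).
Definition sampling_error (k : nat) : R[i] :=
  shifted_integral mu z (fun x => (u x - sample k) * (Lam k x)%:C).

Lemma F_ge0 : 0 <= F.
Proof. by apply: le_trans (hF 0); exact: cabs_ge0. Qed.

(** The hat identity at three consecutive nodes, with the variable value of [u]
    under the integral replaced by its value at the middle node. *)
Lemma sample_equation k : (0 < k)%N ->
  sample k.+1 - sample k = sample k - sample k.-1 +
    h%:C * (m k * sample k + sampling_error k).
Proof.
case: k => // k _ /=; have h0 := mesh_gt0 p0 N0.
have hC : h%:C * h^-1%:C = 1 :> R[i] by rewrite realC_divff// gt_eqF.
have ab : t k.+1 - h < t k.+1 by lra.
have bc : t k.+1 < t k.+1 + h by lra.
have := hat_eq ab bc.
have -> : t k.+1 + h - t k.+1 = h by ring.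
have -> : t k.+1 - (t k.+1 - h) = h by ring.
have -> : t k.+1 - h = t k by rewrite grid_nodeS addrK.
rewrite -grid_nodeS -/(sample k) -/(sample k.+1) -/(sample k.+2).
have -> : shifted_integral mu z (fun x => u x * (hat (t k) (t k.+1) (t k.+2) x)%:C) =
   m k.+1 * sample k.+1 + sampling_error k.+1.
  have vb : vanishes_outside (t k.+1 - h) (t k.+1 + h) (fun x => (Lam k.+1 x)%:C).
    by move=> x /(grid_hat_vanishes p0 N0) ->.
  have cb := grid_hat_continuous p N k.+1.
  rewrite /sampling_error /grid_coef mulrC -(@shifted_integralZ _ mu z _ (sample k.+1) _ _ _ cb vb); last by lra.
  rewrite -(@shifted_integralD _ mu z _ _ (t k.+1 - h) (t k.+1 + h)); first last.
  - by move=> x H; rewrite vb// mulr0.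
  - by move=> x H; rewrite vb// mulr0.
  - apply: ccontinuousM => //; apply: ccontinuousD => //; exact: ccontinuous_cst.
  - apply: ccontinuousM => //; exact: ccontinuous_cst.
  - by lra.
  congr shifted_integral; apply/funext => x; rewrite /grid_hat !grid_nodeS addrK -mulrDl.
  by congr (_ * _); rewrite addrC subrK.
move=> ->; rewrite -mulrBr mulrA hC mul1r; ring.
Qed.

Lemma block_count (l : R) : 0 <= l -> exists K : nat,
  [/\ (0 < K)%N, l <= K%:R * r & K%:R * r <= l + r].
Proof.
move=> l0; have lr : 0 <= l / r by rewrite divr_ge0// ltW.
have := truncn_itv lr; set n := Num.truncn _ => /andP[h1 h2].
exists n.+1; split=> //.
  by rewrite -ler_pdivrMr// ltW.
by rewrite -natr1 mulrDl mul1r lerD2r -ler_pdivlMr.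
Qed.

Lemma grid_hat_sum k n x : \sum_(i < n) Lam (k + i.+1) x <= 1.
Proof.
have h0 := mesh_gt0 p0 N0.
have tel : \sum_(i < n) Lam (k + i.+1) x = (ramp p N k x - ramp p N (k + n) x) / h.
  elim: n => [|n IH]; first by rewrite big_ord0 addn0 subrr mul0r.
  by rewrite big_ord_recr/= IH addnS grid_hatE; ring.
rewrite tel ler_pdivrMr// mul1r.
have h1 := ramp_ge0 p0 N0 (k + n) x.
apply: (@le_trans _ _ (ramp p N k x)); first by lra.
rewrite /ramp grid_nodeS /pos_part; move: (grid_node p N k) => c.
by case: (leP (x - c) 0) (leP (x - (c + h)) 0) => ? [] ?; lra.
Qed.

(** The grid hats add up to at most 1, so sums of integrals against them are
    controlled by the variation alone, whatever the mesh is. *)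
Lemma weighted_grid_hat_sum k n (w : nat -> R -> R[i]) (G : R) : 0 <= G ->
  (forall i, ccontinuous (w i)) ->
  (forall i x, `|x - t i| <= h -> cabs (w i x) <= G) ->
  \sum_(i < n) cabs (shifted_integral mu z (fun x => w (k + i.+1)%N x * (Lam (k + i.+1) x)%:C)) <=
  G * ((n.+1%:R * h + r) * s ^+ 2).
Proof.
move=> G0 cw hw; have h0 := mesh_gt0 p0 N0.
have l0 : 0 <= n.+1%:R * h by rewrite mulr_ge0// ltW.
have [K [K0 K1 K2]] := block_count l0.
have ctb i : ccontinuous (fun x => w i x * (Lam i x)%:C).
  by apply: ccontinuousM => //; exact: grid_hat_continuous.
apply: (@le_trans _ _ (G * (K%:R * (Vr + cabs z * r)))).
  apply: (@shifted_integral_sum_bound _ mu z Vr r (t k) K n G (fun i x => w (k + i.+1)%N x * (Lam (k + i.+1) x)%:C)) => //.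
  - move=> i x H; rewrite grid_hat_vanishes ?mulr0//.
    have h1 : t k + h <= t (k + i.+1) by rewrite -grid_nodeS grid_node_le// addnS ltnS leq_addr.
    have h2 : t (k + i.+1) + h <= t k + n.+1%:R * h.
      rewrite -grid_nodeS; have -> : t k + n.+1%:R * h = t (k + n.+1).
        by rewrite /grid_node natrD; ring.
      by rewrite grid_node_le// -addnS leq_add2l ltnS.
    by apply/orP; case/orP: H => H; [left|right]; lra.
  - move=> x; apply: (@le_trans _ _ (\sum_(i < n) G * Lam (k + i.+1) x)).
      apply: ler_sum => i _; rewrite cabsM cabs_real.
      have /andP[b0 b1] := grid_hat01 p0 N0 (k + i.+1) x.
      rewrite ger0_norm//; have [H|H] := leP `|x - t (k + i.+1)| h.
        by rewrite ler_wpM2r// hw.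
      rewrite grid_hat_vanishes ?mulr0//; apply/orP.
      by move: H; rewrite ltr_normr => /orP[] H; [right|left]; lra.
    by rewrite -mulr_sumr -[leRHS]mulr1 ler_wpM2l// grid_hat_sum.
rewrite ler_wpM2l//.
apply: (@le_trans _ _ (K%:R * (s ^+ 2 * r))); first by rewrite ler_wpM2l.
by rewrite mulrCA mulrC ler_wpM2r ?sqr_ge0.
Qed.

Lemma grid_coef_sum k n :
  \sum_(i < n) cabs (m (k + i.+1)) <= (n.+1%:R * h + r) * s ^+ 2.
Proof.
rewrite -[leRHS]mul1r.
have mE i : m i = shifted_integral mu z (fun x => 1 * (Lam i x)%:C).
  by apply: (congr1 (shifted_integral mu z)); apply/funext => x; rewrite mul1r.
under eq_bigr do rewrite mE.
apply: (@weighted_grid_hat_sum k n (fun _ _ => 1) 1 ler01) => [i|i x _]; last by rewrite cabs1.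
exact: ccontinuous_cst.
Qed.

Lemma sampling_error_sum k n :
  \sum_(i < n) cabs (sampling_error (k + i.+1)) <= F * h * ((n.+1%:R * h + r) * s ^+ 2).
Proof.
have h0 := mesh_gt0 p0 N0.
apply: (@weighted_grid_hat_sum k n (fun i x => u x - sample i) (F * h)).
- by rewrite mulr_ge0 ?F_ge0// ltW.
- by move=> i; apply: ccontinuousD => //; exact: ccontinuous_cst.
- move=> i x hx; rewrite /sample; apply: (le_trans (lipF _ _)).
  by rewrite ler_wpM2l ?F_ge0.
Qed.

Lemma sample_bound k : cabs (sample k) <= F.
Proof. exact: hF. Qed.

Lemma sample_lipschitz k : cabs (sample k.+1 - sample k) <= F * h.
Proof.
have h0 := mesh_gt0 p0 N0.
by apply: (le_trans (lipF _ _)); rewrite grid_nodeS addrAC subrr add0r ger0_norm// ltW.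
Qed.

(** It accounts for the change of norm and for the partial blocks at the ends of
    a walk; the essential point is that neither [p] nor the mesh enters. *)
Definition growth_constant : R := (1 + s + s^-1) * expR (s * (1 + r)).

Lemma growth_constant_ge0 : 0 <= growth_constant.
Proof. by rewrite mulr_ge0 ?expR_ge0// !addr_ge0// ?invr_ge0 ltW. Qed.

Lemma transfer_bound k n i j : h <= 1 ->
  cabs (transfer_mx h m k n i j) <= growth_constant * expR (s * (n%:R * h)).
Proof.
move=> h1; have h0 := mesh_gt0 p0 N0.
rewrite /growth_constant -mulrA -expRD.
apply: transfer_mx_bound => //.
rewrite expr2 -expRD ler_expR big_split/= sumr_const card_ord -mulr_suml.
have hc : (\sum_(i0 < n) cabs (m (k + i0.+1))) / s <= (n.+1%:R * h + r) * s.
  by rewrite ler_pdivrMr// -mulrA -expr2 grid_coef_sum.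
have hr : s * (h + r) <= 2 * (s * (1 + r)).
  by have rr0 := r0; rewrite mulrCA ler_wpM2l ?(ltW s0)//; lra.
move: hc; rewrite -natr1 -[s * h *+ n]mulr_natr.
move: hr; move: (_ / s) (n%:R : R) => S n' hr hc; lra.
Qed.

Lemma grid_node_shift_mul k j : t (k + j * N) = t k + j%:R * p.
Proof.
elim: j => [|j IH]; first by rewrite mul0n addn0 mul0r addr0.
by rewrite mulSnr addnA grid_node_shift// IH -natr1; ring.
Qed.

(** The samples shifted by [j] periods solve the equation whose coefficients are
    those of the unshifted grid, perturbed by the differences of [q]. *)
Lemma transfer_error (al be q : nat -> R[i]) (j k n : nat) (G : R) :
  backward_row h m al be k n ->
  (forall i, (0 < i)%N -> m (i + j * N) = m i + (q i.-1 - q i)) ->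
  (forall i, (k <= i <= k + n)%N -> cabs (al i) <= G /\ cabs (be i) <= G) ->
  cabs (pairing h al be (fun i => sample (i + j * N)) (k + n) -
        pairing h al be (fun i => sample (i + j * N)) k) <=
  G * F * (cabs (q (k + n)%N) + cabs (q k) + 2 * h * \sum_(i < n) cabs (q (k + i)%N))
  + G * (F * h * ((n.+1%:R * h + r) * s ^+ 2)).
Proof.
move=> row mq hG; have h0 := mesh_gt0 p0 N0.
have G0 : 0 <= G.
  by have [g _] := hG k ltac:(by rewrite leqnn leq_addr); apply: le_trans g; exact: cabs_ge0.
apply: le_trans (@perturbed_pairing R h m h0 al be (fun i => sample (i + j * N)) q
  (fun i => sampling_error (i + j * N)) k n G F row _ hG _ _) _.
- move=> i /andP[ki _]; have i0 : (0 < i)%N by exact: leq_ltn_trans ki.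
  have -> : (i.+1 + j * N = (i + j * N).+1)%N by rewrite addSn.
  have -> : (i.-1 + j * N = (i + j * N).-1)%N by case: i i0 {ki}.
  rewrite sample_equation ?addn_gt0 ?i0// mq//; ring.
- by move=> i; exact: sample_bound.
- by move=> i; rewrite addSn; exact: sample_lipschitz.
rewrite lerD2l ler_wpM2l//.
have := sampling_error_sum (k + j * N) n; apply: le_trans.
by rewrite le_eqVlt; apply/orP; left; apply/eqP; apply: eq_bigr => i _; rewrite addnAC.
Qed.

End discretised_equation.

(** * The Cayley-Hamilton inequality, and averaging *)

Section gordon.
Context {R : realType}.

Definition row_apply (M : 'M[R[i]]_2) (l : 'I_2) (Y : 'I_2 -> R[i]) : R[i] :=
  M l 0 * Y 0 + M l 1 * Y 1.

Lemma row_apply_bound (M : 'M[R[i]]_2) (Y : 'I_2 -> R[i]) (B e : R) l :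
  (forall i j, cabs (M i j) <= B) -> (forall i, cabs (Y i) <= e) ->
  cabs (row_apply M l Y) <= 2 * B * e.
Proof.
move=> hM hY; apply: (le_trans (cabsD _ _)); rewrite !cabsM.
have -> : 2 * B * e = B * e + B * e by ring.
by apply: lerD; apply: ler_pM => //; exact: cabs_ge0.
Qed.

Lemma row_apply1 l (Y : 'I_2 -> R[i]) : row_apply 1%:M l Y = Y l.
Proof.
rewrite /row_apply !mxE; move: l; apply: ord2P => /=.
  by rewrite mul1r mul0r addr0.
by rewrite mul1r mul0r add0r.
Qed.

Lemma adjugate2_1 : adjugate2 (1%:M : 'M[R[i]]_2) = 1%:M.
Proof.
by apply/matrixP; apply: ord2P; apply: ord2P; rewrite !mxE /= ?oppr0.
Qed.

(** With [tau] the trace, [adj M Y + M Y = tau Y].  If [|tau| >= 1] this bounds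
    [Y1] by its two neighbours; if [|tau| < 1] it is applied at [Y2] instead and
    bounds [Y1] by [Y2] and [Y3]. *)
Lemma cayley_hamilton_three_steps (M : 'M[R[i]]_2) (Y0 Y1 Y2 Y3 : 'I_2 -> R[i]) (e : R) :
  (forall l, cabs (row_apply (adjugate2 M) l Y1 - Y0 l) <= e) ->
  (forall l, cabs (Y2 l - row_apply M l Y1) <= e) ->
  (forall l, cabs (row_apply (adjugate2 M) l Y2 - Y1 l) <= e) ->
  (forall l, cabs (Y3 l - row_apply M l Y2) <= e) ->
  forall l, cabs (Y1 l) <= cabs (Y0 l) + cabs (Y2 l) + cabs (Y3 l) + 2 * e.
Proof.
move=> h0 h2 h1 h3 l.
pose tau := M 0 0 + M 1 1.
have tauE Y : row_apply (adjugate2 M) l Y + row_apply M l Y = tau * Y l.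
  by move: l {h0 h1 h2 h3}; apply: ord2P; rewrite /row_apply !adjugate2E /tau; ring.
have e0 : 0 <= e by apply: le_trans (h0 l); exact: cabs_ge0.
have c0 := cabs_ge0 (Y0 l); have c2 := cabs_ge0 (Y2 l); have c3 := cabs_ge0 (Y3 l).
have [t1|t1] := leP 1 (cabs tau).
  have : cabs (tau * Y1 l) <= cabs (Y0 l) + cabs (Y2 l) + 2 * e.
    have -> : tau * Y1 l = (row_apply (adjugate2 M) l Y1 - Y0 l) - (Y2 l - row_apply M l Y1)
       + (Y0 l + Y2 l) by rewrite -tauE; ring.
    apply: (le_trans (cabsD _ _)).
    have := cabsB (row_apply (adjugate2 M) l Y1 - Y0 l) (Y2 l - row_apply M l Y1).
    have := cabsD (Y0 l) (Y2 l); have := h0 l; have := h2 l; lra.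
  rewrite cabsM => h; have : cabs (Y1 l) <= cabs tau * cabs (Y1 l).
    by rewrite ler_peMl ?cabs_ge0.
  by move=> *; lra.
have -> : Y1 l = tau * Y2 l - (row_apply (adjugate2 M) l Y2 - Y1 l) + (Y3 l - row_apply M l Y2)
   - Y3 l by rewrite -tauE; ring.
apply: (le_trans (cabsB _ _)).
have g1 := cabsD (tau * Y2 l - (row_apply (adjugate2 M) l Y2 - Y1 l)) (Y3 l - row_apply M l Y2).
have g2 := cabsB (tau * Y2 l) (row_apply (adjugate2 M) l Y2 - Y1 l).
have g3 : cabs (tau * Y2 l) <= cabs (Y2 l).
  by rewrite cabsM ler_piMl ?cabs_ge0// ltW.
have := h1 l; have := h3 l; lra.
Qed.

Lemma mean_exists (g : nat -> R) (W : nat) (B : R) : (0 < W)%N ->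
  \sum_(i < W) g i <= W%:R * B -> exists2 A, (A < W)%N & g A <= B.
Proof.
move=> W0 hg; apply: contrapT => H.
have {}H i : (i < W)%N -> B < g i.
  by move=> iW; rewrite ltNge; apply/negP => gB; apply: H; exists i.
have : \sum_(i < W) B < \sum_(i < W) g i.
  case: W W0 {hg} H => // W _ H; rewrite !big_ord_recl/=; apply: ltr_leD.
    exact: (H 0%N isT).
  by apply: ler_sum => i _; apply: ltW; exact: (H _ (ltn_ord (lift ord0 i))).
by rewrite sumr_const card_ord -mulr_natl ltNge hg.
Qed.

Lemma sum_window (g : nat -> R) c W n : (forall i, 0 <= g i) -> (c + W <= n)%N ->
  \sum_(i < W) g (c + i)%N <= \sum_(i < n) g i.
Proof.
move=> g0 cWn; rewrite -(big_mkord xpredT (fun i => g (c + i)%N)) -(big_mkord xpredT g).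
have -> : \sum_(0 <= i < W) g (c + i)%N = \sum_(c <= i < c + W) g i.
  have := big_addn 0 (c + W) c xpredT g; rewrite add0n addKn => ->.
  by apply: eq_bigr => i _; rewrite addnC.
rewrite (big_cat_nat (n := c) (p := n))//= ?(leq_trans _ cWn) ?leq_addr//.
rewrite (big_cat_nat (m := c) (n := c + W) (p := n))//= ?leq_addr//.
by rewrite addrCA lerDl addr_ge0 ?sumr_ge0.
Qed.

Lemma sum_window_rev (g : nat -> R) c W n : (forall i, 0 <= g i) -> (c <= n)%N ->
  (W <= c)%N -> \sum_(i < W) g (c.-1 - i)%N <= \sum_(i < n) g i.
Proof.
move=> g0 cn Wc; apply: le_trans (_ : \sum_(i < W) g (c - W + i)%N <= _); last first.
  by apply: sum_window => //; rewrite subnK.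
rewrite (reindex_inj rev_ord_inj)/=.
rewrite le_eqVlt; apply/orP; left; apply/eqP; apply: eq_bigr => i _; congr g.
have iW := ltn_ord i; rewrite subnBA// addnS -addSn prednK ?addnBAC//.
exact: leq_trans (leq_ltn_trans (leq0n i) iW) Wc.
Qed.

End gordon.

(** * The estimate over one period *)

Lemma index_arithmetic A N n : (n + (2 * A).+1 = N)%N ->
  [/\ (A + n = N.-1 - A)%N, (A + N <= 2 * N)%N, (A + N + n <= 2 * N)%N,
      (N.-1 - A + N = (2 * N).-1 - A)%N & (A + n + A.+1 = N)%N].
Proof.
rewrite mul2n -addnn addnS -addSn addnA => <-.
have E : ((n.+1 + A + A).-1 - A = n + A)%N by rewrite addSn addSn/= addnK.
rewrite E mul2n -addnn; split.
- by rewrite addnC.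
- by rewrite leq_add2r leq_addl.
- rewrite addnAC leq_add2r (addnC A) !addSn leqW//; exact: leq_addr.
- by rewrite [in RHS]addSn [in RHS]addSn [in RHS]addSn/= [in RHS](addnAC (n + A)) addnK.
- by rewrite addnS !addSn (addnC A n).
Qed.

Lemma shifted_value (T : zmodType) (a b c d : T) : a - b = c - d -> b = a + (d - c).
Proof. by move=> E; rewrite -[d - c]opprB -E opprB addrC subrK. Qed.

Lemma shifted_value2 (T : zmodType) (a b b' c c' d d' : T) : a - b = c - d ->
  b - b' = c' - d' -> b' = a + ((d + d') - (c + c')).
Proof.
by move=> /shifted_value E /shifted_value ->; rewrite E opprD [in RHS]addrACA [RHS]addrA.
Qed.

Section gordon_estimate.
Context {R : realType}.
Variables (mu : local_measure R) (z : R[i]) (u : R -> R[i]).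
Hypothesis cu : ccontinuous u.
Hypothesis hat_eq : hat_equation mu z u.
Variables (r s Vr F : R).
Hypotheses (r0 : 0 < r) (s0 : 0 < s).
Hypothesis hVr : variation_bound mu r Vr.
Hypothesis hs : Vr + cabs z * r <= s ^+ 2 * r.
Hypothesis hF : forall x, cabs (u x) <= F.
Hypothesis lipF : forall x y, cabs (u y - u x) <= F * `|y - x|.
Variables (p : R) (N : nat).
Hypotheses (p0 : 0 < p) (N0 : (0 < N)%N).

Local Notation h := (mesh p N).
Local Notation t := (grid_node p N).
Local Notation m := (grid_coef mu z p N).
Local Notation sample := (sample u p N).
Local Notation T := (transfer_mx h m).
Local Notation c0 := (growth_constant r s).

Hypothesis h1 : h <= 1.

Let h0 : 0 < h := mesh_gt0 p0 N0.
Let F0 : 0 <= F := F_ge0 hF.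

Definition state (k : nat) (l : 'I_2) : R[i] :=
  if l == 0 then sample k else (sample k.+1 - sample k) / h%:C.

Lemma pairing_state (M : nat -> 'M[R[i]]_2) l j k :
  pairing h (fun i => M i l 0) (fun i => M i l 1) (fun i => sample (i + j * N)) k =
  row_apply (M k) l (state (k + j * N)).
Proof. by []. Qed.

Lemma transfer_entries (ell : R) k n : n%:R * h <= ell ->
  forall i j, cabs (T k n i j) <= c0 * expR (s * ell).
Proof.
move=> hn i j; apply: (le_trans (transfer_bound r0 s0 hVr hs p0 N0 k n i j h1)).
by rewrite ler_wpM2l ?growth_constant_ge0// ler_expR ler_wpM2l// ltW.
Qed.

(** The right-hand side of the pairing estimate, with [q] the accumulated
    difference of the coefficients and [G] a bound of the transfer matrices. *)
Definition transfer_remainder (G : R) (q : nat -> R[i]) k n : R :=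
  G * F * (cabs (q (k + n)%N) + cabs (q k) + 2 * h * \sum_(i < n) cabs (q (k + i)%N))
  + G * (F * h * ((n.+1%:R * h + r) * s ^+ 2)).

Lemma adjoint_transfer (ell : R) (q : nat -> R[i]) j k n l : n%:R * h <= ell ->
  (forall i, (0 < i)%N -> m (i + j * N) = m i + (q i.-1 - q i)) ->
  cabs (row_apply (adjugate2 (T k n)) l (state (k + n + j * N)) - state (k + j * N) l) <=
  transfer_remainder (c0 * expR (s * ell)) q k n.
Proof.
move=> hn hq.
have := @transfer_error R mu z u cu hat_eq r s Vr F r0 hVr hs hF lipF p N p0 N0
  _ _ q j k n (c0 * expR (s * ell)) (adjoint_row h m l) hq.
rewrite (pairing_state (fun i => adjugate2 (T k (i - k)))).
rewrite (pairing_state (fun i => adjugate2 (T k (i - k)))) addKn subnn adjugate2_1 row_apply1.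
apply=> i /andP[ki ik]; have hi : (i - k)%:R * h <= ell.
  by apply: le_trans hn; rewrite ler_pM2r// ler_nat leq_subLR.
by split; apply: adjugate2_bound; exact: transfer_entries.
Qed.

(** Comparison over the first [n] of [n + n2] steps: the last [n2] matrices act on
    both sides and are not compared. *)
Lemma forward_transfer (ell : R) (q : nat -> R[i]) j k n n2 l : (n + n2)%:R * h <= ell ->
  (forall i, (0 < i)%N -> m (i + j * N) = m i + (q i.-1 - q i)) ->
  cabs (row_apply (T (k + n) n2) l (state (k + n + j * N)) -
        row_apply (T k (n + n2)) l (state (k + j * N))) <=
  transfer_remainder (c0 * expR (s * ell)) q k n.
Proof.
move=> hn hq.
have row : backward_row h m (fun i => T i (k + (n + n2) - i) l 0)
    (fun i => T i (k + (n + n2) - i) l 1) k n.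
  move=> i /andP[ki ik]; apply: (forward_row h m l); rewrite ki/=.
  by rewrite (leq_trans ik)// leq_add2l leq_addr.
have := @transfer_error R mu z u cu hat_eq r s Vr F r0 hVr hs hF lipF p N p0 N0
  _ _ q j k n (c0 * expR (s * ell)) row hq.
rewrite (pairing_state (fun i => T i (k + (n + n2) - i))).
rewrite (pairing_state (fun i => T i (k + (n + n2) - i))).
rewrite addKn addnA addKn.
apply=> i /andP[ki ik]; have hi : (k + n + n2 - i)%:R * h <= ell.
  apply: le_trans hn; rewrite ler_pM2r// ler_nat leq_subLR addnA leq_add2r.
  by rewrite leq_add2r.
by split; exact: transfer_entries.
Qed.

Lemma forward_transfer_end (ell : R) (q : nat -> R[i]) j k n l : n%:R * h <= ell ->
  (forall i, (0 < i)%N -> m (i + j * N) = m i + (q i.-1 - q i)) ->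
  cabs (state (k + n + j * N) l - row_apply (T k n) l (state (k + j * N))) <=
  transfer_remainder (c0 * expR (s * ell)) q k n.
Proof.
have E Y : row_apply (T (k + n) 0) l Y = Y l := row_apply1 l Y.
by have := @forward_transfer ell q j k n 0 l; rewrite E addn0.
Qed.

Lemma transfer_remainder0 (G : R) k n (B : R) : 0 <= G -> n%:R * h <= B ->
  transfer_remainder G (fun=> 0) k n <= G * (F * h * ((B + 1 + r) * s ^+ 2)).
Proof.
move=> G0 hn; rewrite /transfer_remainder cabs0 big1// mulr0 !addr0 mulr0 add0r.
apply: ler_wpM2l => //; apply: ler_wpM2l; first exact: mulr_ge0 F0 (ltW h0).
apply: ler_wpM2r; first exact: sqr_ge0.
by rewrite -natr1 mulrDl mul1r; move: h1 hn; lra.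
Qed.

Lemma state_bound (x e : R) k : x <= t k -> t k.+1 <= x + 1 ->
  (forall y, x <= y <= x + 1 -> cabs (u y) <= e) ->
  (forall a b, x <= a <= x + 1 -> x <= b <= x + 1 -> cabs (u b - u a) <= e * `|b - a|) ->
  forall l, cabs (state k l) <= e.
Proof.
move=> xk kx hu lu; have tk : t k <= t k.+1 by rewrite grid_node_le.
apply: ord2P; rewrite /state /=; first by apply: hu; rewrite xk (le_trans tk).
have hV : cabs (h%:C : R[i]) = h by rewrite cabs_real ger0_norm// ltW.
rewrite cabsM ComplexField.Normc.normcV hV ler_pdivrMr//.
apply: (le_trans (lu _ _ _ _)); rewrite ?xk ?kx ?(le_trans tk) ?(le_trans xk)//=.
by rewrite grid_nodeS addrAC subrr add0r ger0_norm// ltW.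
Qed.

Variables (del : R).
Hypothesis hdel :
  (seminorm_on (sub_measure mu (translate mu p)) `[(- p)%R, p] <= del%:E)%E.
Hypothesis p2 : 2 <= p.
Hypothesis h2 : 2 * h <= 1.

Let dp : R := (2 * p + 3) * ((2 + 4 * p) * del).
Let Gp : R := c0 * expR (s * p).

(** The first term covers the values of [q], or of the sum of [q] and its
    translate, at the two ends and their sum over a period; the second one is
    the sampling error. *)
Definition period_error : R :=
  Gp * F * (20 * dp) + Gp * (F * h * ((p + 1 + r) * s ^+ 2)).

(** The comparisons below start and end at these four indices; the last two are
    the images of the first two under [k |-> 2 N - 1 - k].  Averaging over the
    indices [A] within distance 1 of the left end, at least [1 / (2 h)] many,
    bounds the four moduli in terms of the sum of all of them. *)
Lemma good_index (q : nat -> R[i]) : h * \sum_(k < 2 * N) cabs (q k) <= dp ->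
  exists2 A, A.+1%:R * h <= 1 &
  cabs (q A) + cabs (q (N + A)%N) + cabs (q (N.-1 - A)%N) + cabs (q ((2 * N).-1 - A)%N)
  <= 8 * dp.
Proof.
move=> hq; have hV : 0 <= h^-1 by rewrite invr_ge0 ltW.
have := truncn_itv hV; set W := Num.truncn _ => /andP[W1 W2].
have Wh : W%:R * h <= 1.
  by rewrite -ler_pdivlMr// div1r.
have W2h : 1 < W.+1%:R * h.
  by rewrite -ltr_pdivrMr// div1r.
have W0 : (0 < W)%N.
  rewrite lt0n; apply/eqP => E; move: W2h h2; rewrite E mul1r => ? ?; lra.
have WN : (W <= N)%N.
  rewrite -(ler_nat R) -(ler_pM2r h0) mesh_N//; move: p2 Wh; lra.
have Whalf : 1 <= 2 * (W%:R * h).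
  have W1R : 1 <= W%:R :> R by rewrite ler1n.
  have : 1 * h <= W%:R * h by rewrite ler_pM2r.
  by move: W2h; rewrite -natr1 mulrDl !mul1r => ? ?; lra.
have q0 i : 0 <= cabs (q i) by exact: cabs_ge0.
set S := \sum_(k < 2 * N) cabs (q k) in hq.
have S0 : 0 <= S by apply: sumr_ge0.
pose g A := cabs (q A) + cabs (q (N + A)%N) + cabs (q (N.-1 - A)%N) + cabs (q ((2 * N).-1 - A)%N).
have N2 : (N <= 2 * N)%N by rewrite leq_pmull.
have sg : \sum_(A < W) g A <= 4 * S.
  rewrite /g !big_split/=.
  have s1 := @sum_window R (fun i => cabs (q i)) 0 W (2 * N) q0 (leq_trans WN N2).
  have s2 := @sum_window R (fun i => cabs (q i)) N W (2 * N) q0 ltac:(by rewrite mul2n -addnn leq_add2l).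
  have s3 := @sum_window_rev R (fun i => cabs (q i)) N W (2 * N) q0 N2 WN.
  have s4 := @sum_window_rev R (fun i => cabs (q i)) (2 * N) W (2 * N) q0 (leqnn _) (leq_trans WN N2).
  have -> : 4 * S = S + S + S + S by ring.
  by rewrite !lerD.
have dpW : 4 * S <= W%:R * (8 * dp).
  apply: (@le_trans _ _ (W%:R * (8 * (h * S)))); last first.
    by rewrite ler_wpM2l// ler_wpM2l.
  have -> : W%:R * (8 * (h * S)) = 4 * S * (2 * (W%:R * h)) by ring.
  by rewrite ler_peMr// mulr_ge0.
have [A AW gA] := mean_exists W0 (le_trans sg dpW).
exists A => //; apply: le_trans Wh.
by rewrite ler_pM2r// ler_nat.
Qed.

Variables (e x0 : R).
Hypothesis decay : forall x, p - 1 <= `|x| ->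
  (forall y, x <= y <= x + 1 -> cabs (u y) <= e) /\
  (forall a b, x <= a <= x + 1 -> x <= b <= x + 1 -> cabs (u b - u a) <= e * `|b - a|).

(** The states of index [A], [A + N], [A + 2 N] lie within distance 1 to the right of
    [- p, 0, p].  The seminorm gives no information beyond [[- p, p]], hence the
    coefficients on the first period can be compared with those two periods
    later only up to the index [N - 1 - A], where [q] and its translate are both
    small.  The corresponding state near [2 p] is therefore taken at index
    [3 N - 1 - A] and carried on by the [2 A + 1] remaining matrices of the
    first period, which cover a distance of at most 2. *)
Lemma state_small : exists2 A, A.+1%:R * h <= 1 & forall l,
  cabs (state (A + N) l) <= 2 * e + 2 * (c0 * expR (s * 2)) * e + 2 * period_error.
Proof.
have [q [hq hsum]] := small_primitive z p0 N0 hdel.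
have [A A1 hA] := good_index hsum.
exists A => //.
have hh0 : 0 < h := h0; have hh1 := h1; have hp2 := p2; have hh2 := h2.
have hNp : N%:R * h = p by exact: mesh_N.
have dp0 : 0 <= dp.
  by apply: le_trans hsum; rewrite mulr_ge0 ?(ltW h0)// sumr_ge0// => i _; exact: cabs_ge0.
have Gp0 : 0 <= Gp by rewrite mulr_ge0 ?growth_constant_ge0// expR_ge0.
have tA : t A = - p + A%:R * h by [].
have A2 : A%:R * h + h <= 1 by move: A1; rewrite -natr1 mulrDl mul1r.
have A0 : 0 <= A%:R * h by rewrite mulr_ge0// ltW.
have AN : ((2 * A).+1 <= N)%N.
  rewrite -(ler_nat R) -(ler_pM2r h0) hNp -natr1 natrM.
  by lra.
pose M := T A N.
(* the number of steps from the index [A] to [N - 1 - A] *)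
pose n4 := (N - (2 * A).+1)%N.
have n4N : (n4 + (2 * A).+1 = N)%N by rewrite /n4 subnK.
have [n4E le1 le2 n4P n4S] := index_arithmetic n4N.
have cq i : 0 <= cabs (q i) by exact: cabs_ge0.
have hq1 i : (0 < i)%N -> m (i + 1 * N) = m i + (q i.-1 - q i).
  by move=> i0; rewrite mul1n; exact: (shifted_value (hq i i0)).
pose q2 i := q i + q (i + N)%N.
have hq2 i : (0 < i)%N -> m (i + 2 * N) = m i + (q2 i.-1 - q2 i).
  move=> i0; have := hq (i + N)%N ltac:(by rewrite addn_gt0 i0).
  have -> : ((i + N).-1 = i.-1 + N)%N by case: i i0.
  rewrite -addnA addnn -mul2n; exact: (shifted_value2 (hq i i0)).
have hq0 i : (0 < i)%N -> m (i + 0 * N) = m i + ((fun=> 0) i.-1 - (fun=> 0) i).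
  by move=> _; rewrite mul0n addn0 subrr addr0.
have rem0 n : (n <= N)%N -> n.+1%:R * h + r <= p + 1 + r.
  move=> nN; have : n%:R * h <= N%:R * h by rewrite ler_pM2r// ler_nat.
  by rewrite hNp lerD2r -natr1 mulrDl mul1r => nh; exact: lerD.
have remE (qq : nat -> R[i]) n : (n <= N)%N ->
    cabs (qq (A + n)%N) + cabs (qq A) + 2 * h * \sum_(i < n) cabs (qq (A + i)%N) <= 20 * dp ->
    transfer_remainder Gp qq A n <= period_error.
  move=> nN hqq; rewrite /transfer_remainder /period_error; apply: lerD.
    by rewrite ler_wpM2l// mulr_ge0.
  apply: ler_wpM2l => //; apply: ler_wpM2l; first exact: mulr_ge0 F0 (ltW h0).
  by apply: ler_wpM2r; [exact: sqr_ge0|exact: rem0].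
have g1 := cq A; have g2 := cq (N + A)%N; have g3 := cq (N.-1 - A)%N.
have g4 := cq ((2 * N).-1 - A)%N.
have R0 : transfer_remainder Gp (fun=> 0) A N <= period_error.
  by apply: remE => //; rewrite cabs0 big1// mulr0 !addr0 mulr_ge0.
have R1 : transfer_remainder Gp q A N <= period_error.
  apply: remE => //.
  have : h * \sum_(i < N) cabs (q (A + i)%N) <= dp.
    apply: le_trans hsum; rewrite ler_pM2l//.
    exact: (@sum_window R (fun i => cabs (q i)) A N (2 * N)).
  by rewrite addnC -mulrA; lra.
have R2 : transfer_remainder Gp q2 A n4 <= period_error.
  apply: remE; first by rewrite leq_subr.
  have s1 : h * \sum_(i < n4) cabs (q (A + i)%N) <= dp.
    apply: le_trans hsum; rewrite ler_pM2l//.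
    apply: (@sum_window R (fun i => cabs (q i)) A n4 (2 * N)) => //.
    by rewrite (leq_trans _ le1)// leq_add2l leq_subr.
  have s2 : h * \sum_(i < n4) cabs (q (A + N + i)%N) <= dp.
    apply: le_trans hsum; rewrite ler_pM2l//.
    exact: (@sum_window R (fun i => cabs (q i)) (A + N) n4 (2 * N)).
  have s3 : h * \sum_(i < n4) cabs (q2 (A + i)%N) <= 2 * dp.
    apply: (@le_trans _ _ (h * (\sum_(i < n4) cabs (q (A + i)%N) + \sum_(i < n4) cabs (q (A + N + i)%N)))).
      rewrite ler_pM2l// -big_split/=; apply: ler_sum => i _.
      by apply: le_trans (cabsD _ _) _; rewrite (addnAC A N).
    by rewrite mulrDr; lra.
  have s4 := cabsD (q A) (q (A + N)%N).
  have s5 := cabsD (q (N.-1 - A)%N) (q ((2 * N).-1 - A)%N).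
  rewrite n4E /q2 n4P -mulrA; move: s4 s5 hA; rewrite (addnC N A); lra.
pose Y3 l := row_apply (T (A + n4) (2 * A).+1) l (state (A + n4 + 2 * N)).
have Np : N%:R * h <= p by rewrite hNp.
have H0 l : cabs (row_apply (adjugate2 M) l (state (A + N)) - state A l) <= period_error.
  have := @adjoint_transfer p (fun=> 0) 0 A N l Np hq0; rewrite mul0n !addn0 => H.
  exact: le_trans H R0.
have H2 l : cabs (state (A + N + N) l - row_apply M l (state (A + N))) <= period_error.
  have := @forward_transfer_end p q 1 A N l Np hq1; rewrite mul1n => H.
  exact: le_trans H R1.
have H1 l : cabs (row_apply (adjugate2 M) l (state (A + N + N)) - state (A + N) l) <= period_error.
  have := @adjoint_transfer p q 1 A N l Np hq1; rewrite mul1n => H.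
  exact: le_trans H R1.
have H3 l : cabs (Y3 l - row_apply M l (state (A + N + N))) <= period_error.
  have := @forward_transfer p q2 2 A n4 (2 * A).+1 l.
  rewrite n4N -/(Y3 l) (_ : (A + 2 * N = A + N + N)%N); last by rewrite -addnA addnn mul2n.
  by move=> H; exact: le_trans (H Np hq2) R2.
have C l := cayley_hamilton_three_steps H0 H2 H1 H3 l.
have pabs : `|p| = p by rewrite ger0_norm// ltW.
have hpp0 := p0.
have S0 : forall l, cabs (state A l) <= e.
  have [d1 d2] := decay (x := - p) ltac:(by rewrite normrN pabs; lra).
  apply: state_bound d1 d2; rewrite ?grid_nodeS tA; lra.
have S2 : forall l, cabs (state (A + N + N) l) <= e.
  have [d1 d2] := decay (x := p) ltac:(by rewrite pabs; lra).
  by apply: state_bound d1 d2; rewrite ?grid_nodeS !grid_node_shift// tA; lra.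
have S3 : forall l, cabs (state (A + n4 + 2 * N) l) <= e.
  have [d1 d2] := decay (x := p + p - 1) ltac:(by rewrite ger0_norm; lra).
  have E : t (A + n4 + 2 * N) = p + p - A%:R * h - h.
    have Z : ((A + n4)%:R + (A.+1)%:R = N%:R :> R) by rewrite -natrD n4S.
    rewrite grid_node_shift_mul// /grid_node; have -> : (A + n4)%:R = N%:R - A.+1%:R :> R by rewrite -Z; ring.
    by rewrite mulrBl hNp -natr1; ring.
  by apply: state_bound d1 d2; rewrite ?grid_nodeS E; lra.
move=> l; apply: (le_trans (C l)).
have Y3b : cabs (Y3 l) <= 2 * (c0 * expR (s * 2)) * e.
  apply: row_apply_bound S3; apply: transfer_entries.
  by rewrite -natr1 natrM mulrDl mul1r -mulrA; lra.
by have := S0 l; have := S2 l; lra.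
Qed.

Hypothesis x0p : `|x0| + 1 <= p.

(** Transport of the bound from the state near 0 to the node left of [x0], forward
    or backward, with the equation itself (no comparison, so [q = 0]). *)
Lemma value_small : cabs (u x0) <=
  2 * (c0 * expR (s * (`|x0| + 1)))
    * (2 * e + 2 * (c0 * expR (s * 2)) * e + 2 * period_error)
  + c0 * expR (s * (`|x0| + 1)) * (F * h * ((`|x0| + 2 + r) * s ^+ 2)) + F * h.
Proof.
have [A A1 hA] := state_small.
set B := _ + 2 * period_error in hA *.
have hp0 := p0; have hh0 : 0 < h := h0; have hx0p := x0p.
have hNp : N%:R * h = p by exact: mesh_N.
have A2 : A%:R * h + h <= 1 by move: A1; rewrite -natr1 mulrDl mul1r.
have A0 : 0 <= A%:R * h by rewrite mulr_ge0// ltW.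
have tAN : t (A + N) = A%:R * h by rewrite grid_node_shift// /grid_node; ring.
have xx : - `|x0| <= x0 <= `|x0| by rewrite -ler_norml.
have [xl xr] := andP xx.
have y0 : 0 <= (x0 + p) / h by rewrite divr_ge0 ?(ltW h0)//; move: x0p; lra.
have := truncn_itv y0; set k := Num.truncn _ => /andP[k1 k2].
have {}k1 : k%:R * h <= x0 + p by rewrite -ler_pdivlMr.
have {}k2 : x0 + p < k.+1%:R * h by rewrite -ltr_pdivrMr.
have tk : t k = - p + k%:R * h by [].
have xk : cabs (u x0) <= cabs (sample k) + F * h.
  have -> : u x0 = sample k + (u x0 - sample k) by ring.
  apply: (le_trans (cabsD _ _)); rewrite lerD2l (le_trans (lipF _ _))//.
  rewrite ler_wpM2l// ger0_norm tk; first by move: k2; rewrite -natr1; lra.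
  by move: k1; lra.
apply: (le_trans xk); rewrite lerD2r.
pose G := c0 * expR (s * (`|x0| + 1)).
have G0 : 0 <= G by rewrite mulr_ge0 ?growth_constant_ge0// expR_ge0.
have hq0 i : (0 < i)%N -> m (i + 0 * N) = m i + ((fun=> 0) i.-1 - (fun=> 0) i).
  by move=> _; rewrite mul0n addn0 subrr addr0.
have kk : - p + k%:R * h <= x0 /\ x0 < - p + k%:R * h + h.
  by move: k1 k2; rewrite -natr1 => *; split; lra.
have hAN : (A + N)%:R * h = A%:R * h + p by rewrite natrD mulrDl hNp.
have sE : sample k = state k 0 by [].
have main : cabs (state k 0) <= 2 * G * B + G * (F * h * ((`|x0| + 1 + 1 + r) * s ^+ 2)).
  have [kAN|ANk] := leqP (A + N) k.
    have nE : (A + N + (k - (A + N)) = k)%N by rewrite subnKC.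
    have nh : (k - (A + N))%:R * h <= `|x0| + 1.
      by rewrite natrB// mulrBl hAN; case: kk; lra.
    have := @forward_transfer_end (`|x0| + 1) (fun=> 0) 0 (A + N) (k - (A + N)) 0 nh hq0.
    rewrite nE mul0n !addn0 => H.
    have {}H := le_trans H (transfer_remainder0 _ G0 nh).
    have Y := row_apply_bound 0 (transfer_entries (A + N) nh) hA.
    set y := row_apply _ _ _ in H Y.
    have -> : state k 0 = y + (state k 0 - y) by ring.
    by apply: (le_trans (cabsD _ _)); exact: lerD.
  have nE : (k + (A + N - k) = A + N)%N by rewrite subnKC// ltnW.
  have nh : (A + N - k)%:R * h <= `|x0| + 1.
    rewrite natrB ?(ltnW ANk)// mulrBl hAN; case: kk; move: A2 xl; lra.
  have := @adjoint_transfer (`|x0| + 1) (fun=> 0) 0 k (A + N - k) 0 nh hq0.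
  rewrite mul0n !addn0 nE => H.
  have {}H := le_trans H (transfer_remainder0 _ G0 nh).
  have Y := row_apply_bound 0 (adjugate2_bound (transfer_entries k nh)) hA.
  set y := row_apply _ _ _ in H Y.
  have -> : state k 0 = y - (y - state k 0) by ring.
  by apply: (le_trans (cabsB _ _)); exact: lerD.
rewrite sE; apply: (le_trans main).
by have -> : `|x0| + 1 + 1 + r = `|x0| + 2 + r by ring.
Qed.

End gordon_estimate.

(** * Absence of eigenvalues *)

Section absence_of_eigenvalues.
Context {R : realType}.

(** By [exp t >= t ^ 3 / 6] with [t = c p], and [(p + 1) ^ 2 <= 4 p ^ 2]. *)
Lemma exponential_beats_square (c D e : R) : 0 < c -> 0 <= D -> 0 < e ->
  exists P : R, forall p, P <= p -> D * (p + 1) ^+ 2 * expR (- (c * p)) <= e.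
Proof.
move=> c0 D0 e0; pose Q := 24 * D / (e * c ^+ 3).
have ec : 0 < e * c ^+ 3 by rewrite mulr_gt0// exprn_gt0.
exists (Num.max 1 Q) => p; rewrite ge_max => /andP[p1 pQ].
have p0 : 0 <= p by lra.
have E : (c * p) ^+ 3 / 6 <= expR (c * p).
  have := @expR_ge1Dxn R (c * p) 2 (mulr_ge0 (ltW c0) p0).
  have -> : (2.+1)`!%:R = 6 :> R by [].
  by lra.
have cp0 : 0 < (c * p) ^+ 3 / 6 by rewrite divr_gt0// exprn_gt0// mulr_gt0//; lra.
rewrite expRN ler_pdivrMr ?expR_gt0//.
apply: (@le_trans _ _ (e * ((c * p) ^+ 3 / 6))); last by rewrite ler_wpM2l// ltW.
have h1 : (p + 1) ^+ 2 <= 4 * p ^+ 2 by nra.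
apply: (@le_trans _ _ (D * (4 * p ^+ 2))); first by rewrite ler_wpM2l.
have h2 : 24 * D <= p * (e * c ^+ 3) by rewrite -ler_pdivrMr.
have -> : e * ((c * p) ^+ 3 / 6) = (p * (e * c ^+ 3)) * (p ^+ 2 / 6) by field.
have -> : D * (4 * p ^+ 2) = 24 * D * (p ^+ 2 / 6) by field.
by rewrite ler_wpM2r// divr_ge0 ?sqr_ge0.
Qed.

(** For given [e], the period [p] is taken so large that [u] is below [e] outside
    [[- p + 1, p - 1]] and that the errors of the comparison, of the order
    [p ^ 2 e^((s - w) p)], are below [e]; then the mesh is taken at most
    [e] and [e^(- w p)].  The bound for [u x0] obtained in this way is [e]
    times a constant. *)
Lemma eigenfunction_eq0 (mu : local_measure R) (z : R[i]) (u : R -> R[i])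
    (V r s w Vr : R) :
  ccontinuous u ->
  weak_solution mu z u ->
  (\int[lebesgue_measure]_x (cabs (u x) ^+ 2)%:E < +oo)%E ->
  variation_bound mu 1 V ->
  0 < r -> 0 < s -> s < w ->
  variation_bound mu r Vr ->
  Vr + cabs z * r <= s ^+ 2 * r ->
  (forall P : R, exists2 p : R, P <= p &
    (translation_defect mu p <= (expR (- (w * p)))%:E)%E) ->
  forall x0, u x0 = 0.
Proof.
move=> cu weak_u L2u hV r0 s0 sw hVr hs freq x0.
have hat_eq := hat_identity cu weak_u hV.
have [F F0 [hF lipF]] := u_bounded_lipschitz cu weak_u hV L2u.
set c0 := growth_constant r s.
have c00 : 0 <= c0 by exact: growth_constant_ge0.
pose Gx := c0 * expR (s * (`|x0| + 1)).
have Gx0 : 0 <= Gx by rewrite mulr_ge0// expR_ge0.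
(* [240 = 20 * 12], with 20 from the period error and 12 from
   [(2 p + 3) (2 + 4 p) <= 12 (p + 1) ^ 2] *)
pose D := c0 * F * (240 + (1 + r) * s ^+ 2).
have s2 : 0 <= s ^+ 2 by exact: sqr_ge0.
have D0 : 0 <= D.
  apply: mulr_ge0; first exact: mulr_ge0.
  have : 0 <= (1 + r) * s ^+ 2 by apply: mulr_ge0 => //; lra.
  by lra.
pose K := 2 * Gx * (4 + 2 * (c0 * expR (s * 2))) + Gx * (F * ((`|x0| + 2 + r) * s ^+ 2)) + F.
apply: (@cabs_small_eq0 _ _ K) => e e0.
have [X hX] := u_decay cu weak_u hV L2u e0.
have ws0 : 0 < w - s by lra.
have [P hP] := exponential_beats_square ws0 D0 e0.
have [p] := freq (Num.max (Num.max P (X + 1)) (Num.max 2 (`|x0| + 1))).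
rewrite !ge_max => /andP[/andP[pP pX] /andP[p2 px0]] hdel.
set del := expR (- (w * p)) in hdel.
have del0 : 0 < del by exact: expR_gt0.
have p0 : 0 < p by lra.
have [N N0 [h1 h2 he hdelN]] : exists2 N : nat, (0 < N)%N &
    [/\ mesh p N <= 1, 2 * mesh p N <= 1, mesh p N <= e & mesh p N <= del].
  pose d := Num.min (1 / 2) (Num.min e del).
  have d0 : 0 < d by rewrite !lt_min e0 del0 andbT; lra.
  exists (Num.bound (p / d)).+1 => //.
  have H : mesh p (Num.bound (p / d)).+1 <= d.
    rewrite /mesh ler_pdivrMr ?ltr0n// mulrC -ler_pdivrMr//.
    rewrite (le_trans (ltW (archi_boundP _)))//; first by rewrite divr_ge0// ltW.
    by rewrite ler_nat.
  by move: H; rewrite /d !le_min => /and3P[H1 H2 H3]; split => //; lra.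
have h0 := mesh_gt0 p0 N0.
have decay x : p - 1 <= `|x| ->
  (forall y, x <= y <= x + 1 -> cabs (u y) <= e) /\
  (forall a b, x <= a <= x + 1 -> x <= b <= x + 1 -> cabs (u b - u a) <= e * `|b - a|).
  by move=> px; apply: hX; lra.
have hsmall := value_small cu hat_eq r0 s0 hVr hs hF lipF p0 N0 h1 hdel p2 h2 decay px0.
have perr : period_error r s F p N del <= e.
  apply: le_trans (hP p pP).
  have Gdel : expR (s * p) * del = expR (- ((w - s) * p)).
    by rewrite /del -expRD; congr expR; ring.
  have q1 : (2 * p + 3) * (2 + 4 * p) <= 12 * (p + 1) ^+ 2 by nra.
  have q2 : p + 1 + r <= (1 + r) * (p + 1) ^+ 2 by nra.
  rewrite /period_error -/c0.
  apply: (@le_trans _ _ (c0 * expR (s * p) * F * (20 * (12 * (p + 1) ^+ 2 * del)) +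
      c0 * expR (s * p) * (F * del * ((1 + r) * (p + 1) ^+ 2 * s ^+ 2)))).
    have cE : 0 <= c0 * expR (s * p) by rewrite mulr_ge0// expR_ge0.
    apply: lerD.
      apply: ler_wpM2l; first exact: mulr_ge0.
      apply: ler_wpM2l => //; rewrite mulrA; apply: ler_wpM2r => //; exact: ltW.
    apply: ler_wpM2l => //; apply: ler_pM.
    - by rewrite mulr_ge0// ltW.
    - by rewrite mulr_ge0//; lra.
    - by rewrite ler_wpM2l.
    - by rewrite ler_wpM2r.
  by rewrite le_eqVlt; apply/orP; left; apply/eqP; rewrite -Gdel /D; ring.
apply: (le_trans hsmall).
pose L := (`|x0| + 2 + r) * s ^+ 2.
have L0 : 0 <= L by apply: mulr_ge0 => //; have := normr_ge0 x0; lra.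
have -> : K * e = 2 * Gx * (2 * e + 2 * (c0 * expR (s * 2)) * e + 2 * e)
    + Gx * (F * e * L) + F * e by rewrite /K /L; ring.
rewrite -/c0 -/Gx -/L.
apply: lerD; last by apply: ler_wpM2l.
apply: lerD; last first.
  by apply: ler_wpM2l => //; apply: ler_wpM2r => //; apply: ler_wpM2l.
apply: ler_wpM2l; first exact: mulr_ge0.
by rewrite lerD2l; apply: ler_wpM2l.
Qed.

Lemma var_measure_ge0 (mu : local_measure R) (a b : R) :
  (0 <= var_measure mu `]a, b])%E.
Proof.
apply: (@le_trans _ _ (cabs (mu `]a, b]%classic))%:E).
  by rewrite lee_fin cabs_ge0.
apply: ereal_sup_ubound; exists 1%N, (fun=> `]a, b]%classic); split.
- by move=> i; exact: measurable_itv.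
- by move=> i j _ _ _; rewrite !ord1.
- by apply/seteqP; split=> [x [] //|x xab]; exists ord0.
- by rewrite big_ord1.
Qed.

Lemma frequently_small_defect (mu : local_measure R) (w : R) : (w%:E < C_of mu)%E ->
  forall P : R, exists2 p : R, P <= p &
    (translation_defect mu p <= (expR (- (w * p)))%:E)%E.
Proof.
rewrite /C_of lteNr => hw P.
have PF : pinfty_nbhs R [set p | Num.max P 0 < p].
  by exists (Num.max P 0); split; rewrite ?num_real.
have : (ereal_inf [set (p^-1%:E * lne (translation_defect mu p))%E |
     p in [set p : R | (Num.max P 0 < p)%R]] < - w%:E)%E.
  apply: le_lt_trans hw; rewrite limf_einfE.
  by apply: ereal_sup_ubound; exists [set p | Num.max P 0 < p].
move=> /ereal_inf_lt[_ [p /= + <-]]; rewrite gt_max => /andP[Pp p0] hp.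
exists p; first exact: ltW.
have pV : 0 < p^-1 by rewrite invr_gt0.
move: hp; case: (translation_defect mu p) => [d| |] /=.
- case: ifPn => [d0 _|]; first by rewrite lee_fin (le_trans d0)// expR_ge0.
  rewrite -ltNge => d0; rewrite -EFinM lte_fin => H; rewrite lee_fin.
  rewrite -[d]lnK ?posrE// ler_expR.
  have : p * (p^-1 * ln d) < p * (- w) by rewrite ltr_pM2l.
  rewrite mulrA divff ?gt_eqF// mul1r => /ltW; lra.
- by rewrite mulry gtr0_sg// mul1e.
- by rewrite leNye.
Qed.

(** [|z| < C_mu ^ 2 - inf] says that [|z| + |mu|_(unif, r) < C_mu ^ 2] for some
    [r]; between the two numbers there is room for [s ^ 2] and then for
    [w > s]. *)
Lemma spectral_constants (mu : local_measure R) (z : R[i]) : loc_unif mu ->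
  (0 < C_of mu)%E -> ((cabs z)%:E < E_of mu)%E ->
  exists r s w Vr : R, [/\ 0 < r, 0 < s, s < w, (w%:E < C_of mu)%E &
    variation_bound mu r Vr /\
    Vr + cabs z * r <= s ^+ 2 * r].
Proof.
move=> hmu C0; rewrite /E_of; set I := ereal_inf _; set C := C_of mu in C0 *.
have sup0 r : (0 <= ereal_sup [set var_measure mu `]a, (a + r)%R] | a in [set: R]])%E.
  apply: le_ereal_sup_tmp; exists (var_measure mu `]0, (0 + r)%R]); first by exists 0.
  exact: var_measure_ge0.
have I0 : (0 <= I)%E.
  apply: le_ereal_inf_tmp => _ [r /= r0 <-]; rewrite /unif_norm_r mule_ge0//.
  by rewrite lee_fin invr_ge0 ltW.
have Iy : (I < +oo)%E.
  apply: le_lt_trans hmu; apply: ereal_inf_lbound; exists 1 => //=.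
  by rewrite /unif_norm_r invr1 mul1e.
have Ifin : I \is a fin_num by rewrite ge0_fin_numE.
rewrite lteBrDr// => hz.
have : (I < C ^+ 2 - (cabs z)%:E)%E by rewrite lteBrDl.
move=> /ereal_inf_lt[_ [r r0 <-]]; rewrite lteBrDl// => hr.
have {}r0 : 0 < r := r0.
have rV : 0 < r^-1 by rewrite invr_gt0.
move: hr; rewrite /unif_norm_r; have := sup0 r.
have supub y : (var_measure mu `]y, (y + r)%R] <= ereal_sup
    [set var_measure mu `]a, (a + r)%R] | a in [set: R]])%E.
  by apply: ereal_sup_ubound; exists y.
move: supub; case: (ereal_sup _) => [Vr| |] supub sup0r hr; last 2 first.
- by move: hr; rewrite mulry gtr0_sg// mul1e addey// ltNge leey.
- by [].
pose a := cabs z + r^-1 * Vr.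
have a0 : 0 <= a.
  by rewrite addr_ge0 ?cabs_ge0// mulr_ge0 ?(ltW rV).
have {}hr : (a%:E < C ^+ 2)%E by rewrite /a EFinD EFinM.
suff [s [w [s0 sw wC as2]]] : exists s w : R,
    [/\ 0 < s, s < w, (w%:E < C)%E & a <= s ^+ 2].
  exists r, s, w, Vr; split=> //; split=> //.
  have -> : Vr + cabs z * r = a * r by rewrite /a; field; rewrite gt_eqF.
  by rewrite ler_pM2r.
move: C0 hr {hz}; case: C => [c| |] // C0 hr; last first.
  exists (1 + a), (2 + a); split; rewrite ?ltry//; [lra|lra|].
  by nra.
have c0 : 0 < c by rewrite -lte_fin.
have ac : a < c ^+ 2 by move: hr; rewrite -EFin_expe lte_fin.
pose q := Num.sqrt a.
have q0 : 0 <= q by exact: sqrtr_ge0.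
have qa : q ^+ 2 = a by rewrite sqr_sqrtr.
have qc : q < c by rewrite -(ltr_pXn2r (n := 2))// ?nnegrE ?(ltW c0)// qa.
exists ((q + c) / 2), ((q + 3 * c) / 4); split; rewrite ?lte_fin; [lra|lra|lra|].
by rewrite -qa; nra.
Qed.

End absence_of_eigenvalues.

Theorem mainTheorem3 (R : realType) (mu : local_measure R)
    (hmu : loc_unif mu) (hC : (0 < C_of mu)%E) :
  forall z : R[i], ((cabs z)%:E < E_of mu)%E -> ~ is_eigenvalue mu z.
Proof.
move=> z hz [u [[L2u _ cu weak_u] nz]].
have [r [s [w [Vr [r0 s0 sw wC [hVr hs]]]]]] := spectral_constants hmu hC hz.
have unif0 : (0 <= unif_norm mu)%E.
  apply: le_ereal_sup_tmp; exists (var_measure mu `]0, (0 + 1)%R]); first by exists 0.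
  exact: var_measure_ge0.
have hV : variation_bound mu 1 (fine (unif_norm mu)).
  move=> y; rewrite fineK ?ge0_fin_numE//; apply: ereal_sup_ubound; by exists y.
apply: nz; apply: aeW => x; have [_ _ L2u'] := L2u.
exact: (eigenfunction_eq0 cu weak_u L2u' hV r0 s0 sw hVr hs (frequently_small_defect wC)).
Qed.
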